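(* Let $\{X_i\}_{i\ge 1}$ be a sequence of $\chi$-valued random variables in which every $X_i$ has the same marginal density $m(x)=\int_{\Theta}p(x\mid\theta)f(\theta)\,d\mu(\theta)$ with respect to $\nu$, with $\Theta$ compact. Assume there are constants $c_0>0$ and $0<\rho<1$ such that for all $n\ge 1$ $$\sup_i E\Big[\int\Big(\frac{m(x_{i+n}\mid X_{1:i})}{m(x_{i+n})}-1\Big)^2 m(x_{i+n})\,d\nu(x_{i+n})\Big]\le c_0^2\rho^{2n}.$$ Let the initial density $f_0$ of the predictive recursion belong to the class $\mathcal F_0$ of densities supported on a compact set $\Theta_0$ (possibly different from $\Theta$), $\Theta_0$ being the support of $f_0$. Let $\tilde k=\inf_{\hat m\in\mathcal M_0}KL(m,\hat m)$, and assume there exists a unique $\tilde f\in\mathcal F_0$ such that $KL(m,\tilde m)=\tilde k$, where $\tilde m(x)=m_{\tilde f}(x)=\int_{\Theta_0}p(x\mid\theta)\tilde f(\theta)\,d\mu(\theta)$. Assume conditions B1, B2$'$, B3, B4, C1, C2, C3 stated in the context. Put $K_n^*=\int m\log(m/m_n)\,d\nu$ and $\tilde K_n^*=K_n^*-\tilde k$. Then $$\lim_{n\to\infty}\tilde K_n^*=0\quad\text{with probability one.}$$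
   Context: Setting. $\nu$ and $\mu$ are sigma-finite measures on the sample space $\chi$ and on the parameter space. $\Theta$ is a compact subset of a Euclidean space (the support of the true mixing density $f$), $\widehat\Theta$ is a closed convex set containing $\Theta$ and also $\Theta_0$, and for each $\theta\in\widehat\Theta$, $p(\cdot\mid\theta)$ is a probability density on $\chi$ with respect to $\nu$. $X_{1:i}=\{X_1,\dots,X_i\}$, and $m(\cdot\mid X_{1:i})$ in the displayed condition is the conditional density of $X_{i+n}$ given $X_{1:i}$. $KL(g,h)=\int g\log(g/h)\,d\nu$ for densities on $\chi$. $\mathcal F_0$ is the set of all densities (with respect to $\mu$) supported on $\Theta_0$, and $\mathcal M_0=\{\hat m:\hat m(x)=\int_{\Theta_0}p(x\mid\theta)\hat f(\theta)\,d\mu(\theta),\ \hat f\in\mathcal F_0\}$. Predictive recursion (PR). Starting from $f_0$ and positive weights $w_i$, define for $i\ge1$ $$f_i(\theta)=(1-w_i)f_{i-1}(\theta)+w_i\frac{p(X_i\mid\theta)f_{i-1}(\theta)}{m_{i-1}(X_i)},\qquad m_{i-1}(x)=\int p(x\mid\theta)f_{i-1}(\theta)\,d\mu(\theta);$$ each iterate $f_i$ is a mixing (probability) density and $m_i$ is the corresponding marginal density. It is assumed that $K_0^*=\int m\log(m/m_0)\,d\nu$ is finite. Conditions. There are a finite set $\Theta_H\subset\widehat\Theta$ and a compact set $\chi_c\subset\chi$ such that: C1. For some constant $c_u>1$: for any $x\notin\chi_c$ there exist $\theta_1^x,\theta_2^x\in\Theta_H$ with $\sup_{\theta,\theta'\in\Theta}\frac{p(x\mid\theta)}{p(x\mid\theta')}\le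 c_u\frac{p(x\mid\theta_2^x)}{p(x\mid\theta_1^x)}$. C2. There is $a>0$ with $\inf_{x\in\chi_c,\theta\in\Theta}p(x\mid\theta)>a$. C3. There is $b<\infty$ with $\sup_{x\in\chi_c,\theta\in\Theta}p(x\mid\theta)<b$. B1. $w_i\downarrow0$ and $w_i\sim i^{-\alpha}$ with $\alpha\in(0.5,1]$. B2$'$. There is $b_3>0$ such that for every positive integer $j$, $\sup_{\theta_1,\theta_2,\theta_3\in\widehat\Theta}E_{\theta_3}\big[\big(\frac{p(X\mid\theta_1)}{p(X\mid\theta_2)}\big)^j\big]<b_3^j$, where $E_{\theta_3}$ is expectation under $X\sim p(\cdot\mid\theta_3)$. B3. $\sup_{\theta_1,\theta_2,\theta_3\in\widehat\Theta}E_{\theta_3}\big[\big(\frac{p(X\mid\theta_1)}{p(X\mid\theta_2)}\big)^2\big]<B<\infty$. B4. For each $x\in\chi$ the map $\theta\mapsto p(x\mid\theta)$ is bounded and continuous. *)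

(* Defs.v *)
From HB Require Import structures.
From mathcomp Require Import all_boot all_order all_algebra.
From mathcomp Require Import all_classical all_reals all_analysis.

Set Implicit Arguments.
Unset Strict Implicit.
Unset Printing Implicit Defensive.

Import Order.TTheory GRing.Theory Num.Theory.
Import numFieldNormedType.Exports.

Local Open Scope classical_set_scope.
Local Open Scope ring_scope.

Notation Borel T := (g_sigma_algebraType (@open T)).

Definition is_density (R : realType) (d : measure_display)
    (T : measurableType d) (mu : {measure set T -> \bar R}) (g : T -> R) :=
  [/\ measurable_fun [set: T] g, forall t, 0 <= g t
    & (\int[mu]_t (g t)%:E = 1)%E].

Definition density_on (R : realType) (d : measure_display)
    (T : measurableType d) (mu : {measure set T -> \bar R}) (A : set T)
    (g : T -> R) :=
  is_density mu g /\ forall t, ~ A t -> g t = 0.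

(* The support of the measure g dmu. It depends only on the mu-a.e. class of
   g, unlike the closure of [set t | g t != 0]. *)
Definition density_support (R : realType) (T : ptopologicalType)
    (mu : {measure set (Borel T) -> \bar R}) (g : T -> R) : set T :=
  [set t | forall U : set T, open U -> U t ->
     (0 < \int[mu]_(u in U) (g u)%:E)%E].

(* Here x / 0 = +oo for x > 0, lne 0 = -oo, lne +oo = +oo and 0 * _ = 0, so
   the integrand is 0 where g vanishes and +oo where only h vanishes. *)
Definition KL (R : realType) (d : measure_display) (T : measurableType d)
    (nu : {measure set T -> \bar R}) (g h : T -> R) : \bar R :=
  (\int[nu]_x ((g x)%:E * lne ((g x)%:E / (h x)%:E)))%E.

Section mixtures.
Variables (R : realType) (chi Par : ptopologicalType).
Variables (nu : {sigma_finite_measure set (Borel chi) -> \bar R}).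
Variables (mu : {sigma_finite_measure set (Borel Par) -> \bar R}).
Variable p : chi -> Par -> R.

Definition mixture (A : set Par) (g : Par -> R) (x : chi) : R :=
  \int[mu]_(t in A) (p x t * g t).

Definition mixture_class (A : set Par) : set (chi -> R) :=
  [set mixture A g | g in density_on mu A].

Definition KL_inf (m : chi -> R) (A : set Par) : \bar R :=
  ereal_inf [set KL nu m mh | mh in mixture_class A].

Fixpoint PR (w : nat -> R) (X : nat -> chi) (f0 : Par -> R) (i : nat)
    : Par -> R :=
  if i is k.+1 then
    let fk := PR w X f0 k in
    fun t => (1 - w k.+1) * fk t
             + w k.+1 * (p (X k.+1) t * fk t / mixture setT fk (X k.+1))
  else f0.

(* The quotient is taken in \bar R, so that it is +oo where only the
   denominator vanishes. *)
Definition lratio (x : chi) (t1 t2 : Par) : \bar R :=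
  ((p x t1)%:E / (p x t2)%:E)%E.

Definition lratio_moment (j : nat) (t1 t2 t3 : Par) : \bar R :=
  (\int[nu]_x (lratio x t1 t2 ^+ j * (p x t3)%:E))%E.

Definition sup_lratio_moment (That : set Par) (j : nat) : \bar R :=
  ereal_sup [set lratio_moment j t.1.1 t.1.2 t.2
            | t in (That `*` That) `*` That].

Definition condC1 (Theta ThetaH : set Par) (chic : set chi) :=
  exists2 cu : R, 1 < cu & forall x, ~ chic x ->
    exists t1, exists t2, [/\ ThetaH t1, ThetaH t2 &
      (ereal_sup [set lratio x t.1 t.2 | t in Theta `*` Theta]
         <= cu%:E * lratio x t2 t1)%E].

Definition condC2 (Theta : set Par) (chic : set chi) :=
  exists2 a : R, 0 < a &
    (a%:E < ereal_inf [set (p z.1 z.2)%:E | z in chic `*` Theta])%E.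

Definition condC3 (Theta : set Par) (chic : set chi) :=
  exists b : R,
    (ereal_sup [set (p z.1 z.2)%:E | z in chic `*` Theta] < b%:E)%E.

Definition condB2' (That : set Par) :=
  exists2 b3 : R, 0 < b3 & forall j : nat, (0 < j)%N ->
    (sup_lratio_moment That j < (b3 ^+ j)%:E)%E.

Definition condB3 (That : set Par) :=
  exists B : R, (sup_lratio_moment That 2 < B%:E)%E.

Definition condB4 (That : set Par) :=
  forall x, [bounded p x t : R^o | t in That] /\
            {within That, continuous (p x)}.

End mixtures.

(* The bound w i <= 1 is what makes the predictive recursion iterates
   nonnegative. *)
Definition condB1 (R : realType) (w : nat -> R) :=
  [/\ forall i, (0 < i)%N -> 0 < w i <= 1,
      forall i j, (0 < i <= j)%N -> w j <= w i,
      w @ \oo --> (0 : R)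
    & exists2 alpha : R, 2^-1 < alpha <= 1 &
        (w : nat -> R^o) ~_\oo (fun i => (i%:R `^ (- alpha) : R^o))].

Section process.
Variables (R : realType) (dO : measure_display) (Omega : measurableType dO).
Variables (P : probability Omega R) (chi : ptopologicalType).
Variables (nu : {sigma_finite_measure set (Borel chi) -> \bar R}).
(* The process is X 1, X 2, etc.; X 0 plays no role. *)
Variable X : nat -> {RV P >-> Borel chi}.

Definition has_density (Y : {RV P >-> Borel chi}) (g : chi -> R) :=
  forall B : set (Borel chi), measurable B ->
    distribution P Y B = (\int[nu]_(x in B) (g x)%:E)%E.

Definition past (i : nat) (om : Omega) : i.-tuple (Borel chi) :=
  [tuple X k.+1 om | k < i].

Definition is_cond_density (i k : nat)
    (g : i.-tuple (Borel chi) -> chi -> R) :=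
  [/\ measurable_fun [set: i.-tuple (Borel chi) * Borel chi]
        (fun z => g z.1 z.2),
      forall y x, 0 <= g y x
    & forall (A : set (i.-tuple (Borel chi))) (B : set (Borel chi)),
        measurable A -> measurable B ->
        P (past i @^-1` A `&` X k @^-1` B) =
        (\int[P]_(om in past i @^-1` A)
            \int[nu]_(x in B) (g (past i om) x)%:E)%E].

(* The quotient by m x is irrelevant where m x = 0, as it is weighted by m x. *)
Definition chi2_dependence (m : chi -> R) (i : nat)
    (g : i.-tuple (Borel chi) -> chi -> R) : \bar R :=
  (\int[P]_om \int[nu]_x
     ((g (past i om) x / m x - 1) ^+ 2 * m x)%:E)%E.

End process.

(* Main.v *)
From HB Require Import structures.
Require Import Defs.
From mathcomp Require Import all_boot all_order all_algebra.
From mathcomp Require Import all_classical all_reals all_analysis.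
From mathcomp Require Import measurable_realfun ring lra zify.

(** The kernel is divided by one of its values, which makes it bounded above and
    below, and predictive recursion for the bounded kernel is analysed with two
    Lyapunov functions: the Kullback-Leibler divergence itself, and the relative
    entropy of a competitor with respect to the current mixing density.

    Reduction to a bounded kernel. The moment bounds of all orders force
    [p x s <= c * p x t] for almost every [x] ([moment_ratio_bound]) and, by
    continuity and separability, for all [s] and [t] in the compact set [K], the
    union of [Theta] and [Theta0], at once ([ratio_le]). Hence [kratio], the
    kernel divided by its value at one fixed parameter, takes values between
    [b^-1] and [b = c + 1]. Let [F] be the initial mixing distribution and [M]
    the law of an observation. The iterates have densities [tilt] with respect
    to [F] that are driven by [kratio] alone ([PR_tilt]). The loss [J u] of a
    density [u] is the mean under [M] of minus the logarithm of the predictive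
    density of [u] for [kratio], and [kappa] is its infimum over bounded [u];
    then the excess divergence of the iterates is [V n = J (tilt n) - kappa]
    ([KL_excess]). That bounded [u] suffice to reach the infimum over all
    densities on [Theta0] is where the support of the initial density enters: a
    point of [Theta0] can be replaced by an average, under [F], over a small
    neighbourhood ([bounded_density_approx]).

    The independent case. One update of size [w] changes the loss by at most
    [- w * (drift - 1)] up to order [w ^ 2] ([log_loss_update]), and the drift
    has mean at least [1] by Jensen ([mean_drift_ge1]); so [V] is a
    supermartingale up to summable errors. The relative entropy of a competitor
    [us] drops by [w * (gain - 1)] up to order [w ^ 2] ([entropy_update]), where
    the gain has mean at least [1 + J u - J us] ([mean_gain]). As this entropy
    is bounded below, the sum of [w i * (E J - J us)] is bounded, while the sum
    of the [w i] diverges; so the lower limit of [E V] is [0]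
    ([liminf_mean_loss]).

    Dependence. Given the first [k] observations, the [i]-th one has law [M] up
    to a total variation error of mean at most [c0 * rho ^ (i - k)]
    ([decorrelation_chi2]), and the iterate [i - 1] is within the sum of the
    steps [w j], [k < j < i], of the iterate [k], in [L1] ([tilt_lip]). Taking
    [i - k] a multiple of [log i] makes the total error summable, because
    [alpha > 1 / 2] ([sum_lag_error]). The maximal inequality that turns
    [E V N] small into [V] uniformly small after [N] with high probability
    ([excess_maximal]) stops the process at the first exit above a level; the
    indicator of being still alive must be read with the same lag, and the two
    readings differ only during a window of logarithmic length after the exit,
    over which the steps add up to little ([sum_lag_straddle]). *)

Set Implicit Arguments.
Unset Strict Implicit.
Unset Printing Implicit Defensive.

Import Order.TTheory GRing.Theory Num.Theory.
Import numFieldNormedType.Exports.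

Local Open Scope classical_set_scope.
Local Open Scope ring_scope.

(** * Bounded measurable functions *)

Section bounded_functions.
Context {R : realType}.

Definition bmf d (T : measurableType d) (g : T -> R) :=
  measurable_fun [set: T] g /\ exists C, forall x, `|g x| <= C.

Lemma measurable_inv d (T : measurableType d) (g : T -> R) :
  measurable_fun [set: T] g -> measurable_fun [set: T] (fun x => (g x)^-1).
Proof.
move=> mg.
rewrite (_ : (fun _ => _) = fun x => g x * expR (- (2 * ln `|g x|))).
  apply: measurable_funM => //; apply: (measurableT_comp (@measurable_expR R)).
  apply: measurable_funN; apply: measurable_funM => //.
  apply: (measurableT_comp (@measurable_ln R)).
  exact: (measurableT_comp (@normr_measurable R setT)).
apply/funext => x; have [->|g0] := eqVneq (g x) 0; first by rewrite invr0 mul0r.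
have n0 : 0 < `|g x| by rewrite normr_gt0.
rewrite expRN mulrDl !mul1r expRD !lnK ?posrE// -expr2 real_normK ?num_real//.
by rewrite expr2 invfM mulrA divff// mul1r.
Qed.

Context d (T : measurableType d).
Implicit Types g h : T -> R.

Lemma bmf_cst c : bmf (fun _ : T => c).
Proof. by split=> //; exists `|c|. Qed.

Lemma bmfD g h : bmf g -> bmf h -> bmf (fun x => g x + h x).
Proof.
move=> [mg [C gC]] [mh [D hD]]; split; first exact: measurable_funD.
by exists (C + D) => x; rewrite (le_trans (ler_normD _ _))// lerD.
Qed.

Lemma bmfN g : bmf g -> bmf (fun x => - g x).
Proof.
move=> [mg [C gC]]; split; first exact: measurable_funN.
by exists C => x; rewrite normrN.
Qed.

Lemma bmfB g h : bmf g -> bmf h -> bmf (fun x => g x - h x).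
Proof. by move=> bg bh; apply: bmfD => //; exact: bmfN. Qed.

Lemma bmfM g h : bmf g -> bmf h -> bmf (fun x => g x * h x).
Proof.
move=> [mg [C gC]] [mh [D hD]]; split; first exact: measurable_funM.
by exists (C * D) => x; rewrite normrM ler_pM.
Qed.

Lemma bmfZ c g : bmf g -> bmf (fun x => c * g x).
Proof. by move=> bg; apply: bmfM => //; exact: bmf_cst. Qed.

Lemma bmf_norm g : bmf g -> bmf (fun x => `|g x|).
Proof.
move=> [mg [C gC]]; split; last by exists C => x; rewrite normr_id.
exact: (measurableT_comp (@normr_measurable R setT)).
Qed.

Lemma bmfV c g : 0 < c -> (forall x, c <= g x) -> measurable_fun setT g ->
  bmf (fun x => (g x)^-1).
Proof.
move=> c0 cg mg; split; first exact: measurable_inv.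
exists c^-1 => x; have g0 : 0 < g x by exact: lt_le_trans (cg x).
by rewrite ger0_norm ?invr_ge0 ?(ltW g0)// lef_pV2// posrE.
Qed.

Lemma bmf_ln c g : 0 < c -> (forall x, c <= g x) -> bmf g ->
  bmf (fun x => ln (g x)).
Proof.
move=> c0 cg [mg [C gC]]; split; first exact: (measurableT_comp (@measurable_ln R)).
exists (`|ln c| + `|ln C|) => x.
have g0 : 0 < g x by exact: lt_le_trans (cg x).
have gleC : g x <= C by apply: le_trans (gC x); exact: ler_norm.
have C0 : 0 < C by exact: lt_le_trans gleC.
have h1 : ln c <= ln (g x) by rewrite ler_ln ?posrE.
have h2 : ln (g x) <= ln C by rewrite ler_ln ?posrE.
have := ler_norm (ln C); have := ler_norm (- ln c); rewrite normrN => h3 h4.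
have h5 := normr_ge0 (ln c); have h6 := normr_ge0 (ln C).
rewrite ler_norml; apply/andP; split; lra.
Qed.

Lemma bmf_comp d' (Z : measurableType d') (g : T -> R) (h : Z -> T) :
  bmf g -> measurable_fun setT h -> bmf (fun z => g (h z)).
Proof.
move=> [mg [C gC]] mh; split; last by exists C => x; exact: gC.
exact: measurableT_comp.
Qed.

Variable P : probability T R.

Lemma bmf_integrable g : bmf g -> P.-integrable setT (EFin \o g).
Proof.
move=> [mg [C gC]]; apply: measurable_bounded_integrable => //.
  exact: (le_lt_trans (probability_le1 _ _) (ltry _)).
exists C; split; first exact: num_real.
by move=> M CM x _ /=; rewrite (le_trans (gC x))// ltW.
Qed.

Lemma bmf_EFin g : bmf g -> (\int[P]_x (g x)%:E)%E = (\int[P]_x g x)%:E.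
Proof. by move=> /bmf_integrable ig; rewrite /Rintegral fineK// integrable_fin_num. Qed.

Lemma meanD g h : bmf g -> bmf h ->
  \int[P]_x (g x + h x) = \int[P]_x g x + \int[P]_x h x.
Proof. by move=> /bmf_integrable ? /bmf_integrable ?; rewrite RintegralD. Qed.

Lemma meanB g h : bmf g -> bmf h ->
  \int[P]_x (g x - h x) = \int[P]_x g x - \int[P]_x h x.
Proof. by move=> /bmf_integrable ? /bmf_integrable ?; rewrite RintegralB. Qed.

Lemma meanZ c g : bmf g -> \int[P]_x (c * g x) = c * \int[P]_x g x.
Proof. by move=> /bmf_integrable ?; rewrite RintegralZl. Qed.

Lemma mean_cst c : \int[P]_(x in setT) c = c.
Proof. by rewrite Rintegral_cst//= probability_setT mulr1. Qed.

Lemma le_mean g h : bmf g -> bmf h -> (forall x, g x <= h x) ->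
  \int[P]_x g x <= \int[P]_x h x.
Proof. by move=> /bmf_integrable ? /bmf_integrable ? gh; apply: le_Rintegral. Qed.

Lemma mean_le_cst g c : bmf g -> (forall x, g x <= c) -> \int[P]_x g x <= c.
Proof. by move=> bg gc; rewrite -[leRHS]mean_cst; apply: le_mean => //; exact: bmf_cst. Qed.

Lemma mean_ge_cst g c : bmf g -> (forall x, c <= g x) -> c <= \int[P]_x g x.
Proof. by move=> bg gc; rewrite -[leLHS]mean_cst; apply: le_mean => //; exact: bmf_cst. Qed.

Lemma norm_mean g : bmf g -> `|\int[P]_x g x| <= \int[P]_x `|g x|.
Proof. by move=> /bmf_integrable ig; apply: le_normr_Rintegral. Qed.

Lemma mean_sum (F : nat -> T -> R) m n : (forall i, bmf (F i)) ->
  bmf (fun x => \sum_(m <= i < n) F i x) /\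
  \int[P]_x (\sum_(m <= i < n) F i x) = \sum_(m <= i < n) \int[P]_x F i x.
Proof.
move=> bF; elim: n => [|n [bn IH]].
  rewrite big_geq//; under eq_fun do rewrite big_geq//.
  by split; [exact: bmf_cst|rewrite mean_cst].
have [mn|nm] := leqP m n; last first.
  rewrite big_geq//; under eq_fun do rewrite big_geq//.
  by split; [exact: bmf_cst|rewrite mean_cst].
rewrite big_nat_recr//=; under eq_fun do rewrite big_nat_recr//=.
by split; [exact: bmfD|rewrite meanD// IH].
Qed.

End bounded_functions.

Section mean_product.
Context {R : realType} d1 d2 (Z : measurableType d1) (S : measurableType d2).
Implicit Types g : Z * S -> R.

Lemma bmf_sliceL g z : bmf g -> bmf (fun s => g (z, s)).
Proof. by move=> bg; apply: (bmf_comp bg); exact: pair1_measurable. Qed.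

Lemma bmf_sliceR g s : bmf g -> bmf (fun z => g (z, s)).
Proof. by move=> bg; apply: (bmf_comp bg); exact: pair2_measurable. Qed.

Lemma bmf_mean (F : probability S R) g : bmf g ->
  bmf (fun z => \int[F]_s g (z, s)).
Proof.
move=> bg; have [mg [C gC]] := bg.
have sl z : bmf (fun s => g (z, s)) by exact: bmf_sliceL.
split; last first.
  exists C => z; apply: (le_trans (norm_mean _ (sl z))).
  by apply: mean_le_cst => //; apply: bmf_norm.
rewrite (_ : (fun _ => _) =
    (fun z => fine (\int[F]_s ((g (z, s) + C)%:E))%E - C)).
  apply: measurable_funB => //; apply: (measurableT_comp (@fine_measurable R setT measurableT)).
  apply: (measurable_fun_fubini_tonelli_F (fun zs => (g zs + C)%:E)).
    by apply/measurable_EFinP; exact: measurable_funD.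
  by move=> zs; rewrite lee_fin; have := gC zs; rewrite ler_norml => /andP[]; lra.
apply/funext => z.
have -> : fine (\int[F]_s ((g (z, s) + C)%:E))%E = \int[F]_s (g (z, s) + C) by [].
by rewrite meanD//; [rewrite mean_cst addrK|exact: bmf_cst].
Qed.

Lemma mean_swap (P : probability Z R) (F : probability S R) g : bmf g ->
  \int[P]_z (\int[F]_s g (z, s)) = \int[F]_s (\int[P]_z g (z, s)).
Proof.
move=> bg; have [mg [C gC]] := bg.
have big : (P \x F)%E.-integrable setT (EFin \o g).
  apply/integrable12ltyP; first exact/measurable_EFinP.
  apply: (@le_lt_trans _ _ (\int[P]_z (\int[F]_s C%:E))%E).
    apply: ge0_le_integral => //=.
    - by move=> z _; apply: integral_ge0 => *; rewrite lee_fin.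
    - apply: (measurable_fun_fubini_tonelli_F (fun zs => (`|g zs|)%:E)) => //.
      by apply/measurable_EFinP; exact: measurableT_comp.
    - move=> z _; apply: ge0_le_integral => //=.
      + apply/measurable_EFinP; apply: measurableT_comp => //.
        by have [] := bmf_sliceL z bg.
      + by move=> *; rewrite lee_fin.
  under eq_integral do rewrite integral_cst//= probability_setT mule1.
  by rewrite integral_cst//= probability_setT mule1 ltry.
have := @Fubini _ _ _ _ _ P F _ big.
rewrite /= => /(congr1 fine).
rewrite /Rintegral; congr (fine _ = fine _); apply: eq_integral => z _.
  by rewrite fineK// -/(\int[F]_s g (z, s)) integrable_fin_num//; exact: (bmf_integrable _ (bmf_sliceL z bg)).
by rewrite fineK// integrable_fin_num//; exact: (bmf_integrable _ (bmf_sliceR z bg)).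
Qed.

End mean_product.

(** * One step of predictive recursion *)

Section elementary.
Context {R : realType}.
Implicit Types a b x y z : R.

Lemma ln_upper z : 0 < z -> ln z <= z - 1.
Proof. by move=> z0; have := @le_ln1Dx R (z - 1); rewrite (addrC 1) subrK; apply; lra. Qed.

(** From [ln z^-1 <= z^-1 - 1]. *)
Lemma ln_lower a z : 1 <= a -> a^-1 <= z ->
  (z - 1) - a * (z - 1) ^+ 2 <= ln z.
Proof.
move=> a1 az; have a0 : 0 < a by lra.
have z0 : 0 < z by apply: lt_le_trans az; rewrite invr_gt0.
have zi0 : 0 < z^-1 by rewrite invr_gt0.
have zia : z^-1 <= a by rewrite -[a]invrK lef_pV2// posrE ?invr_gt0.
have h : ln z^-1 <= z^-1 - 1.
  exact: ln_upper.
move: h; rewrite lnV ?posrE// => h.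
have e : 1 - z^-1 = (z - 1) - z^-1 * (z - 1) ^+ 2 by field; lra.
have s : 0 <= (z - 1) ^+ 2 by exact: sqr_ge0.
have : z^-1 * (z - 1) ^+ 2 <= a * (z - 1) ^+ 2 by apply: ler_wpM2r.
lra.
Qed.

Lemma ln_lipschitz c x y : 0 < c -> c <= x -> c <= y ->
  `|ln x - ln y| <= c^-1 * `|x - y|.
Proof.
move=> c0.
have H u v : c <= u -> c <= v -> ln u - ln v <= c^-1 * `|u - v|.
  move=> cu cv; have u0 : 0 < u by lra.
  have v0 : 0 < v by lra.
  rewrite -ln_div ?posrE//; apply: (le_trans (ln_upper _)); first by rewrite divr_gt0.
  have -> : u / v - 1 = v^-1 * (u - v) by field; lra.
  apply: (@le_trans _ _ (v^-1 * `|u - v|)).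
    by apply: ler_wpM2l (ler_norm _); rewrite invr_ge0 ltW.
  by apply: ler_wpM2r => //; rewrite lef_pV2 ?posrE.
move=> cx cy; rewrite ler_norml; apply/andP; split; last exact: H.
by have := H _ _ cy cx; rewrite distrC; lra.
Qed.

Lemma exists_invS_le x : 0 < x -> exists n : nat, n.+1%:R^-1 <= x.
Proof.
move=> x0; exists (Num.bound x^-1); rewrite -[leRHS]invrK lef_pV2 ?posrE ?invr_gt0//.
apply/ltW/(lt_trans (archi_boundP _)); first by rewrite invr_ge0 ltW.
by rewrite ltr_nat.
Qed.

Lemma norm_mulB x x' y y' c c' : `|x| <= c -> `|y'| <= c' ->
  `|x * y - x' * y'| <= c * `|y - y'| + c' * `|x - x'|.
Proof.
move=> xc yc; rewrite (_ : _ - _ = x * (y - y') + y' * (x - x')); last by ring.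
by rewrite (le_trans (ler_normD _ _))// lerD// normrM ler_wpM2r.
Qed.

Lemma norm_invB c x y : 0 < c -> c^-1 <= x -> c^-1 <= y ->
  `|x^-1 - y^-1| <= c ^+ 2 * `|x - y|.
Proof.
move=> c0 cx cy; have ci0 : 0 < c^-1 by rewrite invr_gt0.
have x0 : 0 < x by lra.
have y0 : 0 < y by lra.
rewrite (_ : _ - _ = (x^-1 * y^-1) * (y - x)); last by field; lra.
have xi : 0 < x^-1 by rewrite invr_gt0.
have yi : 0 < y^-1 by rewrite invr_gt0.
rewrite normrM distrC ler_wpM2r// normrM !gtr0_norm// expr2.
by apply: ler_pM; try exact: ltW; rewrite -[leRHS]invrK lef_pV2 ?posrE.
Qed.

End elementary.

Section step.
Context {R : realType} d1 d2 (T : measurableType d1) (S : measurableType d2).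
Variables (M : probability T R) (F : probability S R) (r : T -> S -> R) (b : R).
Hypothesis mr : measurable_fun setT (fun z : T * S => r z.1 z.2).
Hypothesis b1 : 1 <= b.
Hypothesis rb : forall x t, b^-1 <= r x t <= b.

Let b0 : 0 < b. Proof. exact: lt_le_trans ltr01 b1. Qed.
Let bi0 : 0 < b^-1. Proof. by rewrite invr_gt0. Qed.

Lemma r_gt0 x t : 0 < r x t.
Proof. by have /andP[+ _] := rb x t; exact: lt_le_trans. Qed.

Lemma bmf_r : bmf (fun z : T * S => r z.1 z.2).
Proof.
by split=> //; exists b => -[x t] /=; rewrite gtr0_norm ?r_gt0//; have /andP[] := rb x t.
Qed.

Lemma bmf_rl x : bmf (r x).
Proof. exact: (bmf_sliceL x bmf_r). Qed.

Lemma bmf_rr t : bmf (r^~ t).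
Proof. exact: (bmf_sliceR t bmf_r). Qed.

Definition mix_density (u : S -> R) :=
  [/\ bmf u, forall t, 0 <= u t & \int[F]_t u t = 1].

Definition predictive (u : S -> R) (x : T) : R := \int[F]_t (r x t * u t).

Definition log_loss (u : S -> R) : R := - \int[M]_x ln (predictive u x).

Definition update (w : R) (y : T) (u : S -> R) (t : S) : R :=
  u t * (1 + w * (r y t / predictive u y - 1)).

(** The ratio of the updated to the current predictive density at [x] is
    [1 + w * (overlap u y x - 1)]. *)
Definition overlap (u : S -> R) (y x : T) : R :=
  (\int[F]_t (r x t * r y t * u t)) / (predictive u y * predictive u x).

Definition drift (u : S -> R) (y : T) : R := \int[M]_x overlap u y x.

Lemma bmf_ru x u : bmf u -> bmf (fun t => r x t * u t).
Proof. by move=> bu; apply: bmfM => //; exact: bmf_rl. Qed.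

Lemma bmf_rru x y u : bmf u -> bmf (fun t => r x t * r y t * u t).
Proof. by move=> bu; apply: bmfM => //; apply: bmfM; exact: bmf_rl. Qed.

Lemma predictive_bounds u x : mix_density u -> b^-1 <= predictive u x <= b.
Proof.
move=> [bu u0 u1].
have h c : \int[F]_t (c * u t) = c by rewrite meanZ// u1 mulr1.
rewrite -{1}(h b^-1) -{2}(h b) /predictive.
by apply/andP; split; apply: le_mean => //; (try exact: bmf_ru);
  (try exact: bmfZ) => t; apply: ler_wpM2r => //; have /andP[] := rb x t.
Qed.

Lemma predictive_gt0 u x : mix_density u -> 0 < predictive u x.
Proof. by move=> /predictive_bounds - /(_ x) /andP[+ _]; exact: lt_le_trans. Qed.

Lemma bmf_param_predictive d (Z : measurableType d) (U : Z -> S -> R) :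
  bmf (fun z : Z * S => U z.1 z.2) ->
  bmf (fun z : Z * T => predictive (U z.1) z.2).
Proof.
move=> bU; apply: (bmf_mean F (g := fun z : (Z * T) * S => r z.1.2 z.2 * U z.1.1 z.2)).
apply: bmfM.
  apply: (bmf_comp bmf_r (h := fun z : (Z * T) * S => (z.1.2, z.2))).
  by apply: measurable_fun_pair => //; apply: measurableT_comp.
apply: (bmf_comp bU (h := fun z : (Z * T) * S => (z.1.1, z.2))).
by apply: measurable_fun_pair => //; apply: measurableT_comp.
Qed.

Lemma bmf_predictive u : mix_density u -> bmf (predictive u).
Proof.
move=> [bu _ _].
apply: (bmf_sliceL tt (g := fun z : unit * T => predictive u z.2)).
apply: (bmf_param_predictive (U := fun=> u)).
exact: (bmf_comp bu).
Qed.

Lemma bmf_ln_predictive u : mix_density u -> bmf (fun x => ln (predictive u x)).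
Proof.
move=> du; apply: (bmf_ln bi0); last exact: bmf_predictive.
by move=> x; have /andP[] := predictive_bounds x du.
Qed.

Lemma bmf_invpred u : mix_density u -> bmf (fun x => (predictive u x)^-1).
Proof.
move=> du; apply: (bmfV bi0); last by have [] := bmf_predictive du.
by move=> x; have /andP[] := predictive_bounds x du.
Qed.

Lemma invpred_bounds u x : mix_density u -> 0 < (predictive u x)^-1 <= b.
Proof.
move=> du; have /andP[h1 h2] := predictive_bounds x du.
have p0 := predictive_gt0 x du; rewrite invr_gt0 p0/=.
by rewrite -[leRHS]invrK lef_pV2 ?posrE.
Qed.

Lemma ratio_bounds u y t : mix_density u ->
  (b ^+ 2)^-1 <= r y t / predictive u y <= b ^+ 2.
Proof.
move=> du; have /andP[h1 h2] := predictive_bounds y du.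
have p0 := predictive_gt0 y du; have /andP[h3 h4] := rb y t.
have /andP[i1 i2] := invpred_bounds y du.
rewrite expr2 invfM; apply/andP; split; apply: ler_pM => //; try exact: ltW.
  by rewrite lef_pV2 ?posrE.
exact: ltW (r_gt0 _ _).
Qed.

Let A := b ^+ 2.
Let A1 : 1 <= A. Proof. exact: exprn_ege1. Qed.
Let A0 : 0 < A. Proof. exact: lt_le_trans ltr01 A1. Qed.
Let Ai0 : 0 < A^-1. Proof. by rewrite invr_gt0. Qed.

Lemma convex_bounds (w z : R) : 0 <= w <= 1 -> A^-1 <= z <= A ->
  [/\ A^-1 <= 1 + w * (z - 1), 1 + w * (z - 1) <= A & `|w * (z - 1)| <= w * A].
Proof.
move=> /andP[w0 w1] /andP[z1 z2].
have A1' := A1; have Ai0' := Ai0.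
have Ai1 : A^-1 <= 1 by rewrite invf_le1.
split; [nra|nra|].
rewrite normrM (ger0_norm w0); apply: ler_wpM2l => //.
rewrite ler_norml; apply/andP; split; lra.
Qed.

Lemma mean_ru_gt0 x y u : mix_density u -> 
  b^-1 * predictive u y <= \int[F]_t (r x t * r y t * u t) <= b * predictive u y.
Proof.
move=> [bu u0 u1]; have br := bmf_ru y bu; rewrite /predictive -!(meanZ _ _ br).
apply/andP; split; apply: le_mean; try exact: bmf_rru.
- by apply/bmfZ/bmf_ru.
- move=> t; rewrite -mulrA ler_wpM2r ?mulr_ge0//; first exact/ltW/r_gt0.
  by have /andP[] := rb x t.
- by apply/bmfZ/bmf_ru.
- move=> t; rewrite -mulrA ler_wpM2r ?mulr_ge0//; first exact/ltW/r_gt0.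
  by have /andP[] := rb x t.
Qed.

Lemma overlap_bounds u y x : mix_density u -> A^-1 <= overlap u y x <= A.
Proof.
move=> du; have /andP[h1 h2] := mean_ru_gt0 x y du.
have p0 := predictive_gt0 y du; have /andP[i1 i2] := invpred_bounds x du.
have /andP[_ j2] := predictive_bounds x du.
have px0 := predictive_gt0 x du.
have -> : overlap u y x = (\int[F]_t (r x t * r y t * u t)) / predictive u y *
    (predictive u x)^-1.
  by rewrite /overlap; field; rewrite !gt_eqF.
have k1 : b^-1 <= (\int[F]_t (r x t * r y t * u t)) / predictive u y.
  by rewrite ler_pdivlMr.
have k2 : (\int[F]_t (r x t * r y t * u t)) / predictive u y <= b.
  by rewrite ler_pdivrMr.
rewrite /A expr2 invfM; apply/andP; split; apply: ler_pM => //; try exact: ltW.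
  by rewrite lef_pV2 ?posrE.
by apply: le_trans k1; exact: ltW.
Qed.

Lemma update_ge0 w y u t : mix_density u -> 0 <= w <= 1 ->
  [/\ A^-1 * u t <= update w y u t, update w y u t <= A * u t
    & `|update w y u t - u t| <= w * A * u t].
Proof.
move=> du w01; have [_ u0 _] := du.
have [h1 h2 h3] := convex_bounds w01 (ratio_bounds y t du).
rewrite /update; split.
- by rewrite mulrC ler_wpM2l.
- by rewrite [leRHS]mulrC ler_wpM2l.
- rewrite mulrDr mulr1 (addrC (u t)) addrK normrM mulrC (ger0_norm (u0 _)).
  by rewrite ler_wpM2r.
Qed.

Lemma mix_density_update w y u : mix_density u -> 0 <= w <= 1 ->
  mix_density (update w y u).
Proof.
move=> du w01; have [bu u0 u1] := du.
have bq : bmf (fun t => u t * (1 + w * (r y t / predictive u y - 1))).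
  apply: bmfM => //; apply: bmfD; first exact: bmf_cst.
  apply: bmfZ; apply: bmfB; last exact: bmf_cst.
  by apply: bmfM; [exact: bmf_rl|exact: bmf_cst].
split=> //.
  move=> t; have [h _ _] := update_ge0 y t du w01; apply: le_trans h.
  by rewrite mulr_ge0// ltW.
transitivity (\int[F]_t ((1 - w) * u t + (w / predictive u y) * (r y t * u t))).
  by apply: eq_Rintegral => t _; rewrite /update; ring.
have br := bmf_ru y bu.
rewrite meanD ?meanZ//; try exact: bmfZ.
rewrite u1 -/(predictive u y) mulfVK ?gt_eqF ?predictive_gt0//; ring.
Qed.

Lemma predictive_update w y u x : mix_density u ->
  predictive (update w y u) x = predictive u x * (1 + w * (overlap u y x - 1)).
Proof.
move=> du; have [bu u0 u1] := du.
transitivity (\int[F]_t ((1 - w) * (r x t * u t) +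
    (w / predictive u y) * (r x t * r y t * u t))).
  by apply: eq_Rintegral => t _; rewrite /update; ring.
have br := bmf_ru x bu; have brr := bmf_rru x y bu.
rewrite meanD ?meanZ//; try exact: bmfZ.
rewrite -/(predictive u x) /overlap; field.
by rewrite !gt_eqF ?predictive_gt0.
Qed.

Lemma bmf_param_overlap d (Z : measurableType d) (U : Z -> S -> R) :
  bmf (fun z : Z * S => U z.1 z.2) -> (forall z, mix_density (U z)) ->
  bmf (fun z : (Z * T) * T => overlap (U z.1.1) z.1.2 z.2).
Proof.
move=> bU dU; have bP := bmf_param_predictive bU.
have bi : bmf (fun z : Z * T => (predictive (U z.1) z.2)^-1).
  apply: (bmfV bi0); last by have [] := bP.
  by move=> z; have /andP[] := predictive_bounds z.2 (dU z.1).
rewrite (_ : (fun _ => _) = fun z => (\int[F]_t (r z.2 t * r z.1.2 t * U z.1.1 t))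
   * ((predictive (U z.1.1) z.1.2)^-1 * (predictive (U z.1.1) z.2)^-1)); last first.
  by apply/funext => z; rewrite /overlap invfM.
apply: bmfM.
  apply: (bmf_mean F (g := fun z : ((Z * T) * T) * S =>
    r z.1.2 z.2 * r z.1.1.2 z.2 * U z.1.1.1 z.2)).
  apply: bmfM; first apply: bmfM.
  - apply: (bmf_comp bmf_r (h := fun z : ((Z * T) * T) * S => (z.1.2, z.2))).
    by apply: measurable_fun_pair => //; apply: measurableT_comp.
  - apply: (bmf_comp bmf_r (h := fun z : ((Z * T) * T) * S => (z.1.1.2, z.2))).
    apply: measurable_fun_pair => //; apply: measurableT_comp => //.
    exact: measurableT_comp.
  - apply: (bmf_comp bU (h := fun z : ((Z * T) * T) * S => (z.1.1.1, z.2))).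
    apply: measurable_fun_pair => //; apply: measurableT_comp => //.
    exact: measurableT_comp.
apply: bmfM.
  exact: (bmf_comp bi measurable_fst).
apply: (bmf_comp bi (h := fun z : (Z * T) * T => (z.1.1, z.2))).
by apply: measurable_fun_pair => //; apply: measurableT_comp.
Qed.

Lemma bmf_param_drift d (Z : measurableType d) (U : Z -> S -> R) :
  bmf (fun z : Z * S => U z.1 z.2) -> (forall z, mix_density (U z)) ->
  bmf (fun z : Z * T => drift (U z.1) z.2).
Proof.
by move=> bU dU; apply: (bmf_mean M (g := fun z : (Z * T) * T =>
  overlap (U z.1.1) z.1.2 z.2)); exact: bmf_param_overlap.
Qed.

Lemma bmf_param_log_loss d (Z : measurableType d) (U : Z -> S -> R) :
  bmf (fun z : Z * S => U z.1 z.2) -> (forall z, mix_density (U z)) ->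
  bmf (fun z => log_loss (U z)).
Proof.
move=> bU dU; apply: bmfN.
apply: (bmf_mean M (g := fun z : Z * T => ln (predictive (U z.1) z.2))).
apply: (bmf_ln bi0); last exact: bmf_param_predictive.
by move=> z; have /andP[] := predictive_bounds z.2 (dU z.1).
Qed.

Lemma bmf_overlap2 u : mix_density u ->
  bmf (fun z : T * T => overlap u z.1 z.2).
Proof.
move=> du; have [bu _ _] := du.
have := @bmf_param_overlap _ unit (fun=> u) (bmf_comp bu measurable_snd) (fun=> du).
move=> h; apply: (bmf_comp h (h := fun z : T * T => ((tt, z.1), z.2))).
by apply: measurable_fun_pair => //; apply: measurable_fun_pair.
Qed.

Lemma bmf_overlap u y : mix_density u -> bmf (overlap u y).
Proof. by move=> /bmf_overlap2; exact: (bmf_sliceL y). Qed.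

Lemma bmf_drift u : mix_density u -> bmf (drift u).
Proof. by move=> /bmf_overlap2; exact: bmf_mean. Qed.

Lemma drift_bounds u y : mix_density u -> 0 <= drift u y <= A.
Proof.
move=> du; have bo := bmf_overlap y du; apply/andP; split.
  apply: mean_ge_cst => // x; have /andP[+ _] := overlap_bounds y x du.
  by apply: le_trans; exact: ltW.
by apply: mean_le_cst => // x; have /andP[] := overlap_bounds y x du.
Qed.

(** The predictive densities before and after differ by the factor
    [1 + w * (overlap - 1)], whose logarithm is expanded to first order. *)
Lemma log_loss_update w y u : mix_density u -> 0 <= w <= 1 ->
  log_loss (update w y u) <= log_loss u - w * (drift u y - 1) + A ^+ 3 * w ^+ 2.
Proof.
move=> du w01; have du' := mix_density_update y du w01.
have bo := bmf_overlap y du; have bl := bmf_ln_predictive du.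
have bl' := bmf_ln_predictive du'.
have bo1 : bmf (fun x => w * (overlap u y x - 1)).
  by apply: bmfZ; apply: bmfB => //; exact: bmf_cst.
have key x : ln (predictive u x) + w * (overlap u y x - 1) - A ^+ 3 * w ^+ 2
    <= ln (predictive (update w y u) x).
  have [h1 h2 h3] := convex_bounds w01 (overlap_bounds y x du).
  rewrite predictive_update// lnM ?posrE ?predictive_gt0//; last first.
    exact: lt_le_trans h1.
  rewrite -addrA lerD2l; have := ln_lower A1 h1.
  rewrite [1 + _]addrC addrK; apply: le_trans.
  rewrite lerD2l lerN2 (_ : A ^+ 3 * w ^+ 2 = A * (w * A) ^+ 2); last by ring.
  rewrite ler_wpM2l//; first exact: ltW.
  rewrite -[leLHS]ger0_norm ?sqr_ge0// normrX.
  by rewrite lerXn2r ?nnegrE ?normr_ge0// (le_trans (normr_ge0 _) h3).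
have : \int[M]_x (ln (predictive u x) + w * (overlap u y x - 1) - A ^+ 3 * w ^+ 2)
    <= \int[M]_x ln (predictive (update w y u) x).
  by apply: le_mean => //; apply: bmfB; [exact: bmfD|exact: bmf_cst].
rewrite meanB; [|exact: bmfD|exact: bmf_cst].
rewrite meanD// mean_cst meanZ; last by apply: bmfB => //; exact: bmf_cst.
rewrite meanB//; last exact: bmf_cst.
rewrite mean_cst /log_loss /drift; lra.
Qed.

(** Jensen: [drift] integrates to the second moment, under the density [u],
    of a function of the parameter whose mean under [u] is [1]. *)
Lemma mean_drift_ge1 u : mix_density u -> 1 <= \int[M]_y drift u y.
Proof.
move=> du; have [bu u0 u1] := du.
have bq2 : bmf (fun z : T * S => r z.1 z.2 / predictive u z.1).
  apply: bmfM; first exact: bmf_r.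
  exact: (bmf_comp (bmf_invpred du)).
pose g t := \int[M]_x (r x t / predictive u x).
have bg : bmf g.
  apply: (bmf_mean M (g := fun z : S * T => r z.2 z.1 / predictive u z.2)).
  by apply: (bmf_comp bq2 (h := fun z : S * T => (z.2, z.1))); apply: measurable_fun_pair.
have bq x : bmf (fun t => r x t / predictive u x) by exact: (bmf_sliceL x bq2).
have bqr t : bmf (fun x => r x t / predictive u x) by exact: (bmf_sliceR t bq2).
have gu1 : \int[F]_t (g t * u t) = 1.
  transitivity (\int[F]_t \int[M]_x (u t * (r x t / predictive u x))).
    by apply: eq_Rintegral => t _; rewrite meanZ// mulrC.
  rewrite -(mean_swap M F (g := fun z : T * S => u z.2 * (r z.1 z.2 / predictive u z.1))); last first.
    by apply: bmfM => //; exact: (bmf_comp bu).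
  rewrite -[RHS](mean_cst M); apply: eq_Rintegral => x _ /=.
  transitivity (\int[F]_t ((predictive u x)^-1 * (r x t * u t))).
    by apply: eq_Rintegral => t _; ring.
  by rewrite meanZ; [rewrite mulVf// gt_eqF// predictive_gt0|exact: bmf_ru].
have driftE y : drift u y = \int[F]_t (g t * (r y t / predictive u y * u t)).
  transitivity (\int[M]_x \int[F]_t (r x t / predictive u x * (r y t / predictive u y * u t))).
    apply: eq_Rintegral => x _; rewrite /overlap.
    transitivity (\int[F]_t ((predictive u y * predictive u x)^-1 * (r x t * r y t * u t))).
      by rewrite meanZ; [rewrite mulrC|exact: bmf_rru].
    by apply: eq_Rintegral => t _; rewrite invfM; ring.
  rewrite (mean_swap M F (g := fun z : T * S =>
    r z.1 z.2 / predictive u z.1 * (r y z.2 / predictive u y * u z.2))); last first.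
    apply: bmfM => //; apply: bmfM; last exact: (bmf_comp bu).
    exact: (bmf_comp (bq y)).
  apply: eq_Rintegral => t _ /=; rewrite [RHS]mulrC /g -meanZ//.
  by apply: eq_Rintegral => x _; rewrite mulrC.
have -> : \int[M]_y drift u y = \int[F]_t (g t ^+ 2 * u t).
  transitivity (\int[M]_y \int[F]_t (g t * (r y t / predictive u y * u t))).
    by apply: eq_Rintegral => y _; exact: driftE.
  rewrite (mean_swap M F (g := fun z : T * S => g z.2 * (r z.1 z.2 / predictive u z.1 * u z.2))); last first.
    apply: bmfM; first exact: (bmf_comp bg).
    by apply: bmfM => //; exact: (bmf_comp bu).
  apply: eq_Rintegral => t _ /=.
  transitivity (\int[M]_x ((g t * u t) * (r x t / predictive u x))).
    by apply: eq_Rintegral => x _; ring.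
  by rewrite meanZ// -/(g t); ring.
have bgu : bmf (fun t => g t * u t) by exact: bmfM.
have : \int[F]_t (2 * (g t * u t) - u t) <= \int[F]_t (g t ^+ 2 * u t).
  apply: le_mean; first by apply: bmfB => //; exact: bmfZ.
    by apply: bmfM => //; exact: bmfM.
  move=> t; have := u0 t; have := sqr_ge0 (g t - 1); nra.
rewrite meanB//; last exact: bmfZ.
by rewrite meanZ// gu1 u1; lra.
Qed.

Definition l1dist (u v : S -> R) : R := \int[F]_t `|u t - v t|.

Lemma bmf_absB (u v : S -> R) : bmf u -> bmf v -> bmf (fun t => `|u t - v t|).
Proof. by move=> bu bv; apply: bmf_norm; exact: bmfB. Qed.

Lemma l1dist_ge0 u v : 0 <= l1dist u v.
Proof. exact: Rintegral_ge0. Qed.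

Lemma l1dist_trans u v x : bmf u -> bmf v -> bmf x ->
  l1dist u x <= l1dist u v + l1dist v x.
Proof.
move=> bu bv bx; rewrite /l1dist -meanD; try exact: bmf_absB.
apply: le_mean; [exact: bmf_absB|by apply: bmfD; exact: bmf_absB|].
move=> t; rewrite (_ : u t - x t = (u t - v t) + (v t - x t)); last by ring.
exact: ler_normD.
Qed.

Lemma l1dist_update w y u : mix_density u -> 0 <= w <= 1 ->
  l1dist (update w y u) u <= A * w.
Proof.
move=> du w01; have [bu u0 u1] := du; have [bu' _ _] := mix_density_update y du w01.
rewrite -[leRHS]mulr1 -u1 -meanZ//; apply: le_mean; [exact: bmf_absB|exact: bmfZ|].
by move=> t; have [_ _] := update_ge0 y t du w01; rewrite (mulrC w).
Qed.

Lemma mean_weighted_lip (g u v : S -> R) c : bmf g -> bmf u -> bmf v ->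
  (forall t, `|g t| <= c) ->
  `|\int[F]_t (g t * u t) - \int[F]_t (g t * v t)| <= c * l1dist u v.
Proof.
move=> bg bu bv gc; rewrite -meanB; try exact: bmfM.
apply: (le_trans (norm_mean _ _)); first by apply: bmfB; exact: bmfM.
rewrite /l1dist -meanZ; last exact: bmf_absB.
apply: le_mean; first by apply: bmf_norm; apply: bmfB; exact: bmfM.
  by apply: bmfZ; exact: bmf_absB.
by move=> t; rewrite -mulrBr normrM ler_wpM2r.
Qed.

Lemma norm_r x t : `|r x t| <= b.
Proof. by rewrite gtr0_norm ?r_gt0//; have /andP[] := rb x t. Qed.

Lemma predictive_lip u v x : mix_density u -> mix_density v ->
  `|predictive u x - predictive v x| <= b * l1dist u v.
Proof.
move=> [bu _ _] [bv _ _]; apply: mean_weighted_lip => //; [exact: bmf_rl|].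
exact: norm_r.
Qed.

Lemma log_loss_lip u v : mix_density u -> mix_density v ->
  `|log_loss u - log_loss v| <= A * l1dist u v.
Proof.
move=> du dv; have bu := bmf_ln_predictive du; have bv := bmf_ln_predictive dv.
rewrite /log_loss opprK addrC -meanB//; apply: (le_trans (norm_mean _ _)); first exact: bmfB.
apply: mean_le_cst => [|x]; first exact/bmf_norm/bmfB.
have /andP[h1 _] := predictive_bounds x du; have /andP[h2 _] := predictive_bounds x dv.
apply: (le_trans (ln_lipschitz bi0 h2 h1)).
rewrite invrK /A expr2 -mulrA ler_wpM2l//; first exact: ltW.
by rewrite distrC; exact: predictive_lip.
Qed.

Lemma gain_lip us u v x : mix_density us -> mix_density u -> mix_density v ->
  `|predictive us x / predictive u x - predictive us x / predictive v x|
    <= b ^+ 4 * l1dist u v.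
Proof.
move=> ds du dv; have /andP[h1 _] := predictive_bounds x du.
have /andP[h2 _] := predictive_bounds x dv; have /andP[_ h3] := predictive_bounds x ds.
rewrite -mulrBr normrM gtr0_norm ?predictive_gt0//.
apply: (@le_trans _ _ (b * (b ^+ 2 * (b * l1dist u v)))); last first.
  by rewrite le_eqVlt; apply/orP; left; apply/eqP; ring.
apply: ler_pM => //; first exact/ltW/predictive_gt0.
apply: (le_trans (norm_invB b0 h1 h2)).
by apply: ler_wpM2l; [exact: exprn_ge0 (ltW _)|exact: predictive_lip].
Qed.

Lemma overlap_lip u v y x : mix_density u -> mix_density v ->
  `|overlap u y x - overlap v y x| <= 3 * b ^+ 8 * l1dist u v.
Proof.
move=> du dv; have [bu u0 u1] := du; have [bv v0 v1] := dv.
set D := l1dist u v; have D0 : 0 <= D by exact: l1dist_ge0.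
pose N u := \int[F]_t (r x t * r y t * u t).
have rr t : `|r x t * r y t| <= b ^+ 2.
  by rewrite normrM expr2 ler_pM// norm_r.
have NL : `|N u - N v| <= b ^+ 2 * D.
  by apply: mean_weighted_lip => //; apply: bmfM; exact: bmf_rl.
have Nb : `|N u| <= b ^+ 2.
  have /andP[h1 h2] := mean_ru_gt0 x y du; have p0 := predictive_gt0 y du.
  have /andP[_ h3] := predictive_bounds y du.
  rewrite ger0_norm; last by apply: le_trans h1; rewrite mulr_ge0// ltW.
  by apply: (le_trans h2); rewrite expr2 ler_wpM2l// ltW.
have iL z : `|(predictive u z)^-1 - (predictive v z)^-1| <= b ^+ 3 * D.
  have /andP[h1 _] := predictive_bounds z du; have /andP[h2 _] := predictive_bounds z dv.
  apply: (le_trans (norm_invB b0 h1 h2)).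
  rewrite (_ : b ^+ 3 * D = b ^+ 2 * (b * D)); last by ring.
  by apply: ler_wpM2l; [exact: exprn_ge0 (ltW _)|exact: predictive_lip].
have iN (v' : S -> R) z : mix_density v' -> `|(predictive v' z)^-1| <= b.
  by move=> dv'; have /andP[h1 h2] := invpred_bounds z dv'; rewrite gtr0_norm.
have i2L : `|(predictive u y)^-1 * (predictive u x)^-1 -
    (predictive v y)^-1 * (predictive v x)^-1| <= 2 * b ^+ 4 * D.
  apply: (le_trans (norm_mulB _ _ (iN _ y du) (iN _ x dv))).
  have -> : 2 * b ^+ 4 * D = b * (b ^+ 3 * D) + b * (b ^+ 3 * D) by ring.
  by apply: lerD; apply: ler_wpM2l (iL _); exact: ltW.
have i2N : `|(predictive v y)^-1 * (predictive v x)^-1| <= b ^+ 2.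
  by rewrite normrM expr2; apply: ler_pM => //; exact: iN.
rewrite /overlap !invfM -/(N u) -/(N v).
apply: (le_trans (norm_mulB _ _ Nb i2N)).
have b2 : 0 <= b ^+ 2 by exact/exprn_ge0/ltW.
have p68 : b ^+ 6 <= b ^+ 8 by exact: ler_weXn2l.
have p48 : b ^+ 4 <= b ^+ 8 by exact: ler_weXn2l.
apply: (@le_trans _ _ (b ^+ 2 * (2 * b ^+ 4 * D) + b ^+ 2 * (b ^+ 2 * D))).
  by apply: lerD; apply: ler_wpM2l.
have -> : b ^+ 2 * (2 * b ^+ 4 * D) + b ^+ 2 * (b ^+ 2 * D) =
  (2 * b ^+ 6 + b ^+ 4) * D by ring.
by apply: ler_wpM2r => //; lra.
Qed.

Lemma drift_lip u v y : mix_density u -> mix_density v ->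
  `|drift u y - drift v y| <= 3 * b ^+ 8 * l1dist u v.
Proof.
move=> du dv; have bu := bmf_overlap y du; have bv := bmf_overlap y dv.
rewrite /drift -meanB//; apply: (le_trans (norm_mean _ _)); first exact: bmfB.
apply: mean_le_cst => [|x]; first exact/bmf_norm/bmfB.
exact: overlap_lip.
Qed.

Lemma bmf_gain us u : mix_density us -> mix_density u ->
  bmf (fun x => predictive us x / predictive u x).
Proof. by move=> ds du; apply: bmfM; [exact: bmf_predictive|exact: bmf_invpred]. Qed.

Lemma gain_bounds us u x : mix_density us -> mix_density u ->
  0 <= predictive us x / predictive u x <= A.
Proof.
move=> ds du; have p0 := predictive_gt0 x ds; have /andP[_ h] := predictive_bounds x ds.
have /andP[i1 i2] := invpred_bounds x du.
apply/andP; split; first by apply: mulr_ge0; exact: ltW.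
by rewrite /A expr2; apply: ler_pM => //; exact: ltW.
Qed.

(** [ln z <= z - 1] for the ratio [z] of the two predictive densities. *)
Lemma mean_gain us u : mix_density us -> mix_density u ->
  1 + (log_loss u - log_loss us) <= \int[M]_x (predictive us x / predictive u x).
Proof.
move=> ds du; have bs := bmf_ln_predictive ds; have bu := bmf_ln_predictive du.
rewrite /log_loss opprK (addrC (- _)) -meanB// -[X in X + _](mean_cst M) -meanD; first last.
- exact: bmfB.
- exact: bmf_cst.
apply: le_mean; [by apply: bmfD; [exact: bmf_cst|exact: bmfB]|exact: bmf_gain|].
move=> x; have p1 := predictive_gt0 x ds; have p2 := predictive_gt0 x du.
have : 0 < predictive us x / predictive u x by rewrite divr_gt0.
by move=> /ln_upper; rewrite ln_div ?posrE//; lra.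
Qed.

Lemma bmf_ln_density c u : mix_density u -> 0 < c -> (forall t, c <= u t) ->
  bmf (fun t => ln (u t)).
Proof. by move=> [bu _ _] c0 cu; exact: bmf_ln cu bu. Qed.

(** To first order in [w], the relative entropy of [us] with respect to [u]
    drops by [w] times the relative gain of the predictive density of [us] over
    that of [u] at the new observation. *)
Lemma entropy_update c w y us u : mix_density us -> mix_density u ->
  0 < c -> (forall t, c <= u t) -> 0 <= w <= 1 ->
  \int[F]_t (us t * ln (u t)) + w * (predictive us y / predictive u y - 1)
    - A ^+ 3 * w ^+ 2 <= \int[F]_t (us t * ln (update w y u t)).
Proof.
move=> ds du c0 cu w01; have [bs s0 s1] := ds; have [bu u0 u1] := du.
have du' := mix_density_update y du w01.
have cu' t : A^-1 * c <= update w y u t.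
  have [h _ _] := update_ge0 y t du w01; apply: le_trans h.
  by rewrite ler_wpM2l// ltW.
have bl := bmf_ln_density du c0 cu.
have bl' := bmf_ln_density du' (mulr_gt0 Ai0 c0) cu'.
have bru := bmf_ru y bs.
have key t : us t * ln (u t) + ((w / predictive u y) * (r y t * us t) - w * us t
    - A ^+ 3 * w ^+ 2 * us t) <= us t * ln (update w y u t).
  have [h1 h2 h3] := convex_bounds w01 (ratio_bounds y t du).
  have ut0 : 0 < u t by exact: lt_le_trans (cu t).
  have -> : us t * ln (u t) + ((w / predictive u y) * (r y t * us t) - w * us t
      - A ^+ 3 * w ^+ 2 * us t) = us t * (ln (u t) +
      (w * (r y t / predictive u y - 1) - A ^+ 3 * w ^+ 2)) by ring.
  apply: ler_wpM2l => //; rewrite /update lnM ?posrE//; last first.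
    exact: lt_le_trans h1.
  rewrite lerD2l; have := ln_lower A1 h1.
  rewrite [1 + _]addrC addrK; apply: le_trans.
  rewrite lerD2l lerN2 (_ : A ^+ 3 * w ^+ 2 = A * (w * A) ^+ 2); last by ring.
  rewrite ler_wpM2l//; first exact: ltW.
  rewrite -[leLHS]ger0_norm ?sqr_ge0// normrX.
  by rewrite lerXn2r ?nnegrE ?normr_ge0// (le_trans (normr_ge0 _) h3).
have b1' : bmf (fun t => us t * ln (u t)) by exact: bmfM.
have b2 : bmf (fun t => w / predictive u y * (r y t * us t)) by exact: bmfZ.
have b3 : bmf (fun t => w * us t) by exact: bmfZ.
have b4 : bmf (fun t => A ^+ 3 * w ^+ 2 * us t) by exact: bmfZ.
have b23 : bmf (fun t => w / predictive u y * (r y t * us t) - w * us t) by exact: bmfB.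
have b234 : bmf (fun t => w / predictive u y * (r y t * us t) - w * us t
    - A ^+ 3 * w ^+ 2 * us t) by exact: bmfB.
have : \int[F]_t (us t * ln (u t) + ((w / predictive u y) * (r y t * us t) - w * us t
    - A ^+ 3 * w ^+ 2 * us t)) <= \int[F]_t (us t * ln (update w y u t)).
  by apply: le_mean => //; [exact: bmfD|exact: bmfM].
rewrite meanD// meanB// meanB// !meanZ// s1 -/(predictive us y); apply: le_trans.
by rewrite le_eqVlt; apply/orP; left; apply/eqP; ring.
Qed.

End step.

(** * Step sizes and lags *)

Section dyadic.
Context {R : realType}.
Local Notation tl := (trunc_log 2).

Lemma sum_trunc_log (g : nat -> R) K :
  \sum_(1 <= i < 2 ^ K) g (tl i) = \sum_(k < K) (2 ^ k)%:R * g k.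
Proof.
elim: K => [|K IH]; first by rewrite big_geq// big_ord0.
rewrite big_ord_recr/= -IH (@big_cat_nat _ _ _ (2 ^ K)%N)/= ?expn_gt0 ?leq_exp2l//.
congr (_ + _); transitivity (\sum_(2 ^ K <= i < 2 ^ K.+1) g K).
  apply: eq_big_nat => i iK; congr (g _); exact: trunc_log_eq.
by rewrite sumr_const_nat expnS mul2n -addnn addnK mulr_natl.
Qed.

Lemma sum_trunc_log_le (g : nat -> R) c n : (forall k, 0 <= g k) ->
  (forall K, \sum_(k < K) (2 ^ k)%:R * g k <= c) ->
  \sum_(1 <= i < n) g (tl i) <= c.
Proof.
move=> g0 gc; case: n => [|n]; first by have := gc 0%N; rewrite big_ord0 big_geq.
apply: le_trans (gc n.+1); rewrite -sum_trunc_log.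
rewrite [leRHS](@big_cat_nat _ _ _ n.+1)//=; last by rewrite ltnW// ltn_expl.
by rewrite lerDl sumr_ge0.
Qed.

(** The full series is the square of the geometric series. *)
Lemma sum_arith_geom (b : R) K : 0 <= b < 1 ->
  \sum_(k < K) (k.+1)%:R * b ^+ k <= ((1 - b) ^+ 2)^-1.
Proof.
move=> /andP[b0 b1]; have c0 : 0 < (1 - b) ^+ 2 by rewrite exprn_gt0// subr_gt0.
rewrite -[leRHS]mul1r ler_pdivlMr//.
have -> : (\sum_(k < K) (k.+1)%:R * b ^+ k) * (1 - b) ^+ 2 =
    1 - K.+1%:R * b ^+ K + K%:R * b ^+ K.+1.
  elim: K => [|K IH]; first by rewrite big_ord0; ring.
  by rewrite big_ord_recr/= mulrDl IH -!natr1 !exprS; ring.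
have p0 : 0 <= b ^+ K by exact: exprn_ge0.
rewrite exprS -natr1; have k0 : 0 <= K%:R :> R by [].
have : K%:R * (b * b ^+ K) <= K%:R * b ^+ K.
  by apply: ler_wpM2l => //; apply: ler_piMl => //; exact: ltW.
nra.
Qed.

Lemma sum_half_geom (p : R) n : 0 < p < 1 ->
  \sum_(1 <= i < n) p ^+ i./2 <= 2 * (1 - p)^-1.
Proof.
move=> /andP[p0 p1].
have q0 : 0 < 1 - p by rewrite subr_gt0.
apply: (@le_trans _ _ (\sum_(0 <= i < n.*2) p ^+ i./2)).
  have [->|n0] := posnP n; first by rewrite !big_geq.
  rewrite [leRHS](@big_cat_nat _ _ _ n)//=; last by rewrite -addnn leq_addr.
  rewrite [X in _ <= X + _](@big_cat_nat _ _ _ 1)//= -addrA addrCA lerDl.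
  by rewrite addr_ge0// sumr_ge0// => i _; rewrite exprn_ge0// ltW.
have -> : \sum_(0 <= i < n.*2) p ^+ i./2 = 2 * \sum_(0 <= i < n) p ^+ i.
  elim: n => [|n IH]; first by rewrite !big_geq// mulr0.
  by rewrite doubleS !big_nat_recr//= IH uphalf_double doubleK; ring.
rewrite ler_wpM2l// -[leRHS]mul1r ler_pdivlMr//.
have -> : (\sum_(0 <= i < n) p ^+ i) * (1 - p) = 1 - p ^+ n.
  elim: n => [|n IH]; first by rewrite big_geq// expr0; ring.
  by rewrite big_nat_recr//= mulrDl IH exprS; ring.
by rewrite lerBlDr lerDl exprn_ge0// ltW.
Qed.

(** Step sizes on dyadic scale: [g] is [2 ^ - alpha], and [alpha > 1/2] is
    what makes [2 * g ^ 2 < 1]. *)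
Lemma step_dyadic_bounds (w : nat -> R) : condB1 w ->
  exists g C : R, [/\ 0 < g < 1, 2 * g ^+ 2 < 1, 0 < C,
    forall i, (0 < i)%N -> w i <= C * g ^+ tl i
    & exists N, forall i, (0 < i)%N -> (N <= i)%N ->
        (2 * 2 ^+ (tl i).+1)^-1 <= w i].
Proof.
move=> [w01 _ _ [alpha /andP[a2 a1] wE]].
have ln2 : 0 < ln 2 :> R by apply: ln_gt0; lra.
have a0 : 0 < alpha by apply: lt_trans a2; rewrite invr_gt0.
pose g : R := expR (- (alpha * ln 2)).
have gE n : g ^+ n = expR (- (alpha * (n%:R * ln 2))).
  by rewrite /g -expRM_natl; congr expR; ring.
have g0 : 0 < g by exact: expR_gt0.
have g1 : g < 1 by rewrite expR_lt1 oppr_lt0 mulr_gt0.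
have g21 : 2 * g ^+ 2 < 1.
  rewrite gE -{1}(@lnK R 2) ?posrE// -expRD expR_lt1.
  have : 1 < alpha * 2 by lra.
  nra.
have powE i : (0 < i)%N -> i%:R `^ (- alpha) = expR (- (alpha * ln i%:R)) :> R.
  by case: i => // i _; rewrite /powR pnatr_eq0/= mulNr.
have ln_tl i : (0 < i)%N -> (tl i)%:R * @ln R 2 <= @ln R i%:R <= (tl i).+1%:R * @ln R 2.
  move=> i0; rewrite 2!mulr_natl -!lnXn//; apply/andP; split.
    by rewrite ler_ln ?posrE ?exprn_gt0 ?ltr0n// -natrX ler_nat trunc_logP.
  by rewrite ler_ln ?posrE ?exprn_gt0 ?ltr0n// -natrX ler_nat ltnW// trunc_log_ltn.
have : \forall n \near \oo, `|w n - n%:R `^ (- alpha)| <= 2^-1 * `|n%:R `^ (- alpha)|.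
  have := wE => /eqaddoP /(_ 2^-1); apply; by rewrite invr_gt0.
move=> [N _ HN].
have v0 i : (0 < i)%N -> 0 < i%:R `^ (- alpha) :> R by move=> i0; rewrite powE// expR_gt0.
have wle i : (0 < i)%N -> (N <= i)%N -> w i <= 2 * i%:R `^ (- alpha).
  move=> i0 Ni; have := HN _ Ni; have := v0 _ i0.
  by move=> v; rewrite (gtr0_norm v) ler_norml => /andP[]; lra.
have wge i : (0 < i)%N -> (N <= i)%N -> 2^-1 * i%:R `^ (- alpha) <= w i.
  move=> i0 Ni; have := HN _ Ni; have := v0 _ i0.
  by move=> v; rewrite (gtr0_norm v) ler_norml => /andP[]; lra.
(* The second summand of the constant covers the indices below [N], where only
   [w i <= 1] is known. *)
exists g, (2 + (g ^+ tl N)^-1); split=> //.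
- by rewrite g0 g1.
- by rewrite addr_gt0// invr_gt0 exprn_gt0.
- move=> i i0; have gi0 : 0 < g ^+ tl i by rewrite exprn_gt0.
  have gN0 : 0 < g ^+ tl N by rewrite exprn_gt0.
  have gNi : 0 < (g ^+ tl N)^-1 by rewrite invr_gt0.
  rewrite mulrDl; have [Ni|iN] := leqP N i.
    apply: (le_trans (wle _ i0 Ni)).
    apply: ler_wpDr; first by rewrite mulr_ge0// ltW.
    apply: ler_wpM2l => //; rewrite powE// gE ler_expR lerN2.
    apply: ler_wpM2l; first exact: ltW.
    by have /andP[] := ln_tl _ i0.
  have /andP[_ wi1] := w01 _ i0; apply: (le_trans wi1).
  apply: ler_wpDl; first by rewrite mulr_ge0// ltW.
  rewrite mulrC ler_pdivlMr// mul1r; apply: ler_wiXn2l; rewrite ?ltW//.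
  exact/leq_trunc_log/ltnW.
- exists N => i i0 Ni; apply: le_trans (wge _ i0 Ni).
  rewrite invfM ler_wpM2l// powE//.
  have -> : (2 ^+ (tl i).+1)^-1 = expR (- ((tl i).+1%:R * ln 2)) :> R.
    by rewrite expRN expRM_natl lnK// posrE.
  rewrite ler_expR lerN2; have /andP[_ h] := ln_tl _ i0; apply: le_trans h.
  apply: ler_piMl => //; apply: ln_ge0; by rewrite ler1n.
Qed.

Lemma sum_dyadic_weights (g : R) n : 0 < g -> 2 * g ^+ 2 < 1 ->
  \sum_(1 <= i < n) (tl i).+1%:R * g ^+ (2 * tl i) <= ((1 - 2 * g ^+ 2) ^+ 2)^-1.
Proof.
move=> g0 g21.
apply: (@sum_trunc_log_le (fun k => k.+1%:R * g ^+ (2 * k))).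
  by move=> k; rewrite mulr_ge0// exprn_ge0// ltW.
move=> K; apply: le_trans (sum_arith_geom K (b := 2 * g ^+ 2) _); last first.
  by rewrite g21 andbT mulr_ge0// exprn_ge0// ltW.
apply: ler_sum => k _; rewrite natrX exprMn -exprM le_eqVlt.
by apply/orP; left; apply/eqP; ring.
Qed.

Lemma sum_sqr_step (w : nat -> R) : condB1 w ->
  exists C, forall n, \sum_(1 <= i < n) w i ^+ 2 <= C.
Proof.
move=> B1; have [w01 _ _ _] := B1.
have [g [C [/andP[g0 _] g21 C0 wC _]]] := step_dyadic_bounds B1.
exists (C ^+ 2 * ((1 - 2 * g ^+ 2) ^+ 2)^-1) => n.
apply: le_trans (ler_wpM2l _ (sum_dyadic_weights n g0 g21)); last exact: sqr_ge0.
rewrite mulr_sumr; apply: ler_sum_nat => i /andP[i0 _].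
have gp : 0 <= g ^+ (2 * tl i) by rewrite exprn_ge0// ltW.
apply: (@le_trans _ _ (C ^+ 2 * g ^+ (2 * tl i))); last first.
  by apply: ler_wpM2l; rewrite ?sqr_ge0// ler_peMl// ler1n.
rewrite mulnC exprM -exprMn lerXn2r ?nnegrE ?wC//.
  by have /andP[/ltW] := w01 _ i0.
by rewrite mulr_ge0 ?exprn_ge0// ltW.
Qed.

Lemma sum_step_unbounded (w : nat -> R) : condB1 w ->
  forall C, exists n, C < \sum_(1 <= i < n) w i.
Proof.
move=> B1 C; have [w01 _ _ _] := B1.
have [g [_ [_ _ _ _ [N wN]]]] := step_dyadic_bounds B1.
have [K CK] : exists K : nat, 4 * (C + N%:R) < K%:R.
  exists (Num.bound `|4 * (C + N%:R)|); apply: le_lt_trans (ler_norm _) _.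
  exact: archi_boundP.
exists (2 ^ K)%N.
have h1 : K%:R / 4 <= \sum_(1 <= i < 2 ^ K) (w i + (i < N)%:R).
  apply: (@le_trans _ _ (\sum_(1 <= i < 2 ^ K) (2 * 2 ^+ (tl i).+1)^-1)).
    rewrite (@sum_trunc_log (fun k => (2 * 2 ^+ k.+1)^-1)).
    rewrite (eq_bigr (fun=> 4^-1)) ?sumr_const ?card_ord ?mulr_natl//.
    move=> k _; rewrite natrX exprS.
    have : (2 : R) ^+ k != 0 by rewrite expf_neq0.
    by move=> ?; field; lra.
  apply: ler_sum_nat => i /andP[i0 _].
  have [iN|Ni] := ltnP i N; last by rewrite addr0 wN.
  apply: (@le_trans _ _ 1); last first.
    by rewrite lerDr; have /andP[/ltW] := w01 _ i0.
  by rewrite invf_le1 ?mulr_gt0 ?exprn_gt0// mulr_ege1 ?exprn_ege1// ler1n.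
have h2 : \sum_(1 <= i < 2 ^ K) ((i < N)%:R : R) <= N%:R.
  have cnt n : \sum_(0 <= i < n) ((i < N)%:R : R) = (minn n N)%:R.
    elim: n => [|n IH]; first by rewrite big_geq// min0n.
    by rewrite big_nat_recr//= IH -natrD; congr (_%:R); lia.
  apply: (@le_trans _ _ (\sum_(0 <= i < 2 ^ K) ((i < N)%:R : R))).
    by rewrite [leRHS](@big_cat_nat _ _ _ 1)//= ?expn_gt0// lerDr sumr_ge0.
  by rewrite cnt ler_nat geq_minr.
move: h1; rewrite big_split/= => h1; lra.
Qed.

Definition lag (a i : nat) : nat := (i.-1 - minn i./2 (a * tl i))%N.

Lemma lag_ltn a i : (0 < i)%N -> (lag a i < i)%N.
Proof. by rewrite /lag; lia. Qed.

Lemma lag_half a i : (0 < i)%N -> (i <= (lag a i).+1.*2)%N.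
Proof.
move=> i0; rewrite /lag; have := odd_double_half i; rewrite -muln2 -[in X in _ -> X]muln2.
by have := leq_b1 (odd i); lia.
Qed.

Lemma lag_log a i : (0 < i)%N -> (i <= (lag a i).+1 + a * tl i)%N.
Proof. by rewrite /lag; lia. Qed.

Lemma leq_lag a i : (minn i./2 (a * tl i) <= i - lag a i)%N.
Proof.
have : (minn i./2 (a * tl i) <= i)%N.
  by rewrite geq_min -{2}(half_bit_double i false) half_leq// add0n -addnn leq_addr.
by rewrite /lag; move: (minn _ _) => l; lia.
Qed.

Lemma trunc_log_lag a i : (0 < i)%N -> (tl i <= (tl (lag a i).+1).+1)%N.
Proof.
move=> i0; rewrite -trunc_log2_double//; exact/leq_trunc_log/lag_half.
Qed.

Lemma exists_expr_le (p e : R) : 0 < p < 1 -> 0 < e -> exists a, p ^+ a <= e.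
Proof.
move=> /andP[p0 p1] e0.
have : (fun n => p ^+ n) @ \oo --> (0 : R) by apply: cvg_expr; rewrite gtr0_norm.
move=> /cvgrPdist_le /(_ _ e0) [N _ /(_ N (leqnn N))].
by rewrite sub0r normrN gtr0_norm ?exprn_gt0// => ?; exists N.
Qed.

(** Conditioning on the past up to [lag a i], instead of [i.-1], makes the
    dependence [rho ^+ (i - lag a i)] summable while the step sizes in between
    stay summable against [w i]: the lag is a multiple of the logarithm. *)
Lemma sum_lag_error (w : nat -> R) (rho : R) : condB1 w -> 0 < rho < 1 ->
  exists a C, forall n,
    \sum_(1 <= i < n) w i * (\sum_((lag a i).+1 <= j < i) w j + rho ^+ (i - lag a i))
    <= C.
Proof.
move=> B1 rho01; have [w01 wdec _ _] := B1.
have [g [C [/andP[g0 g1] g21 C0 wC _]]] := step_dyadic_bounds B1.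
(* With [rho ^ a <= g], a lag of [a * tl i] costs at most [g ^ tl i]. *)
have [a ag] := exists_expr_le rho01 g0.
have /andP[r0 r1] := rho01.
have C0' := ltW C0; have g0' := ltW g0; have r0' := ltW r0; have g1' := ltW g1.
have r1' := ltW r1.
pose K := C ^+ 2 * a%:R / g + C.
exists a, (K * ((1 - 2 * g ^+ 2) ^+ 2)^-1 + 2 * (1 - rho)^-1) => n.
have K0 : 0 <= K by rewrite addr_ge0// divr_ge0// mulr_ge0// sqr_ge0.
apply: le_trans (lerD (ler_wpM2l K0 (sum_dyadic_weights n g0 g21)) (sum_half_geom n rho01)).
rewrite mulr_sumr -big_split/=; apply: ler_sum_nat => i /andP[i0 _].
have /andP[/ltW wi0 wi1] := w01 _ i0.
have gp : 0 <= g ^+ tl i by rewrite exprn_ge0.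
set t := tl i in gp *.
have h1 : \sum_((lag a i).+1 <= j < i) w j <= (a * t)%:R * (C / g * g ^+ t).
  apply: (@le_trans _ _ (\sum_((lag a i).+1 <= j < i) (C / g * g ^+ t))); last first.
    rewrite sumr_const_nat -[leLHS]mulr_natl; apply: ler_wpM2r.
      by rewrite mulr_ge0// divr_ge0.
    by rewrite ler_nat leq_subLR lag_log.
  apply: ler_sum_nat => j /andP[lj ji].
  apply: (le_trans (wdec (lag a i).+1 _ _)) => //.
  apply: (le_trans (wC _ (ltn0Sn _))); rewrite -mulrA ler_wpM2l//.
  rewrite mulrC ler_pdivlMr// -exprSr; apply: ler_wiXn2l => //.
  exact: trunc_log_lag.
have h2 : rho ^+ (i - lag a i) <= rho ^+ i./2 + g ^+ t.
  have e := leq_lag a i; rewrite -/t in e.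
  apply: (@le_trans _ _ (rho ^+ minn i./2 (a * t))).
    by apply: ler_wiXn2l.
  rewrite /minn; case: ifPn => _.
    by rewrite lerDl.
  rewrite exprM; apply: ler_wpDl; first by rewrite exprn_ge0.
  by rewrite lerXn2r ?nnegrE ?exprn_ge0.
have wt : w i <= C * g ^+ t by exact: wC.
have rh : 0 <= rho ^+ i./2 by rewrite exprn_ge0.
have t0 : 0 <= (a * t)%:R :> R by [].
have Cg : 0 <= C / g * g ^+ t by rewrite mulr_ge0// divr_ge0.
apply: (@le_trans _ _ (w i * ((a * t)%:R * (C / g * g ^+ t) + (rho ^+ i./2 + g ^+ t)))).
  by apply: ler_wpM2l => //; exact: lerD.
apply: (@le_trans _ _ (C * g ^+ t * ((a * t)%:R * (C / g * g ^+ t) + g ^+ t) + rho ^+ i./2)).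
  rewrite addrCA mulrDr [leRHS]addrC; apply: lerD; first exact: ler_piMl.
  by apply: ler_wpM2r => //; rewrite addr_ge0// mulr_ge0.
have E1 : g ^+ (2 * t) = g ^+ t * g ^+ t by rewrite mulnC exprM expr2.
rewrite lerD2r -/t E1 natrM -natr1.
have -> : C * g ^+ t * (a%:R * t%:R * (C / g * g ^+ t) + g ^+ t) =
  ((K - C) * t%:R + C) * (g ^+ t * g ^+ t) by rewrite /K; field; lra.
rewrite [leRHS]mulrA; apply: ler_wpM2r; first exact: mulr_ge0.
have : 0 <= t%:R :> R by [].
have : 0 <= C * t%:R by rewrite mulr_ge0.
have : C <= K by rewrite /K lerDr divr_ge0// mulr_ge0// sqr_ge0.
rewrite mulrDr mulr1 mulrBl; lra.
Qed.

Lemma arith_geom_small (g e : R) : 0 < g < 1 -> 0 < e ->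
  exists K, forall k, (K <= k)%N -> k.+1%:R * g ^+ k <= e.
Proof.
move=> /andP[g0 g1] e0; pose s := Num.sqrt g.
have s0 : 0 < s by rewrite sqrtr_gt0.
have s2 : s ^+ 2 = g by rewrite sqr_sqrtr// ltW.
have s1 : s < 1 by rewrite -(@ltr_pXn2r _ 2)// ?nnegrE ?ltW// s2 expr1n.
pose c := ((1 - s) ^+ 2)^-1.
have c0 : 0 < c by rewrite invr_gt0 exprn_gt0// subr_gt0.
have bnd k : k.+1%:R * s ^+ k <= c.
  have s01 : 0 <= s < 1 by rewrite s1 andbT ltW.
  apply: le_trans (sum_arith_geom k.+1 s01).
  by rewrite big_ord_recr/= lerDr sumr_ge0// => i _; rewrite mulr_ge0// exprn_ge0// ltW.
(* One of the two factors [s ^ k] of [g ^ k] compensates [k + 1]. *)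
have [K sK] : exists K, s ^+ K <= e / c.
  by apply: exists_expr_le; [rewrite s0|rewrite divr_gt0].
exists K => k Kk; rewrite -s2 exprAC expr2 mulrA.
apply: (@le_trans _ _ (c * (e / c))); last by rewrite mulrC mulfVK// gt_eqF.
apply: ler_pM => //; [by rewrite mulr_ge0// exprn_ge0// ltW|by rewrite exprn_ge0// ltW|].
by apply: le_trans sK; apply: ler_wiXn2l; rewrite ?ltW.
Qed.

(** The indices [i] with [lag a i < j < i] exceed [j] by at most a multiple of
    [log j], and their steps are at most [w j]. *)
Lemma sum_lag_straddle (w : nat -> R) a e : condB1 w -> 0 < e ->
  exists N, forall j m, (N <= j)%N ->
    \sum_(j.+1 <= i < m | (lag a i < j)%N) w i <= e.
Proof.
move=> B1 e0; have [w01 wdec _ _] := B1.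
have [g [C [g01 g21 C0 wC _]]] := step_dyadic_bounds B1.
have [K gK] : exists K, forall k, (K <= k)%N -> k.+1%:R * g ^+ k <= e / (C * a.+1%:R).
  by apply: arith_geom_small => //; rewrite divr_gt0// mulr_gt0.
exists (2 ^ K)%N => j m Kj.
have j0 : (0 < j)%N by apply: leq_trans Kj; rewrite expn_gt0.
have wj0 : 0 <= w j by have /andP[/ltW] := w01 _ j0.
pose L := (a * (tl j).+1)%N.
apply: (@le_trans _ _ (\sum_(j.+1 <= i < m | (i < j.+1 + L)%N) w j)).
  rewrite big_nat_cond [leRHS]big_nat_cond.
  rewrite [leLHS]big_mkcond [leRHS]big_mkcond/=; apply: ler_sum => i _.
  case: ifPn => [/andP[/andP[ji im] lj]|_]; last by case: ifPn.
  have i0 : (0 < i)%N by lia.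
  have il : (tl i <= (tl j).+1)%N.
    apply: (leq_trans (trunc_log_lag a i0)); rewrite ltnS.
    exact: leq_trunc_log.
  have := lag_log a i0; have := leq_mul (leqnn a) il; rewrite -/L => h1 h2.
  have -> : (i < j.+1 + L)%N by lia.
  by rewrite ji im/= wdec// j0 ltnW.
apply: (@le_trans _ _ (w j * L%:R)).
  rewrite -big_filter big_const_seq count_predT iter_addr_0 mulr_natr.
  rewrite -[leLHS]mulr_natr -[leRHS]mulr_natr ler_wpM2l// ler_nat size_filter.
  rewrite -sum1_count -big_filter.
  have : {subset [seq i <- index_iota j.+1 m | (i < j.+1 + L)%N] <= iota j.+1 L}.
    by move=> i; rewrite mem_filter mem_index_iota mem_iota => /andP[-> /andP[->]].
  move=> /(uniq_leq_size (filter_uniq _ (iota_uniq _ _))).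
  by rewrite size_iota big_const_seq count_predT iter_addn_0 mul1n.
have tK : (K <= tl j)%N by exact: trunc_log_max.
have := gK _ tK; rewrite ler_pdivlMr ?mulr_gt0// => h.
apply: le_trans h; rewrite /L.
apply: (@le_trans _ _ ((C * g ^+ tl j) * (a * (tl j).+1)%:R)).
  by apply: ler_wpM2r => //; exact: wC.
have g0 : 0 <= g ^+ tl j by have /andP[/ltW ? _] := g01; exact: exprn_ge0.
have -> : (tl j).+1%:R * g ^+ tl j * (C * a.+1%:R) =
  C * g ^+ tl j * (a.+1 * (tl j).+1)%:R by rewrite natrM; ring.
by apply: ler_wpM2l; [rewrite mulr_ge0// ltW|rewrite ler_nat leq_mul2r leqnSn orbT].
Qed.

End dyadic.

(** * Almost sure convergence under a bounded kernel *)

Section tails.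
Context {R : realType}.

Lemma bounded_sum_tail (f : nat -> R) m C : (forall i, (m <= i)%N -> 0 <= f i) ->
  (forall n, \sum_(m <= i < n) f i <= C) -> forall e, 0 < e ->
  exists N, forall j n, (N <= j)%N -> \sum_(j <= i < n) f i <= e.
Proof.
move=> f0 fC e e0; pose E := range (fun n => \sum_(m <= i < n) f i).
have s0 j n : (m <= j)%N -> 0 <= \sum_(j <= i < n) f i.
  by move=> mj; rewrite big_nat sumr_ge0// => i /andP[ji _]; apply: f0; exact: leq_trans ji.
have hE : has_sup E.
  by split; [exists (\sum_(m <= i < 0) f i), 0%N|exists C => _ [n _ <-]].
have [_ [N _ <-] hN] := sup_adherent e0 hE.
exists (maxn m N) => j n Nj.
have [mj Nj'] : (m <= j)%N /\ (N <= j)%N by move: Nj; rewrite geq_max => /andP.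
have [jn|nj] := leqP j n; last by rewrite big_geq ?(ltW e0)// ltnW.
have : \sum_(m <= i < n) f i <= sup E by apply: sup_upper_bound => //; exists n.
rewrite (@big_cat_nat _ _ _ j)//=.
have : \sum_(m <= i < N) f i <= \sum_(m <= i < j) f i.
  have [mN|Nm] := leqP m N; last by rewrite big_geq ?s0// ltnW.
  by rewrite [leRHS](@big_cat_nat _ _ _ N)//= lerDl s0.
lra.
Qed.

End tails.

Section recursion.
Context {R : realType} d1 d2 (T : measurableType d1) (S : measurableType d2).
Variables (F : probability S R) (r : T -> S -> R) (b : R) (w : nat -> R).
Hypothesis mr : measurable_fun setT (fun z : T * S => r z.1 z.2).
Hypothesis b1 : 1 <= b.
Hypothesis rb : forall x t, b^-1 <= r x t <= b.
Hypothesis w01 : forall i, (0 < i)%N -> 0 < w i <= 1.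

Let A := b ^+ 2.
Let A0 : 0 < A. Proof. by rewrite exprn_gt0// (lt_le_trans ltr01 b1). Qed.

Lemma w01_le i : (0 < i)%N -> 0 <= w i <= 1.
Proof. by move=> /w01 /andP[/ltW -> ->]. Qed.

(** The density, with respect to the initial mixing distribution, of the
    [n]-th iterate of predictive recursion. *)
Fixpoint tilt (y : nat -> T) (n : nat) : S -> R :=
  if n is k.+1 then update F r (w k.+1) (y k.+1) (tilt y k) else fun=> 1.

Lemma tilt_density y n : mix_density F (tilt y n).
Proof.
elim: n => [|n IH] /=; last exact: (mix_density_update mr b1 rb _ IH (w01_le _)).
by split; [exact: bmf_cst|by []|rewrite mean_cst].
Qed.

Lemma tilt_ge y n t : A ^- n <= tilt y n t.
Proof.
elim: n => [|n IH] /=; first by rewrite expr0 invr1.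
have [h _ _] := update_ge0 mr b1 rb (y n.+1) t (tilt_density y n) (w01_le (ltn0Sn n)).
apply: le_trans h; rewrite -/A (_ : A ^- n.+1 = A^-1 * A ^- n); last by rewrite exprS invfM.
by apply: ler_wpM2l IH; rewrite invr_ge0 ltW.
Qed.

Lemma tilt_local y y' n : (forall j, (0 < j <= n)%N -> y j = y' j) ->
  tilt y n = tilt y' n.
Proof.
elim: n => //= n IH yy'; rewrite IH; last first.
  by move=> j /andP[j0 jn]; apply: yy'; rewrite j0 leqW.
by rewrite yy'// ltnSn.
Qed.

Lemma bmf_tilt d (Z : measurableType d) (Y : nat -> Z -> T) n :
  (forall j, measurable_fun setT (Y j)) ->
  bmf (fun z : Z * S => tilt (Y^~ z.1) n z.2).
Proof.
move=> mY; elim: n => [|n IH] /=; first exact: bmf_cst.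
apply: bmfM => //; apply: bmfD; first exact: bmf_cst.
apply: bmfZ; apply: bmfB; last exact: bmf_cst.
have mYf : measurable_fun setT (fun z : Z * S => Y n.+1 z.1) by exact: measurableT_comp.
apply: bmfM.
  apply: (bmf_comp (bmf_r mr b1 rb) (h := fun z : Z * S => (Y n.+1 z.1, z.2))).
  by apply: measurable_fun_pair.
have bP := bmf_param_predictive F mr b1 rb (U := fun z => tilt (Y^~ z) n) IH.
have bi : bmf (fun z : Z * T => (predictive F r (tilt (Y^~ z.1) n) z.2)^-1).
  apply: (bmfV (c := b^-1)); [|  |by have [] := bP].
    by rewrite invr_gt0 (lt_le_trans ltr01 b1).
  by move=> z; have /andP[] := predictive_bounds mr b1 rb z.2 (tilt_density (Y^~ z.1) n).
apply: (bmf_comp bi (h := fun z : Z * S => (z.1, Y n.+1 z.1))).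
by apply: measurable_fun_pair.
Qed.

Lemma tilt_lip y k n : (k <= n)%N ->
  l1dist F (tilt y n) (tilt y k) <= A * \sum_(k.+1 <= j < n.+1) w j.
Proof.
elim: n => [|n IH].
  rewrite leqn0 => /eqP ->; rewrite big_geq// mulr0 /l1dist.
  by under eq_Rintegral do rewrite subrr normr0; rewrite mean_cst.
rewrite leq_eqVlt => /predU1P[->|kn].
  rewrite big_geq// mulr0 /l1dist.
  by under eq_Rintegral do rewrite subrr normr0; rewrite mean_cst.
have [bn _ _] := tilt_density y n; have [bn' _ _] := tilt_density y n.+1.
have [bk _ _] := tilt_density y k.
apply: (le_trans (l1dist_trans F bn' bn bk)).
rewrite big_nat_recr//= mulrDr addrC; apply: lerD; first exact: IH.
exact: (l1dist_update mr b1 rb _ (tilt_density y n) (w01_le _)).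
Qed.

(** A finite history as a sequence of observations numbered from [1]; [x0] fills
    the places that the history does not determine. *)
Definition extend (x0 : T) k (v : k.-tuple T) (j : nat) : T := nth x0 v j.-1.

Lemma measurable_extend x0 k j :
  measurable_fun setT (fun v : k.-tuple T => extend x0 v j).
Proof.
have [jk|kj] := ltnP j.-1 k; last first.
  rewrite (_ : (fun _ => _) = fun=> x0); first exact: measurable_cst.
  by apply/funext => v; rewrite /extend nth_default// size_tuple.
rewrite (_ : (fun _ => _) = fun v => tnth v (Ordinal jk)); first exact: measurable_tnth.
by apply/funext => v; rewrite (tnth_nth x0).
Qed.

End recursion.

Section almost_sure_criterion.
Context {R : realType} d (Omega : measurableType d) (P : probability Omega R).
Variable V : nat -> Omega -> R.
Hypothesis mV : forall n, measurable_fun setT (V n).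
Hypothesis V0 : forall n om, 0 <= V n om.

Definition exceedance lam N m : set Omega :=
  [set om | exists l, (N <= l <= m)%N /\ lam < V l om].

Lemma measurable_exceedance lam N m : measurable (exceedance lam N m).
Proof.
rewrite (_ : exceedance _ _ _ = \bigcup_(l in [set l | (N <= l <= m)%N])
    (setT `&` V l @^-1` `]lam, +oo[)).
  by apply: bigcup_measurable => l _; exact: mV.
apply/seteqP; split => om /=.
  by move=> [l [Nlm Vl]]; exists l => //; split => //=; rewrite in_itv/= andbT.
by move=> [l Nlm [_ /=]]; rewrite in_itv/= andbT => Vl; exists l.
Qed.

(** The events that [V] exceeds a level after time [N] decrease to a null set;
    countably many levels are enough. *)
Lemma ae_cvg0 :
  (forall lam e, 0 < lam -> 0 < e -> exists N, forall m, (N <= m)%N ->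
     (P (exceedance lam N m) <= e%:E)%E) ->
  {ae P, forall om, V ^~ om @ \oo --> (0 : R)}.
Proof.
move=> H.
have /choice[N0 HN0] : forall k : nat * nat, exists N, forall m, (N <= m)%N ->
    (P (exceedance (k.1.+1%:R^-1)%R N m) <= (k.2.+1%:R^-1)%:E)%E.
  by move=> k; apply: H; rewrite invr_gt0.
pose tail k n := \bigcup_m exceedance k.+1%:R^-1 (N0 (k, n)) m.
have mtail k n : measurable (tail k n).
  by apply: bigcupT_measurable => m; exact: measurable_exceedance.
have Ptail k n : (P (tail k n) <= (n.+1%:R^-1)%:E)%E.
  have nd : nondecreasing_seq (exceedance k.+1%:R^-1 (N0 (k, n))).
    move=> m m' mm'; apply/subsetPset => om [l [/andP[Nl lm] Vl]]; exists l; split => //.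
    by rewrite Nl (leq_trans lm).
  have cv := nondecreasing_cvg_mu (mu := P) (fun m => measurable_exceedance _ _ m)
    (mtail k n) nd.
  rewrite -(cvg_lim _ cv)//; apply: lime_le; first by apply/cvg_ex; eexists; exact: cv.
  exists (N0 (k, n)) => // m /= Nm; exact: (HN0 (k, n)).
pose bad k := \bigcap_n tail k n.
have mbad : forall k, measurable (bad k).
  by move=> k; apply: bigcapT_measurable.
have Pbad k : P (bad k) = 0%E.
  apply/eqP; rewrite eq_le measure_ge0 andbT; apply/lee_addgt0Pr => e e0.
  rewrite add0e; have [n ne] : exists n : nat, n.+1%:R^-1 <= e.
    exact: exists_invS_le.
  apply: le_trans (_ : P (tail k n) <= e%:E)%E.
    by apply: le_measure; rewrite ?inE//; exact: bigcap_inf.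
  by apply: (le_trans (Ptail k n)); rewrite lee_fin.
have bad_neg k : P.-negligible (bad k) by apply/negligibleP; [exact: mbad|exact: Pbad].
have neg := negligible_bigcup bad_neg.
apply: negligibleS neg => om /= nc; apply: contrapT => nb; apply: nc.
apply/cvgrPdist_le => e e0.
have [k ke] : exists k : nat, k.+1%:R^-1 <= e.
  exact: exists_invS_le.
have [n hn] : exists n, ~ tail k n om.
  by apply: contrapT => h; apply: nb; exists k => // n _; apply: contrapT => hn; apply: h; exists n.
exists (N0 (k, n)) => // l /= Nl.
rewrite sub0r normrN ger0_norm//; apply: le_trans ke; rewrite leNgt; apply/negP => Vl.
by apply: hn; exists l => //; exists l; split => //; rewrite Nl leqnn.
Qed.

End almost_sure_criterion.

(* Linear arithmetic over opaque atoms: [lra] alone would compare the integrals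
   up to conversion. *)
Ltac lra_atoms := repeat match goal with
  | |- context [Rintegral ?m ?D ?f] => generalize (Rintegral m D f)
  | |- context [log_loss ?m ?F ?r ?u] => generalize (log_loss m F r u)
  | |- context [drift ?m ?F ?r ?u ?y] => generalize (drift m F r u y)
  | |- context [predictive ?F ?r ?u ?y] => generalize (predictive F r u y)
  | |- context [l1dist ?F ?u ?v] => generalize (l1dist F u v)
  | |- context [bigop.body ?i ?r ?F] => generalize (bigop.body i r F)
  end; intros; lra.

Section almost_sure.
Context {R : realType} dO (Omega : measurableType dO) (P : probability Omega R).
Context d1 d2 (T : measurableType d1) (S : measurableType d2).
Variables (M : probability T R) (F : probability S R) (r : T -> S -> R) (b : R).
Variables (w : nat -> R) (X : nat -> Omega -> T) (x0 : T) (c0 rho kappa : R).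
Hypothesis mr : measurable_fun setT (fun z : T * S => r z.1 z.2).
Hypothesis b1 : 1 <= b.
Hypothesis rb : forall x t, b^-1 <= r x t <= b.
Hypothesis B1 : condB1 w.
Hypothesis mX : forall i, measurable_fun setT (X i).
Hypothesis c00 : 0 <= c0.
Hypothesis rho01 : 0 < rho < 1.
Hypothesis kappa_le : forall u, mix_density F u -> kappa <= log_loss M F r u.
Hypothesis kappa_adherent : forall e, 0 < e ->
  exists2 u, mix_density F u & log_loss M F r u < kappa + e.

Definition hist k (om : Omega) : k.-tuple T := [tuple X j.+1 om | j < k].

Hypothesis decorrelation : forall k i (Phi : k.-tuple T -> T -> R) c, (k < i)%N ->
  0 <= c ->
  measurable_fun setT (fun z : k.-tuple T * T => Phi z.1 z.2) ->
  (forall v x, 0 <= Phi v x <= c) ->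
  `|\int[P]_om Phi (hist k om) (X i om) - \int[P]_om \int[M]_x Phi (hist k om) x|
    <= c * (c0 * rho ^+ (i - k)).

Let A := b ^+ 2.
Let w01 : forall i, (0 < i)%N -> 0 < w i <= 1. Proof. by have [] := B1. Qed.
Let w0 i : (0 < i)%N -> 0 <= w i. Proof. by move=> /w01 /andP[/ltW]. Qed.
Let b0 : 0 < b. Proof. exact: lt_le_trans ltr01 b1. Qed.
Let A0 : 0 <= A. Proof. exact: sqr_ge0. Qed.
Let b8 : 0 <= 3 * b ^+ 8. Proof. by rewrite mulr_ge0// exprn_ge0// ltW. Qed.
Let b4 : 0 <= b ^+ 4. Proof. by rewrite exprn_ge0// ltW. Qed.

Local Notation U := (tilt F r w).
Local Notation J := (log_loss M F r).
Local Notation V y n := (J (U y n) - kappa).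
Local Notation traj om := (X^~ om).

Let dU y n : mix_density F (U y n). Proof. exact: (tilt_density F mr b1 rb). Qed.

Let V_ge0 y n : 0 <= V y n.
Proof. by rewrite subr_ge0; exact: kappa_le. Qed.

Lemma bmf_path_loss d (Z : measurableType d) (Y : nat -> Z -> T) n :
  (forall j, measurable_fun setT (Y j)) -> bmf (fun z => J (U (Y^~ z) n)).
Proof.
move=> mY; apply: (bmf_param_log_loss M mr b1 rb (U := fun z => U (Y^~ z) n)) => //.
exact: (bmf_tilt F mr b1 rb w01 n mY).
Qed.

Lemma bmf_path_drift d (Z : measurableType d) (Y : nat -> Z -> T) n :
  (forall j, measurable_fun setT (Y j)) ->
  bmf (fun z : Z * T => drift M F r (U (Y^~ z.1) n) z.2).
Proof.
move=> mY; apply: (bmf_param_drift M mr b1 rb (U := fun z => U (Y^~ z) n)) => //.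
exact: (bmf_tilt F mr b1 rb w01 n mY).
Qed.

Lemma bmf_path_gain us d (Z : measurableType d) (Y : nat -> Z -> T) n :
  mix_density F us -> (forall j, measurable_fun setT (Y j)) ->
  bmf (fun z : Z * T => predictive F r us z.2 / predictive F r (U (Y^~ z.1) n) z.2).
Proof.
move=> ds mY; apply: bmfM; first exact: (bmf_comp (bmf_predictive mr b1 rb ds)).
apply: (bmfV (c := b^-1)); first by rewrite invr_gt0.
  by move=> z; have /andP[] := predictive_bounds mr b1 rb z.2 (dU (Y^~ z.1) n).
have [] // := bmf_param_predictive F mr b1 rb (U := fun z => U (Y^~ z) n) _.
exact: (bmf_tilt F mr b1 rb w01 n mY).
Qed.

Let mpair i : measurable_fun setT (fun om => (om, X i om)).
Proof. exact: measurable_fun_pair. Qed.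

(** A function of the whole trajectory that reads only its first [k] terms is a
    function of the history; being defined on sequences, it can be composed with
    [tilt] without dependent types. *)
Lemma decorrelation_seq k i (Psi : (nat -> T) -> T -> R) c : (k < i)%N -> 0 <= c ->
  measurable_fun setT (fun z : k.-tuple T * T => Psi (extend x0 z.1) z.2) ->
  (forall y y', (forall j, (0 < j <= k)%N -> y j = y' j) -> Psi y = Psi y') ->
  (forall y x, 0 <= Psi y x <= c) ->
  `|\int[P]_om Psi (traj om) (X i om) - \int[P]_om \int[M]_x Psi (traj om) x|
    <= c * (c0 * rho ^+ (i - k)).
Proof.
move=> ki c_ge0 mPsi loc Psib.
have E om : Psi (extend x0 (hist k om)) = Psi (traj om).
  apply: loc => -[|j]// /andP[_ jk].
  rewrite /extend -[LHS]/(nth x0 (hist k om) (Ordinal jk)) -tnth_nth.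
  by rewrite tnth_mktuple.
have e1 : (fun om => Psi (extend x0 (hist k om)) (X i om)) =
    (fun om => Psi (traj om) (X i om)) by apply/funext => om; rewrite E.
have e2 : (fun om => \int[M]_x Psi (extend x0 (hist k om)) x) =
    (fun om => \int[M]_x Psi (traj om) x) by apply/funext => om; rewrite E.
have := decorrelation ki c_ge0 mPsi (fun v => Psib (extend x0 v)).
by rewrite e1 e2.
Qed.

Let gap k i : R := \sum_(k.+1 <= j < i) w j.

Let gap_ge0 k i : 0 <= gap k i.
Proof. by rewrite /gap big_nat sumr_ge0// => j /andP[kj _]; apply: w0; lia. Qed.

Let U_lag y k i : (k < i)%N -> l1dist F (U y i.-1) (U y k) <= A * gap k i.
Proof.
case: i => // i; rewrite ltnS => ki /=.
exact: (tilt_lip F mr b1 rb w01).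
Qed.

Let rho_ge0 n : 0 <= rho ^+ n.
Proof. by apply: exprn_ge0; have /andP[/ltW] := rho01. Qed.

Let C1 := 3 * b ^+ 8 * A + A * c0.

Let C1_ge0 : 0 <= C1.
Proof. by rewrite /C1; apply: addr_ge0; exact: mulr_ge0. Qed.

(** In conditional mean given a past event the loss does not increase, up to
    the error of replacing the current density by the one at time [k]. *)
Lemma mean_loss_increment (al : (nat -> T) -> R) k i : (k < i)%N ->
  bmf (fun v : k.-tuple T => al (extend x0 v)) -> bmf (fun om => al (traj om)) ->
  (forall y y', (forall j, (0 < j <= k)%N -> y j = y' j) -> al y = al y') ->
  (forall y, 0 <= al y <= 1) ->
  \int[P]_om (al (traj om) * (J (U (traj om) i) - J (U (traj om) i.-1))) <=
    C1 * (w i * (gap k i + rho ^+ (i - k))) + A ^+ 3 * w i ^+ 2.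
Proof.
move=> ki mal mal' loc al01.
have i0 : (0 < i)%N by case: i ki.
pose G y x := drift M F r (U y k) x.
have bG : bmf (fun om => G (traj om) (X i om)).
  exact: (bmf_comp (bmf_path_drift k mX) (mpair i)).
have bGM : bmf (fun om => \int[M]_x G (traj om) x).
  exact: (bmf_mean M (bmf_path_drift k mX)).
have step om : al (traj om) * (J (U (traj om) i) - J (U (traj om) i.-1)) <=
    w i * (al (traj om) - al (traj om) * G (traj om) (X i om)) +
    (w i * (3 * b ^+ 8 * A * gap k i) + A ^+ 3 * w i ^+ 2).
  set y := traj om; have /andP[a0 a1] := al01 y.
  have h1 : J (U y i) - J (U y i.-1) <=
      - (w i * (drift M F r (U y i.-1) (X i om) - 1)) + A ^+ 3 * w i ^+ 2.
    have := log_loss_update M mr b1 rb (X i om) (dU y i.-1) (w01_le w01 i0).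
    have <- : U y i = update F r (w i) (X i om) (U y i.-1) by case: (i) i0.
    by rewrite -/A; move: (A ^+ 3 * _); lra_atoms.
  have h2 : G y (X i om) - 3 * b ^+ 8 * A * gap k i <= drift M F r (U y i.-1) (X i om).
    clear h1; have := drift_lip M mr b1 rb (X i om) (dU y i.-1) (dU y k).
    rewrite ler_norml => /andP[+ _].
    have : 3 * b ^+ 8 * l1dist F (U y i.-1) (U y k) <= 3 * b ^+ 8 * (A * gap k i).
      exact: ler_wpM2l (U_lag _ ki).
    by rewrite mulrA /G; move: (_ * gap k i) (3 * b ^+ 8 * _); lra_atoms.
  have g0 : 0 <= 3 * b ^+ 8 * A * gap k i by apply: mulr_ge0 => //; exact: mulr_ge0.
  have q0 : 0 <= A ^+ 3 * w i ^+ 2 by rewrite mulr_ge0 ?sqr_ge0// exprn_ge0.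
  have wi := w0 i0.
  have h3 : J (U y i) - J (U y i.-1) <=
      w i * (1 - G y (X i om)) + (w i * (3 * b ^+ 8 * A * gap k i) + A ^+ 3 * w i ^+ 2).
    apply: (le_trans h1); clear h1; rewrite addrA lerD2r -mulrDr -mulrN.
    by apply: ler_wpM2l => //; move: h2 {g0 q0}; move: (_ * gap k i); rewrite /G; lra_atoms.
  apply: (le_trans (ler_wpM2l a0 h3)); rewrite mulrDr; apply: lerD.
    by rewrite le_eqVlt; apply/orP; left; apply/eqP; ring.
  by apply: ler_piMl => //; rewrite addr_ge0// mulr_ge0.
have bL : bmf (fun om => al (traj om) * (J (U (traj om) i) - J (U (traj om) i.-1))).
  by apply: bmfM => //; apply: bmfB; exact: bmf_path_loss.
have bag : bmf (fun om => al (traj om) * G (traj om) (X i om)) by exact: bmfM.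
have bR0 : bmf (fun om => al (traj om) - al (traj om) * G (traj om) (X i om)) by exact: bmfB.
apply: (@le_trans _ _ (\int[P]_om (
    w i * (al (traj om) - al (traj om) * G (traj om) (X i om)) +
    (w i * (3 * b ^+ 8 * A * gap k i) + A ^+ 3 * w i ^+ 2)))).
  by apply: le_mean => //; apply: bmfD; [exact: bmfZ|exact: bmf_cst].
rewrite meanD; [|exact: bmfZ|exact: bmf_cst].
rewrite mean_cst addrA lerD2r meanZ// meanB//.
have dec := @decorrelation_seq k i (fun y x => al y * G y x) A ki A0 _ _ _.
have {}dec : `|\int[P]_om (al (traj om) * G (traj om) (X i om)) -
    \int[P]_om \int[M]_x (al (traj om) * G (traj om) x)| <= A * (c0 * rho ^+ (i - k)).
  apply: dec.
  - apply: measurable_funM.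
      by have [mm _] := mal; exact: (measurableT_comp mm).
    have := @bmf_path_drift _ (k.-tuple T) (fun j v => extend x0 v j) k _.
    by case=> // j; exact: measurable_extend.
  - move=> y y' yy'; apply/funext => x; rewrite /G (loc _ _ yy').
    by rewrite (tilt_local _ _ _ yy').
  - move=> y x; have /andP[a0 a1] := al01 y.
    have /andP[g0 g1] := drift_bounds M mr b1 rb x (dU y k).
    rewrite mulr_ge0//=; apply: le_trans g1; exact: ler_piMl.
have bP : \int[P]_om al (traj om) <= \int[P]_om \int[M]_x (al (traj om) * G (traj om) x).
  have bGx om : bmf (G (traj om)) by exact: (bmf_drift M mr b1 rb (dU _ _)).
  apply: le_mean => //.
    rewrite (_ : (fun _ => _) = fun om => al (traj om) * \int[M]_x G (traj om) x).
      exact: bmfM.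
    by apply/funext => om; rewrite meanZ.
  move=> om; rewrite meanZ//; have /andP[a0 a1] := al01 (traj om).
  by rewrite ler_peMr// (mean_drift_ge1 M mr b1 rb (dU _ _)).
move: dec; rewrite ler_norml => /andP[dec _].
rewrite -mulrDr [leRHS]mulrCA /C1; apply: ler_wpM2l; first exact: w0.
have : 0 <= A * c0 * gap k i by apply: mulr_ge0 => //; exact: mulr_ge0.
have : 0 <= 3 * b ^+ 8 * A * rho ^+ (i - k) by apply: mulr_ge0 => //; exact: mulr_ge0.
rewrite mulrDr !mulrDl; move: dec bP; rewrite [A * (c0 * _)]mulrA.
move: (A * c0 * gap k i) (A * c0 * rho ^+ _) (_ * A * gap k i) (_ * A * rho ^+ _).
by lra_atoms.
Qed.

Let C2 := b ^+ 4 * A + A * A + A * c0.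

(** The gain against the density at time [k] is decorrelated from the past, and
    exchanging that density for the current one is Lipschitz in [L1]. *)
Lemma mean_gain_lag us k i : mix_density F us -> (k < i)%N ->
  1 + \int[P]_om J (U (traj om) i.-1) - J us - C2 * (gap k i + rho ^+ (i - k)) <=
  \int[P]_om (predictive F r us (X i om) / predictive F r (U (traj om) i.-1) (X i om)).
Proof.
move=> ds ki.
pose Q n y x := predictive F r us x / predictive F r (U y n) x.
have bQ n : bmf (fun om => Q n (traj om) (X i om)).
  exact: (bmf_comp (bmf_path_gain n ds mX) (mpair i)).
have bJ n : bmf (fun om => J (U (traj om) n)) by exact: bmf_path_loss.
have h1 : \int[P]_om Q k (traj om) (X i om) - b ^+ 4 * A * gap k i <=
    \int[P]_om Q i.-1 (traj om) (X i om).
  rewrite -[X in _ - X](mean_cst P) -meanB//; last exact: bmf_cst.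
  apply: le_mean => //; first by apply: bmfB => //; exact: bmf_cst.
  move=> om; have := gain_lip mr b1 rb (X i om) ds (dU (traj om) i.-1) (dU (traj om) k).
  rewrite ler_norml => /andP[+ _].
  have : b ^+ 4 * l1dist F (U (traj om) i.-1) (U (traj om) k) <= b ^+ 4 * (A * gap k i).
    exact: ler_wpM2l (U_lag _ ki).
  by rewrite mulrA /Q; move: (_ * gap k i) (b ^+ 4 * l1dist _ _ _) (_ / _) (_ / _); lra_atoms.
have dec : `|\int[P]_om Q k (traj om) (X i om) - \int[P]_om \int[M]_x Q k (traj om) x|
    <= A * (c0 * rho ^+ (i - k)).
  apply: decorrelation_seq => //.
  - have := @bmf_path_gain us _ (k.-tuple T) (fun j v => extend x0 v j) k ds _.
    by case=> // j; exact: measurable_extend.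
  - by move=> y y' yy'; apply/funext => x; rewrite /Q (tilt_local _ _ _ yy').
  - by move=> y x; exact: (gain_bounds mr b1 rb x ds (dU y k)).
have h2 : 1 + (\int[P]_om J (U (traj om) k) - J us) <=
    \int[P]_om \int[M]_x Q k (traj om) x.
  rewrite -[X in X + _](mean_cst P) -[X in _ - X](mean_cst P) -meanB//; last exact: bmf_cst.
  rewrite -meanD; [|exact: bmf_cst|by apply: bmfB => //; exact: bmf_cst].
  apply: le_mean.
  - by apply: bmfD; [exact: bmf_cst|apply: bmfB => //; exact: bmf_cst].
  - exact: (bmf_mean M (bmf_path_gain k ds mX)).
  - by move=> om; exact: (mean_gain M mr b1 rb ds (dU _ _)).
have h3 : \int[P]_om J (U (traj om) i.-1) - A * A * gap k i <= \int[P]_om J (U (traj om) k).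
  rewrite -[X in _ - X](mean_cst P) -meanB//; last exact: bmf_cst.
  apply: le_mean => //; first by apply: bmfB => //; exact: bmf_cst.
  clear h1 dec h2; move=> om; have := log_loss_lip M mr b1 rb (dU (traj om) i.-1) (dU (traj om) k).
  rewrite ler_norml => /andP[_ +].
  have : A * l1dist F (U (traj om) i.-1) (U (traj om) k) <= A * (A * gap k i).
    by apply: ler_wpM2l (U_lag _ ki).
  by rewrite mulrA -/A; move: (_ * gap k i) (A * l1dist _ _ _); lra_atoms.
move: dec; rewrite ler_norml => /andP[dec _].
have : 0 <= A * c0 * gap k i by apply: mulr_ge0 => //; exact: mulr_ge0.
have : 0 <= (b ^+ 4 * A + A * A) * rho ^+ (i - k).
  by apply: mulr_ge0 => //; apply: addr_ge0; exact: mulr_ge0.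
move: dec h1 h2 h3; rewrite [A * (c0 * _)]mulrA /C2.
have -> : (b ^+ 4 * A + A * A + A * c0) * (gap k i + rho ^+ (i - k)) =
  b ^+ 4 * A * gap k i + A * A * gap k i + A * c0 * gap k i +
  ((b ^+ 4 * A + A * A) * rho ^+ (i - k) + A * c0 * rho ^+ (i - k)) by ring.
rewrite /Q; move: (A * c0 * gap k i) (A * c0 * rho ^+ (i - k)) (A * A * gap k i).
by move: (b ^+ 4 * A * gap k i) ((b ^+ 4 * A + A * A) * rho ^+ (i - k)); lra_atoms.
Qed.

(** The entropy drops telescope to the mean of [ln (tilt y n)] under the density
    [us], which is at most [c - 1] by [ln z <= z - 1]. *)
Lemma entropy_budget us c y n : mix_density F us -> (forall t, us t <= c) ->
  \sum_(1 <= i < n.+1) (w i * (predictive F r us (y i) /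
     predictive F r (U y i.-1) (y i) - 1) - A ^+ 3 * w i ^+ 2) <= c - 1.
Proof.
move=> ds usc; have [bs s0 s1] := ds; have [bU U0 U1] := dU y n.
have An k : 0 < A ^- k by rewrite invr_gt0 exprn_gt0// exprn_gt0.
have bln k : bmf (fun t => ln (U y k t)).
  by apply: bmf_ln_density (dU y k) (An k) _ => t; exact: (tilt_ge F mr b1 rb w01).
apply: (@le_trans _ _ (\int[F]_t (us t * ln (U y n t)))).
  elim: n {bU U0 U1} => [|n IH].
    rewrite big_geq// /=; apply: mean_ge_cst => [|t]; last by rewrite ln1 mulr0.
    by apply: bmfM => //; exact: bmf_cst.
  rewrite big_nat_recr//=.
  have := entropy_update mr b1 rb (y n.+1) ds (dU y n) (An n) _ (w01_le w01 (ltn0Sn n)).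
  move=> /(_ (fun t => tilt_ge F mr b1 rb w01 y n t)); apply: le_trans.
  by rewrite -addrA lerD2r.
have -> : c - 1 = \int[F]_t (c * U y n t - us t).
  by rewrite meanB//; [rewrite meanZ// U1 s1 mulr1|exact: bmfZ].
apply: le_mean; [exact: bmfM|by apply: bmfB => //; exact: bmfZ|].
move=> t; have Ut : 0 < U y n t by apply: lt_le_trans (tilt_ge F mr b1 rb w01 y n t).
apply: (@le_trans _ _ (us t * (U y n t - 1))).
  by apply: ler_wpM2l => //; exact: ln_upper.
rewrite mulrBr mulr1 lerD2r; exact: ler_wpM2r.
Qed.

Lemma mean_loss_budget us : mix_density F us ->
  exists C, forall n,
    \sum_(1 <= i < n) w i * (\int[P]_om J (U (traj om) i.-1) - J us) <= C.
Proof.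
move=> ds; have [[_ [c hc]] _ _] := ds.
have usc t : us t <= c by apply: le_trans (hc t); exact: ler_norm.
have [a [CL hL]] := sum_lag_error B1 rho01.
have [CS hS] := sum_sqr_step B1.
exists (c - 1 + A ^+ 3 * CS + C2 * CL) => n.
have C20 : 0 <= C2 by rewrite /C2 !addr_ge0// mulr_ge0.
pose Q i om := predictive F r us (X i om) / predictive F r (U (traj om) i.-1) (X i om).
have bQ i : bmf (Q i) by exact: (bmf_comp (bmf_path_gain i.-1 ds mX) (mpair i)).
have h1 : \sum_(1 <= i < n) (w i * (\int[P]_om Q i om - 1)) <= c - 1 + A ^+ 3 * CS.
  have bQ1 i : bmf (fun om => w i * (Q i om - 1)).
    by apply: bmfZ; apply: bmfB => //; exact: bmf_cst.
  have [bs sE] := mean_sum P 1 n bQ1.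
  rewrite (eq_bigr (fun i => \int[P]_om (w i * (Q i om - 1)))); last first.
    move=> i _; rewrite meanZ; last by apply: bmfB => //; exact: bmf_cst.
    by rewrite meanB// ?mean_cst//; exact: bmf_cst.
  rewrite -sE; apply: mean_le_cst => // om.
  have := entropy_budget (traj om) n.-1 ds usc.
  have -> : \sum_(1 <= i < n.-1.+1) (w i * (predictive F r us (traj om i) /
     predictive F r (U (traj om) i.-1) (traj om i) - 1) - A ^+ 3 * w i ^+ 2) =
    \sum_(1 <= i < n) (w i * (Q i om - 1)) - A ^+ 3 * \sum_(1 <= i < n) w i ^+ 2.
    rewrite mulr_sumr -sumrB; case: (n) => // ; by rewrite !big_geq.
  have : A ^+ 3 * \sum_(1 <= i < n) w i ^+ 2 <= A ^+ 3 * CS.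
    by apply: ler_wpM2l => //; exact: exprn_ge0.
  lra.
have h2 : C2 * \sum_(1 <= i < n) w i * (gap (lag a i) i + rho ^+ (i - lag a i)) <= C2 * CL.
  by apply: ler_wpM2l => //; exact: hL.
apply: le_trans (lerD h1 h2); rewrite mulr_sumr -big_split/=.
apply: ler_sum_nat => i /andP[i0 _].
rewrite mulrCA -mulrDr; apply: ler_wpM2l; first exact: w0.
have := mean_gain_lag ds (lag_ltn a i0); rewrite -/(Q i); lra.
Qed.

(** Otherwise a competitor within [e / 2] of the infimum would beat the iterates
    by [e / 2] at every late step, and the bounded sum of [mean_loss_budget] would
    grow like the sum of the steps. *)
Lemma liminf_mean_loss e N : 0 < e ->
  exists2 n, (N <= n)%N & \int[P]_om V (traj om) n <= e.
Proof.
move=> e0; apply: contrapT => hN.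
have bJ n : bmf (fun om => J (U (traj om) n)) by exact: bmf_path_loss.
have Ve n : (N <= n)%N -> kappa + e < \int[P]_om J (U (traj om) n).
  move=> Nn; rewrite ltNge; apply/negP => h; apply: hN; exists n => //.
  by rewrite meanB//; [rewrite mean_cst; lra|exact: bmf_cst].
have e20 : 0 < e / 2 by rewrite divr_gt0.
have [us ds Jus] := kappa_adherent e20.
have [C hC] := mean_loss_budget ds.
have [n hn] := sum_step_unbounded B1 (2 / e * (C + e * \sum_(1 <= i < N.+1) w i)).
have h1 : e / 2 * \sum_(1 <= i < n) w i - e * \sum_(1 <= i < N.+1) w i <= C.
  apply: le_trans (hC (maxn n N.+1)).
  apply: (@le_trans _ _ (e / 2 * (\sum_(1 <= i < maxn n N.+1) w i) - e * \sum_(1 <= i < N.+1) w i)).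
    rewrite lerD2r; apply: ler_wpM2l; first exact: ltW.
    have [n0|n0] := posnP n; first by rewrite n0 big_geq// big_nat sumr_ge0// => i /andP[+ _]; exact: w0.
    rewrite [leRHS](@big_cat_nat _ _ _ n)//= ?leq_max ?leqnn// lerDl.
    by rewrite big_nat sumr_ge0// => i /andP[ni _]; apply: w0; exact: leq_trans ni.
  rewrite ![\sum_(1 <= i < maxn n N.+1) _](@big_cat_nat _ _ _ N.+1)//= ?leq_max ?leqnn ?orbT//.
  have h2 : - (e / 2) * (\sum_(1 <= i < N.+1) w i) <=
    \sum_(1 <= i < N.+1) w i * (\int[P]_om J (U (traj om) i.-1) - J us).
    rewrite mulr_sumr; apply: ler_sum_nat => i /andP[i0 _].
    rewrite mulrC; apply: ler_wpM2l; first exact: w0.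
    have : kappa <= \int[P]_om J (U (traj om) i.-1).
      by apply: mean_ge_cst => // om; exact: kappa_le.
    lra.
  have h3 : (e / 2) * (\sum_(N.+1 <= i < maxn n N.+1) w i) <=
    \sum_(N.+1 <= i < maxn n N.+1) w i * (\int[P]_om J (U (traj om) i.-1) - J us).
    rewrite mulr_sumr; apply: ler_sum_nat => i /andP[i0 _].
    rewrite mulrC; apply: ler_wpM2l; first by apply: w0; exact: leq_trans i0.
    have : (N <= i.-1)%N by rewrite -ltnS prednK//; exact: leq_trans i0.
    by move=> /Ve; lra.
  by apply: le_trans (lerD h2 h3); lra.
have : e / 2 * (2 / e * (C + e * \sum_(1 <= i < N.+1) w i)) <
    e / 2 * \sum_(1 <= i < n) w i by rewrite ltr_pM2l.
have -> : e / 2 * (2 / e * (C + e * \sum_(1 <= i < N.+1) w i)) =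
  C + e * \sum_(1 <= i < N.+1) w i by field; lra.
lra.
Qed.

(** The event that the excess loss has not exceeded [lam] between the times [N]
    and [j], as a weight in the reals so that it can multiply loss increments. *)
Definition alive lam N j (y : nat -> T) : R :=
  \prod_(N <= l < j.+1) (V y l <= lam)%R%:R.

Lemma alive_bool lam N j y : alive lam N j y = 0 \/ alive lam N j y = 1.
Proof.
rewrite /alive; elim: (index_iota _ _) => [|l s [IH|IH]]; rewrite ?big_nil ?big_cons.
- by right.
- by left; rewrite IH mulr0.
- by rewrite IH mulr1; case: (_ <= _); [right|left].
Qed.

Lemma alive_bounds lam N j y : 0 <= alive lam N j y <= 1.
Proof. by have [->|->] := alive_bool lam N j y; rewrite lexx ler01. Qed.

Lemma alive_early lam N j y : (j < N)%N -> alive lam N j y = 1.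
Proof. by move=> jN; rewrite /alive big_geq. Qed.

Lemma aliveS lam N j y : (N <= j.+1)%N ->
  alive lam N j.+1 y = alive lam N j y * (V y j.+1 <= lam)%R%:R.
Proof. by move=> Nj; rewrite /alive big_nat_recr. Qed.

Lemma alive_nincr lam N j j' y : (j <= j')%N -> alive lam N j' y <= alive lam N j y.
Proof.
elim: j' => [|j' IH]; first by rewrite leqn0 => /eqP ->.
rewrite leq_eqVlt => /predU1P[->//|/IH]; apply: le_trans.
have [Nj|jN] := leqP N j'.+1; last by rewrite !alive_early// ltnW.
rewrite aliveS//; have /andP[a0 _] := alive_bounds lam N j' y.
by apply: ler_piMr => //; rewrite lern1 leq_b1.
Qed.

Lemma alive_local lam N k j y y' : (j <= k)%N ->
  (forall l, (0 < l <= k)%N -> y l = y' l) -> alive lam N j y = alive lam N j y'.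
Proof.
move=> jk yy'; rewrite /alive; apply: eq_big_nat => l /andP[_ lj].
rewrite (@tilt_local _ _ _ _ _ F r w y y')// => i /andP[i0 il]; apply: yy'.
by rewrite i0 (leq_trans il)// (leq_trans _ jk).
Qed.

Lemma bmf_alive lam N j d (Z : measurableType d) (Y : nat -> Z -> T) :
  (forall j, measurable_fun setT (Y j)) -> bmf (fun z => alive lam N j (Y^~ z)).
Proof.
move=> mY; split; last first.
  exists 1 => z; have /andP[a0 a1] := alive_bounds lam N j (Y^~ z).
  by rewrite ger0_norm.
rewrite /alive; elim: (index_iota _ _) => [|l s IH].
  by under eq_fun do rewrite big_nil; exact: measurable_cst.
under eq_fun do rewrite big_cons; apply: measurable_funM => //.
apply: (@measurableT_comp _ _ _ _ _ _ (fun c : bool => c%:R : R)) => //.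
apply: measurable_fun_ler => //; apply: measurable_funB => //.
by have [] := bmf_path_loss l mY.
Qed.

(** Optional stopping along one trajectory: the increments up to the first exit
    telescope, and the loss at the exit is above [lam]. *)
Lemma alive_optional lam N m y : 0 < lam -> (N <= m)%N ->
  alive lam N m y * V y m + lam * (1 - alive lam N m y) - V y N <=
  \sum_(N.+1 <= i < m.+1) alive lam N i.-1 y * (J (U y i) - J (U y i.-1)).
Proof.
move=> l0; elim: m => [|m IH].
  rewrite leqn0 => /eqP ->; rewrite big_geq// /alive big_nat1.
  move: (V_ge0 y 0); case: (leP (V y 0) lam) => /=; by lra_atoms.
rewrite leq_eqVlt => /predU1P[<- {IH}|Nm].
  rewrite big_geq// /alive big_nat1.
  move: (V_ge0 y N); case: (leP (V y N) lam) => /=; by lra_atoms.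
have -> : \sum_(N.+1 <= i < m.+2) alive lam N i.-1 y * (J (U y i) - J (U y i.-1)) =
    \sum_(N.+1 <= i < m.+1) alive lam N i.-1 y * (J (U y i) - J (U y i.-1)) +
    alive lam N m y * (J (U y m.+1) - J (U y m)) by rewrite big_nat_recr.
move: (IH Nm) (V_ge0 y m.+1) => {IH}; rewrite aliveS; last by rewrite ltnW.
have [->|->] := alive_bool lam N m y; first by lra_atoms.
by case: (leP (V y m.+1) lam) => h; rewrite [nat_of_bool _]/=; move: h; lra_atoms.
Qed.

(** The two indicators differ only for the indices [i] such that the exit time
    lies between [lag a i] and [i]. *)
Lemma alive_straddle lam N a e m y : 0 <= e ->
  (forall j m, (N <= j)%N -> \sum_(j.+1 <= i < m | (lag a i < j)%N) w i <= e) ->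
  \sum_(N.+1 <= i < m) w i * (alive lam N (lag a i) y - alive lam N i.-1 y) <= e.
Proof.
move=> e0 he.
have [[t at0]|noz] := pselect (exists t, alive lam N t y == 0); last first.
  have al1 j : alive lam N j y = 1.
    have [a0|//] := alive_bool lam N j y; exfalso; apply: noz; exists j; exact/eqP.
  by rewrite big1// => i _; rewrite !al1 subrr mulr0.
have ex : exists t, alive lam N t y == 0 by exists t.
case: (ex_minnP ex) => {t at0} t /eqP at0 tmin.
have before j : (j < t)%N -> alive lam N j y = 1.
  move=> jt; have [a0|//] := alive_bool lam N j y.
  by move: (tmin j); rewrite a0 eqxx => /(_ isT); rewrite leqNgt jt.
have after j : (t <= j)%N -> alive lam N j y = 0.
  move=> tj; have := alive_nincr lam N y tj; rewrite at0.
  by have /andP[h1 _] := alive_bounds lam N j y => h2; apply/eqP; rewrite eq_le h2.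
have Nt : (N <= t)%N.
  rewrite leqNgt; apply/negP => tN; move: at0; rewrite alive_early// => /eqP.
  by rewrite oner_eq0.
apply: le_trans (he t m Nt).
rewrite (@big_nat_widenl _ _ _ t.+1 N.+1)//= [leRHS]big_mkcond/=.
apply: ler_sum_nat => i /andP[Ni _].
have i0 : (0 < i)%N by exact: leq_trans Ni.
have wi := w0 i0.
have pi : i = i.-1.+1 by rewrite prednK.
have [lt|tl] := ltnP (lag a i) t; have [ti|it] := ltnP t i => /=.
- by rewrite before// after ?subr0 ?mulr1// -ltnS -pi.
- by rewrite !before ?subrr ?mulr0// -pi.
- by rewrite !after ?subrr ?mulr0// -ltnS -pi.
- by move: (leq_ltn_trans tl (lag_ltn a i0)); rewrite ltnNge it.
Qed.

Lemma loss_increment_norm y i : (0 < i)%N ->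
  `|J (U y i) - J (U y i.-1)| <= A ^+ 2 * w i.
Proof.
case: i => // i _ /=; apply: (le_trans (log_loss_lip M mr b1 rb (dU y i.+1) (dU y i))).
rewrite (_ : A ^+ 2 * _ = A * (A * w i.+1)); last by ring.
apply: ler_wpM2l => //.
exact: (l1dist_update mr b1 rb _ (dU y i) (w01_le w01 _)).
Qed.

(** A maximal inequality: the stopped excess loss is a supermartingale up to
    summable errors. *)
Lemma excess_maximal lam e : 0 < lam -> 0 < e ->
  exists N, forall m, (N <= m)%N -> \int[P]_om (1 - alive lam N m (traj om)) <= e.
Proof.
move=> l0 e0; have [a [CL hL]] := sum_lag_error B1 rho01.
have [CS hS] := sum_sqr_step B1.
pose K := C1 + A ^+ 3 + A ^+ 2 + 1.
have K0 : 0 < K.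
  have A3 : 0 <= A ^+ 3 by exact: exprn_ge0.
  have A2 : 0 <= A ^+ 2 by exact: exprn_ge0.
  by apply: ltr_wpDl => //; apply: addr_ge0 => //; exact: addr_ge0.
(* Four errors, weighted by the summands of [K], are each at most [d]. *)
pose d := lam * e / K; have d0 : 0 < d by rewrite divr_gt0// mulr_gt0.
pose f i := w i * (gap (lag a i) i + rho ^+ (i - lag a i)).
have f0 i : (1 <= i)%N -> 0 <= f i.
  by move=> i0; apply: mulr_ge0; [exact: w0|exact: addr_ge0].
have [N1 h1] := bounded_sum_tail f0 hL d0.
have [N2 h2] := bounded_sum_tail (fun i _ => sqr_ge0 (w i)) hS d0.
have [N3 h3] := sum_lag_straddle a B1 d0.
have [N hN hV] := liminf_mean_loss (maxn N1 (maxn N2 N3)) d0.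
move: hN; rewrite !geq_max => /and3P[NN1 NN2 NN3].
exists N => m Nm.
have bal j : bmf (fun om => alive lam N j (traj om)) by exact: bmf_alive.
have bJ n : bmf (fun om => J (U (traj om) n)) by exact: bmf_path_loss.
have bV n : bmf (fun om => V (traj om) n) by apply: bmfB => //; exact: bmf_cst.
have b1al j : bmf (fun om => 1 - alive lam N j (traj om)).
  by apply: bmfB => //; exact: bmf_cst.
pose D i om := alive lam N i.-1 (traj om) * (J (U (traj om) i) - J (U (traj om) i.-1)).
have bD i : bmf (D i) by apply: bmfM => //; exact: bmfB.
pose g i om := w i * (alive lam N (lag a i) (traj om) - alive lam N i.-1 (traj om)).
have bg i : bmf (g i) by apply: bmfZ; exact: bmfB.
have [bsD sD] := mean_sum P N.+1 m.+1 bD.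
have [bsg sg] := mean_sum P N.+1 m.+1 bg.
have key i : (0 < i)%N -> \int[P]_om D i om <=
    C1 * f i + A ^+ 3 * w i ^+ 2 + A ^+ 2 * \int[P]_om g i om.
  move=> i0.
  have bk : bmf (fun om => alive lam N (lag a i) (traj om) *
      (J (U (traj om) i) - J (U (traj om) i.-1))) by apply: bmfM => //; exact: bmfB.
  have hk : \int[P]_om (alive lam N (lag a i) (traj om) *
      (J (U (traj om) i) - J (U (traj om) i.-1))) <= C1 * f i + A ^+ 3 * w i ^+ 2.
    have Ha : bmf (fun v : (lag a i).-tuple T => alive lam N (lag a i) (extend x0 v)).
      apply: (bmf_alive lam N (lag a i) (Y := fun j v => extend x0 v j)) => j.
      exact: measurable_extend.
    rewrite /f; exact: (mean_loss_increment (lag_ltn a i0) Ha (bal (lag a i))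
      (fun y y' => @alive_local lam N (lag a i) (lag a i) y y' (leqnn _))
      (alive_bounds lam N (lag a i))).
  apply: le_trans (lerD hk (lexx _)); rewrite -meanZ// -meanD//; last exact: bmfZ.
  apply: le_mean => //; first by apply: bmfD => //; exact: bmfZ.
  move=> om; rewrite /D /g.
  have := loss_increment_norm (traj om) i0; rewrite ler_norml => /andP[h _].
  have al0 : 0 <= alive lam N (lag a i) (traj om) - alive lam N i.-1 (traj om).
    by rewrite subr_ge0 alive_nincr// -ltnS prednK// lag_ltn.
  move: (ler_wpM2l al0 h) => {h al0}.
  set x := J (U (traj om) i) - _.
  move: (alive _ _ (lag a i) _) (alive _ _ i.-1 _) x (A ^+ 2) (w i) => p q x c v.
  by rewrite mulrN !mulrBl !mulrBr mulrCA; nra.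
have hg : \int[P]_om (\sum_(N.+1 <= i < m.+1) g i om) <= d.
  apply: mean_le_cst => // om; apply: alive_straddle; first exact: ltW.
  by move=> j n Nj; apply: h3; exact: leq_trans Nj.
have hD : \int[P]_om (\sum_(N.+1 <= i < m.+1) D i om) <= C1 * d + A ^+ 3 * d + A ^+ 2 * d.
  rewrite sD; apply: (@le_trans _ _ (\sum_(N.+1 <= i < m.+1)
     (C1 * f i + A ^+ 3 * w i ^+ 2 + A ^+ 2 * \int[P]_om g i om))).
    by apply: ler_sum_nat => i /andP[Ni _]; apply: key; exact: leq_trans Ni.
  rewrite 2!big_split/= -!mulr_sumr -sg; apply: lerD; first apply: lerD.
  - by apply: ler_wpM2l => //; apply: h1; rewrite (leq_trans NN1).
  - by apply: ler_wpM2l; [exact: exprn_ge0|apply: h2; rewrite (leq_trans NN2)].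
  - by apply: ler_wpM2l => //; exact: exprn_ge0.
have opt : lam * \int[P]_om (1 - alive lam N m (traj om)) - \int[P]_om V (traj om) N <=
    \int[P]_om (\sum_(N.+1 <= i < m.+1) D i om).
  rewrite -meanZ// -meanB//; last exact: bmfZ.
  apply: le_mean => //; first by apply: bmfB => //; exact: bmfZ.
  move=> om; apply: le_trans (alive_optional (traj om) l0 Nm).
  rewrite lerD2r lerDr; apply: mulr_ge0 => //.
  by have /andP[] := alive_bounds lam N m (traj om).
have : lam * \int[P]_om (1 - alive lam N m (traj om)) <= K * d.
  move: opt hD hV {h1 h2 h3 hg sD sg}; rewrite /K !mulrDl mul1r; lra_atoms.
by rewrite /d mulrCA divff ?gt_eqF// mulr1 ler_pM2l.
Qed.

Lemma ae_excess_cvg0 :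
  {ae P, forall om, (fun n => V (traj om) n) @ \oo --> (0 : R)}.
Proof.
have bV n : bmf (fun om => V (traj om) n).
  by apply: bmfB; [exact: bmf_path_loss|exact: bmf_cst].
apply: (ae_cvg0 (V := fun n om => V (traj om) n)) => [n|n om|lam e l0 e0].
- by have [] := bV n.
- exact: V_ge0.
have [N hN] := excess_maximal l0 e0; exists N => m Nm.
set E := exceedance _ _ _ _; have mE : measurable E.
  by apply: measurable_exceedance => n; have [] := bV n.
have bal : bmf (fun om => 1 - alive lam N m (traj om)).
  by apply: bmfB; [exact: bmf_cst|exact: bmf_alive].
have b1E : bmf (\1_E : Omega -> R).
  split; first exact: measurable_indic.
  by exists 1 => om; rewrite indicE; case: (_ \in _); rewrite ?normr1 ?normr0.
rewrite -[E]setIT -integral_indic// (bmf_EFin P b1E) lee_fin.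
apply: le_trans (hN _ Nm); apply: le_mean => // om.
rewrite indicE; have /andP[_ a1] := alive_bounds lam N m (traj om).
case: (boolP (om \in E)) => [|_]; last by rewrite subr_ge0.
rewrite inE => -[l [/andP[Nl lm] Vl]].
have -> : alive lam N m (traj om) = 0; last by rewrite subr0.
apply/eqP; rewrite eq_le (andP (alive_bounds lam N m (traj om))).1 andbT.
apply: (le_trans (alive_nincr lam N _ lm)).
rewrite /alive big_nat_recr// /= (_ : (V (traj om) l <= lam) = false) ?mulr0//.
by apply/negbTE; rewrite -ltNge.
Qed.

End almost_sure.

(** * Measures with a density *)

Section density.
Context {R : realType} d (T : measurableType d).
Variables (nu : {measure set T -> \bar R}) (g : T -> R).
Hypothesis mg : measurable_fun setT g.
Hypothesis g0 : forall x, 0 <= g x.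

Definition with_density of measurable_fun setT g & forall x, 0 <= g x :=
  fun A : set T => (\int[nu]_(x in A) (g x)%:E)%E.

Local Notation Q := (with_density mg g0).

Let Q0 : Q set0 = 0%E. Proof. by rewrite /Q integral_set0. Qed.

Let Q_ge0 A : (0 <= Q A)%E.
Proof. by apply: integral_ge0 => x _; rewrite lee_fin. Qed.

Let Q_sigma_additive : semi_sigma_additive Q.
Proof.
move=> /= A mA tA mUA; rewrite /Q/= ge0_integral_bigcup//=.
- apply: is_cvg_ereal_nneg_natsum_cond => n _ _.
  by apply: integral_ge0 => x _; rewrite lee_fin.
- by apply/measurable_EFinP; exact: measurable_funTS.
- by move=> x _; rewrite lee_fin.
Qed.

HB.instance Definition _ := isMeasure.Build _ _ _ Q Q0 Q_ge0 Q_sigma_additive.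

Import HBNNSimple.

Lemma ge0_integral_density (M : {measure set T -> \bar R}) (f : T -> \bar R) :
  (forall B, measurable B -> M B = (\int[nu]_(x in B) (g x)%:E)%E) ->
  measurable_fun setT f -> (forall x, 0 <= f x)%E ->
  (\int[M]_x f x = \int[nu]_x (f x * (g x)%:E))%E.
Proof.
move=> ME mf f0; pose h := nnsfun_approx measurableT mf.
have mgE : measurable_fun setT (fun x => (g x)%:E) by exact/measurable_EFinP.
have hcvg x : EFin \o h ^~ x @ \oo --> f x by apply: cvg_nnsfun_approx.
have -> : (\int[M]_x f x)%E = limn (fun n => \int[M]_x (h n x)%:E)%E.
  rewrite -monotone_convergence//.
  - by apply: eq_integral => x _; apply/esym/cvg_lim => //; exact: hcvg.
  - by move=> n; exact/measurable_EFinP/measurable_funP.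
  - by move=> n x _; rewrite lee_fin.
  - by move=> x _ a b ab; rewrite lee_fin; exact/lefP/nd_nnsfun_approx.
have -> : (\int[nu]_x (f x * (g x)%:E) = limn (fun n => \int[nu]_x ((h n x)%:E * (g x)%:E)))%E.
  rewrite -monotone_convergence//.
  - apply: eq_integral => x _; apply/esym/cvg_lim => //.
    by apply: cvgeZr => //; exact: hcvg.
  - by move=> n; apply: emeasurable_funM => //; exact/measurable_EFinP/measurable_funP.
  - by move=> n x _; rewrite mule_ge0 ?lee_fin.
  - move=> x _ a b ab; rewrite lee_wpmul2r ?lee_fin//; exact/lefP/nd_nnsfun_approx.
congr (limn _); apply/funext => n.
transitivity (\int[M]_x (\sum_(y \in range (h n)) (y * \1_(h n @^-1` [set y]) x)%:E))%E.
  by apply: eq_integral => t _; rewrite /= fimfunE -fsumEFin.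
have indich r : measurable_fun setT (fun x => (r * \1_(h n @^-1` [set r]) x)%:E).
  by apply: (measurable_comp measurableT) => //; exact: measurable_funM.
rewrite ge0_integral_fsum//; last by move=> m y _; exact: nnfun_muleindic_ge0.
transitivity (\int[nu]_x (\sum_(y \in range (h n))
    (y * \1_(h n @^-1` [set y]) x)%:E * (g x)%:E))%E; last first.
  apply: eq_integral => x _.
  rewrite -ge0_mule_fsuml => [|y]; last exact: nnfun_muleindic_ge0.
  by rewrite fsumEFin // -(fimfunE _ x).
rewrite ge0_integral_fsum//; last 2 first.
  - by move=> y; apply: emeasurable_funM.
  - by move=> m y _; apply: mule_ge0; [exact: nnfun_muleindic_ge0|rewrite lee_fin].
apply: eq_fsbigr => r rhn.
have mr : measurable (h n @^-1` [set r]) by [].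
under [LHS]eq_integral do rewrite EFinM.
rewrite integralZl_indic_nnsfun => //.
rewrite integral_indic// setIT ME//.
have r0 : 0 <= r by move: rhn; rewrite inE => -[x _ <-].
under [RHS]eq_integral do rewrite EFinM -muleA.
rewrite ge0_integralZl//.
- congr (_ * _)%E; rewrite integral_mkcond.
  by apply: eq_integral => x _; rewrite patchE indicE; case: ifPn => xr; rewrite ?mul1e ?mul0e.
- by apply: emeasurable_funM => //; exact/measurable_EFinP.
- by move=> x _; rewrite mule_ge0 ?lee_fin.
Qed.

End density.

Section density_probability.
Context {R : realType} d (T : measurableType d) (nu : {measure set T -> \bar R}).
Variables (g : T -> R) (dg : is_density nu g).

Let mg : measurable_fun setT g. Proof. by have [] := dg. Qed.
Let g0 x : 0 <= g x. Proof. by have [] := dg. Qed.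
Let Q := with_density nu mg g0.
Let Q1 : Q setT = 1%E. Proof. by have [] := dg. Qed.

HB.instance Definition _ := Measure.on Q.
HB.instance Definition _ := Measure_isProbability.Build _ _ _ Q Q1.

Definition density_probability : probability T R := Q.

Lemma density_probabilityE A :
  density_probability A = (\int[nu]_(x in A) (g x)%:E)%E.
Proof. by []. Qed.

Lemma ge0_integral_density_probability (f : T -> \bar R) :
  measurable_fun setT f -> (forall x, 0 <= f x)%E ->
  (\int[density_probability]_x f x = \int[nu]_x (f x * (g x)%:E))%E.
Proof. by move=> mf f0; apply: ge0_integral_density. Qed.

End density_probability.

(** * Decorrelation *)

Section conditional_density.
Context {R : realType} dO (Omega : measurableType dO) (P : probability Omega R).
Context d1 d2 (S : measurableType d1) (T : measurableType d2).
Variables (nu : {sigma_finite_measure set T -> \bar R}).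
Variables (Y : {RV P >-> S}) (X : {RV P >-> T}) (g : S -> T -> R).
Hypothesis mg : measurable_fun setT (fun z : S * T => g z.1 z.2).
Hypothesis g0 : forall y x, 0 <= g y x.
Hypothesis gE : forall (A : set S) (B : set T), measurable A -> measurable B ->
  P (Y @^-1` A `&` X @^-1` B) =
  (\int[P]_(om in Y @^-1` A) \int[nu]_(x in B) (g (Y om) x)%:E)%E.

Let mY : measurable_fun setT Y. Proof. exact: measurable_funP. Qed.
Let mX : measurable_fun setT X. Proof. exact: measurable_funP. Qed.

Lemma measurable_joint : measurable_fun setT (fun om => (Y om, X om)).
Proof. exact: measurable_fun_pair. Qed.

Let joint_mfun := isMeasurableFun.Build _ _ _ _ _ measurable_joint.
Let joint : {RV P >-> (S * T)%type} := HB.pack (fun om => (Y om, X om)) joint_mfun.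

(** Rectangles generate the product sigma-algebra, so they identify the joint
    law with the measure of density [g] with respect to the law of [Y] times [nu]. *)
Lemma mean_cond_density (Phi : S * T -> \bar R) :
  measurable_fun setT Phi -> (forall z, 0 <= Phi z)%E ->
  (\int[P]_om Phi (Y om, X om) =
   \int[P]_om \int[nu]_x (Phi (Y om, x) * (g (Y om) x)%:E))%E.
Proof.
move=> mPhi Phi0; pose pi := distribution P Y.
have mgE : measurable_fun setT (fun z : S * T => (g z.1 z.2)%:E) by exact/measurable_EFinP.
have marg (F : S * T -> \bar R) : measurable_fun setT F -> (forall z, 0 <= F z)%E ->
    (\int[pi \x nu]_z F z = \int[P]_om \int[nu]_x F (Y om, x))%E.
  move=> mF F0; rewrite (fubini_tonelli1 F)// ge0_integral_distribution//.
    exact: measurable_fun_fubini_tonelli_F.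
  by move=> y; apply: integral_ge0.
transitivity (\int[pi \x nu]_z (Phi z * (g z.1 z.2)%:E))%E; last first.
  rewrite marg//; first exact: emeasurable_funM.
  by move=> z; apply: mule_ge0; rewrite ?lee_fin.
transitivity (\int[distribution P joint]_z Phi z)%E.
  by rewrite ge0_integral_distribution.
apply: ge0_integral_density => // C mC.
pose Q := with_density (pi \x nu)%E mg (fun z => g0 z.1 z.2).
change (distribution P joint C = Q C).
pose G : set (set (S * T)) :=
  [set A `*` B | A in measurable & B in measurable].
apply: (measure_unique G (fun=> setT)) => //.
- exact: measurable_prod_measurableType.
- move=> _ _ [A1 mA1 [B1 mB1 <-]] [A2 mA2 [B2 mB2 <-]].
  exists (A1 `&` A2); first exact: measurableI.
  exists (B1 `&` B2); first exact: measurableI.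
  by rewrite setXI.
- by move=> _; exists setT => //; exists setT => //; rewrite setXTT.
- by rewrite bigcup_const.
- move=> _ [A mA [B mB <-]].
  transitivity (P (Y @^-1` A `&` X @^-1` B)); first by [].
  rewrite gE// /Q /with_density [RHS]integral_mkcond marg.
  + rewrite [LHS]integral_mkcond; apply: eq_integral => om _.
    rewrite patchE; case: ifPn => [|/negP] omA.
      rewrite integral_mkcond; apply: eq_integral => x _.
      move: omA; rewrite inE /= => omA; rewrite !patchE /=.
      congr (if _ then _ else _); apply/idP/idP; rewrite !inE; first by [].
      by case.
    rewrite integral0_eq// => x _; rewrite patchE; case: ifPn => //.
    by rewrite inE => -[/= omA' _]; exfalso; apply: omA; rewrite inE.
  + apply/(measurable_restrictT _ _).1; first exact: measurableX.
    exact: measurable_funTS.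
  + by move=> z; rewrite patchE; case: ifPn => // _; rewrite lee_fin.
- by move=> _; apply: (le_lt_trans (probability_le1 _ _)) => //; rewrite ltry.
Qed.

Variables (M : probability T R) (m : T -> R) (s : R).
Hypothesis mm : measurable_fun setT m.
Hypothesis m0 : forall x, 0 <= m x.
Hypothesis ME : forall B, measurable B -> M B = (\int[nu]_(x in B) (m x)%:E)%E.
Hypothesis XE : forall B, measurable B -> distribution P X B = M B.
Hypothesis s0 : 0 < s.
Hypothesis chi2 : (\int[P]_om \int[nu]_x
   ((g (Y om) x / m x - 1) ^+ 2 * m x)%:E <= (s ^+ 2)%:E)%E.

Let chi2_split (phi c gx mx : R) : 0 <= phi <= c -> 0 <= gx -> 0 < mx ->
  let e := c * s / 2 * mx + c / (2 * s) * ((gx / mx - 1) ^+ 2 * mx) in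
  phi * gx <= phi * mx + e /\ phi * mx <= phi * gx + e.
Proof.
move=> /andP[p0 pc] gx0 mx0 /=.
set z := gx / mx - 1; have -> : gx = (1 + z) * mx by rewrite /z; field; lra.
have -> : c * s / 2 * mx + c / (2 * s) * (z ^+ 2 * mx) =
  c / (2 * s) * (s ^+ 2 + z ^+ 2) * mx by field; rewrite gt_eqF.
have zb : `|z| <= (2 * s)^-1 * (s ^+ 2 + z ^+ 2).
  rewrite mulrC ler_pdivlMr ?mulr_gt0// -(real_normK (num_real z)).
  have := sqr_ge0 (s - `|z|); rewrite sqrrB; move: (`|z|) => y; lra.
have pz : phi * `|z| <= c / (2 * s) * (s ^+ 2 + z ^+ 2) by rewrite -mulrA ler_pM.
have h1 : phi * z <= phi * `|z| by apply: ler_wpM2l => //; exact: ler_norm.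
have h2 : - (phi * z) <= phi * `|z|.
  by rewrite -mulrN -normrN; apply: ler_wpM2l => //; exact: ler_norm.
move: pz; set k := _ * (_ + _) => pz.
split; rewrite mulrDl mul1r mulrDr [phi * (z * mx)]mulrA; first rewrite lerD2l.
  by apply: ler_wpM2r; [exact: ltW|exact: le_trans pz].
rewrite -addrA lerDl -mulrDl; apply: mulr_ge0; [lra|exact: ltW].
Qed.

(** The chi-square bound controls the total variation distance between [g] and
    [m] through [2 |z| <= s + z ^ 2 / s]. *)
Lemma decorrelation_chi2 (Phi : S -> T -> R) c : 0 <= c ->
  measurable_fun setT (fun z : S * T => Phi z.1 z.2) ->
  (forall y x, 0 <= Phi y x <= c) ->
  `|\int[P]_om Phi (Y om) (X om) - \int[P]_om \int[M]_x Phi (Y om) x| <= c * s.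
Proof.
move=> c0 mPhi Phib; have Phi0 y x : 0 <= Phi y x by have /andP[] := Phib y x.
have Phic y x : Phi y x <= c by have /andP[] := Phib y x.
have bPhi : bmf (fun z : S * T => Phi z.1 z.2).
  by split=> //; exists c => z; rewrite ger0_norm.
have mYT : measurable_fun setT (fun z : Omega * T => (Y z.1, z.2)).
  by apply: measurable_fun_pair => //; exact: measurableT_comp.
have mPY : measurable_fun setT (fun z : Omega * T => Phi (Y z.1) z.2).
  exact: (measurableT_comp mPhi mYT).
have mgY : measurable_fun setT (fun z : Omega * T => g (Y z.1) z.2).
  exact: (measurableT_comp mg mYT).
have mm2 : measurable_fun setT (fun z : Omega * T => m z.2) by exact: measurableT_comp.
pose chi z := (g (Y z.1) z.2 / m z.2 - 1) ^+ 2 * m z.2.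
have chi0 z : 0 <= chi z by rewrite mulr_ge0// sqr_ge0.
have mchi : measurable_fun setT chi.
  apply: measurable_funM => //; apply: measurable_funX; apply: measurable_funB => //.
  by apply: measurable_funM => //; exact: measurable_inv.
(* Where [m] vanishes the chi-square integrand gives no information on [g]; the
   law of [X] does not charge that set. *)
pose pos x : R := \1_[set x | m x != 0] x.
have mpos : measurable_fun setT pos.
  apply: measurable_indic; rewrite (_ : [set x | _] = ~` (m @^-1` [set 0])).
    by apply: measurableC; rewrite -[X in measurable X]setTI; exact: mm.
  by apply/seteqP; split => x /=; [move/eqP|move=> /eqP].
have pos0 x : 0 <= pos x by rewrite /pos indicE.
have posP x : (m x = 0 /\ pos x = 0) \/ (0 < m x /\ pos x = 1).
  rewrite /pos indicE; have [mx|mx] := eqVneq (m x) 0.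
    by left; rewrite memNset//= mx eqxx.
  by right; rewrite lt_def mx m0 mem_set.
pose D := (P \x nu)%E.
(* The integrals of [a1] and [a4] are the two means of [Phi], and [e] bounds the
   pointwise difference of [a1] and [a4]. *)
pose a1 (z : Omega * T) : R := Phi (Y z.1) z.2 * m z.2.
pose a4 (z : Omega * T) : R := Phi (Y z.1) z.2 * pos z.2 * g (Y z.1) z.2.
pose e (z : Omega * T) : R := c * s / 2 * m z.2 + c / (2 * s) * chi z.
have ma1 : measurable_fun setT a1 by exact: measurable_funM.
have ma4 : measurable_fun setT a4.
  apply: measurable_funM => //; apply: measurable_funM => //.
  exact: measurableT_comp.
have me : measurable_fun setT e.
  by apply: measurable_funD; apply: measurable_funM.
have k1 : 0 <= c * s / 2 by rewrite divr_ge0// mulr_ge0// ltW.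
have k2 : 0 <= c / (2 * s) by rewrite divr_ge0// mulr_ge0// ltW.
have a10 z : 0 <= a1 z by exact: mulr_ge0.
have a40 z : 0 <= a4 z by apply: mulr_ge0 => //; exact: mulr_ge0.
have e0 z : 0 <= e z by apply: addr_ge0; exact: mulr_ge0.
have pw z : a4 z <= a1 z + e z /\ a1 z <= a4 z + e z.
  rewrite /a4 /a1 /e /chi; have [[mx px]|[mx px]] := posP z.2.
    by rewrite mx px !mulr0 !mul0r !addr0.
  by rewrite px mulr1; exact: chi2_split.
have I1 : (\int[D]_z (a1 z)%:E = (\int[P]_om \int[M]_x Phi (Y om) x)%:E)%E.
  rewrite fubini_tonelli1//; try solve [exact/measurable_EFinP|by move=> *; rewrite lee_fin].
  have bPY : bmf (fun z : Omega * T => Phi (Y z.1) z.2) by exact: (bmf_comp bPhi mYT).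
  rewrite -(bmf_EFin P (bmf_mean M bPY)); apply: eq_integral => om _.
  rewrite -(bmf_EFin M (bmf_sliceL om bPY)) /fubini_F [RHS](ge0_integral_density mm m0 ME)//.
  - by apply/measurable_EFinP; have [] := bmf_sliceL om bPY.
  - by move=> x; rewrite lee_fin.
have I2 : (\int[D]_z (m z.2)%:E = 1)%E.
  rewrite fubini_tonelli1//; try solve [exact/measurable_EFinP|by move=> *; rewrite lee_fin].
  rewrite /fubini_F (eq_integral (fun=> 1%E)) => [|om _]; last by rewrite -ME// probability_setT.
  by rewrite integral_cst//= probability_setT mule1.
have I3 : (\int[D]_z (chi z)%:E <= (s ^+ 2)%:E)%E.
  by rewrite fubini_tonelli1//; try solve [exact/measurable_EFinP|by move=> *; rewrite lee_fin].
have bX : bmf (fun om => Phi (Y om) (X om)).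
  exact: (bmf_comp bPhi measurable_joint).
have I4 : (\int[D]_z (a4 z)%:E = (\int[P]_om Phi (Y om) (X om))%:E)%E.
  rewrite fubini_tonelli1//; try solve [exact/measurable_EFinP|by move=> *; rewrite lee_fin].
  rewrite -(bmf_EFin P bX).
  transitivity (\int[P]_om (Phi (Y om) (X om) * pos (X om))%:E)%E.
    rewrite (mean_cond_density (Phi := fun z => (Phi z.1 z.2 * pos z.2)%:E))//.
      by apply/measurable_EFinP/measurable_funM => //; exact: measurableT_comp.
    by move=> z; rewrite lee_fin mulr_ge0.
  apply: ae_eq_integral => //.
  - apply/measurable_EFinP/measurable_funM; first by have [] := bX.
    exact: measurableT_comp.
  - by apply/measurable_EFinP; have [] := bX.
  have mN : measurable (m @^-1` [set 0]) by rewrite -[X in measurable X]setTI; exact: mm.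
  exists (X @^-1` (m @^-1` [set 0])); split.
  - by rewrite -[X in measurable X]setTI; exact: mX.
  - rewrite -[LHS]/(distribution P X _) XE// ME//.
    by apply: integral0_eq => x /= ->.
  - move=> om /= nh; apply: contrapT => /eqP mx; apply: nh => _.
    rewrite /pos indicE mem_set//= ?mulr1//; exact/eqP.
have Ie : (\int[D]_z (e z)%:E <= (c * s)%:E)%E.
  under eq_integral do rewrite EFinD.
  rewrite ge0_integralD//; first last.
  - by apply/measurable_EFinP/measurable_funM.
  - by move=> z _; rewrite lee_fin mulr_ge0.
  - by apply/measurable_EFinP/measurable_funM.
  - by move=> z _; rewrite lee_fin mulr_ge0.
  under eq_integral do rewrite EFinM.
  under [X in (_ + X)%E]eq_integral do rewrite EFinM.
  rewrite ge0_integralZl//; try solve [exact/measurable_EFinP|by move=> *; rewrite lee_fin].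
  rewrite ge0_integralZl//; try solve [exact/measurable_EFinP|by move=> *; rewrite lee_fin].
  rewrite I2 mule1; apply: (@le_trans _ _ ((c * s / 2)%:E + (c / (2 * s))%:E * (s ^+ 2)%:E)%E).
    by rewrite leeD2l// lee_wpmul2l// lee_fin.
  rewrite -EFinM -EFinD lee_fin le_eqVlt; apply/orP; left; apply/eqP; field.
  by rewrite gt_eqF.
have add (a a' : Omega * T -> R) : measurable_fun setT a -> measurable_fun setT a' ->
    (forall z, 0 <= a z) -> (forall z, 0 <= a' z) -> (forall z, a z <= a' z + e z) ->
    (\int[D]_z (a z)%:E <= \int[D]_z (a' z)%:E + (c * s)%:E)%E.
  move=> ma ma' aa aa' h.
  apply: (@le_trans _ _ (\int[D]_z ((a' z)%:E + (e z)%:E))%E).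
    apply: ge0_le_integral => //=.
    all: try solve [exact/measurable_EFinP|by move=> z _; rewrite -EFinD lee_fin ?addr_ge0
      |by apply: emeasurable_funD; exact/measurable_EFinP].
    by move=> z _; rewrite lee_fin.
  rewrite ge0_integralD//; first by rewrite leeD2l.
  all: try solve [exact/measurable_EFinP|by move=> z _; rewrite lee_fin].
have h1 := add _ _ ma4 ma1 a40 a10 (fun z => (pw z).1).
have h2 := add _ _ ma1 ma4 a10 a40 (fun z => (pw z).2).
move: h1 h2; rewrite I1 I4 -!EFinD !lee_fin => h1 h2.
by rewrite ler_norml; apply/andP; split; lra.
Qed.

End conditional_density.

(** * Kernels continuous on a compact parameter set *)

Section compact_parameters.
Context {R : realType} (Par : normedModType R).

Lemma open_borel (A : set (Borel Par)) : open (A : set Par) -> measurable A.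
Proof. exact: sub_sigma_algebra. Qed.

Lemma within_continuousP (K : set Par) (f : Par -> R) t e :
  {within K, continuous f} -> K t -> 0 < e ->
  exists2 d, 0 < d & forall s, K s -> ball t d s -> `|f s - f t| < e.
Proof.
move=> cf Kt e0.
have : \forall s \near (nbhs (t : subspace K)), `|f s - f t| < e.
  have := cf t; move=> /cvgrPdist_lt /(_ _ e0).
  by apply: filterS => s; rewrite distrC.
have E : within K (nbhs t) = nbhs (t : subspace K) := nbhs_subspace_in Kt.
rewrite -E => /nbhs_ballP[d d0 hd].
by exists d => // s Ks ds; exact: hd.
Qed.

Lemma compact_finite_net (K : set Par) e : compact K -> 0 < e ->
  exists2 s : seq Par, (forall x, x \in s -> K x) &
    forall t, K t -> exists2 x, x \in s & (ball x e)° t.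
Proof.
rewrite compact_cover => cK e0.
have [||D DK KD] := cK _ K (fun x => (ball x e)°).
- by move=> x _; exact: open_interior.
- by move=> t Kt; exists t => //; exact: nbhsx_ballx.
exists (finmap.enum_fset D) => [x /DK|t /KD[x xD xt]]; first by rewrite inE.
by exists x.
Qed.

Lemma compact_dense_seq (K : set Par) : compact K -> K !=set0 ->
  exists2 d : nat -> Par, (forall n, K (d n)) &
    forall t e, K t -> 0 < e -> exists n, (ball t e) (d n).
Proof.
move=> cK [t0 Kt0].
have /choice[s hs] : forall k : nat, exists s : seq Par, (forall x, x \in s -> K x) /\
    forall t, K t -> exists2 x, x \in s & (ball x k.+1%:R^-1)° t.
  move=> k; have [|s h1 h2] := compact_finite_net cK (e := k.+1%:R^-1).
    by rewrite invr_gt0.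
  by exists s.
exists (fun n => if unpickle n is Some (k, j) then nth t0 (s k) j else t0).
  move=> n; case: unpickle => [[k j]|//].
  have [js|sj] := ltnP j (size (s k)); last by rewrite nth_default.
  by apply: (hs k).1; exact: mem_nth.
move=> t e Kt e0.
have [k ke] : exists k : nat, k.+1%:R^-1 <= e.
  exact: exists_invS_le.
have [x xs xt] := (hs k).2 _ Kt.
exists (pickle (k, index x (s k))); rewrite pickleK nth_index//.
by apply: ball_sym; apply: le_ball ke _ _; exact: interior_subset.
Qed.

Variables (K : set Par) (d : nat -> Par).
Hypothesis dK : forall n, K (d n).
Hypothesis ddense : forall t e, K t -> 0 < e -> exists n, (ball t e) (d n).

Lemma within_dense_le (f g : Par -> R) t : {within K, continuous f} ->
  {within K, continuous g} -> K t -> (forall n, f (d n) <= g (d n)) -> f t <= g t.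
Proof.
move=> cf cg Kt fg; rewrite leNgt; apply/negP => gf.
have e0 : 0 < (f t - g t) / 2 by rewrite divr_gt0// subr_gt0.
have [d1 d10 h1] := within_continuousP cf Kt e0.
have [d2 d20 h2] := within_continuousP cg Kt e0.
have [||n dn] := @ddense t (Num.min d1 d2) => //; first by rewrite lt_min d10.
have l1 : Num.min d1 d2 <= d1 by rewrite ge_min lexx.
have l2 : Num.min d1 d2 <= d2 by rewrite ge_min lexx orbT.
have := h1 _ (dK n) (le_ball l1 dn); have := h2 _ (dK n) (le_ball l2 dn).
rewrite !ltr_norml => /andP[_ i1] /andP[i2 _]; have := fg n; lra.
Qed.

(** Caratheodory: such a kernel is the limit of suprema over the points of a
    countable dense set that are close to the parameter. *)
Lemma measurable_kernel dT (T : measurableType dT) (f : T -> Par -> R) :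
  (forall t, K t -> measurable_fun setT (f^~ t)) ->
  (forall x t, K t -> 0 <= f x t) ->
  (forall x, {within K, continuous (f x)}) ->
  measurable_fun (setT `*` (K : set (Borel Par)))
    (fun z : T * Borel Par => f z.1 z.2).
Proof.
move=> mf f0 cf.
pose U n j : set (Borel Par) := (ball (d j) n.+1%:R^-1)°.
pose h n j (z : T * Borel Par) : \bar R := (f z.1 (d j) * \1_(U n j) z.2)%:E.
have mh n j : measurable_fun setT (h n j).
  apply/measurable_EFinP/measurable_funM.
    exact: (measurableT_comp (mf _ (dK j))).
  have mU : measurable (U n j) by apply: open_borel; exact: open_interior.
  exact: (measurableT_comp (measurable_indic mU)).
apply/measurable_EFinP.
pose H z := einfs (fun n => esups (h n ^~ z) 0) 0.
have mH : measurable_fun setT H.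
  by apply: measurable_fun_einfs => n; exact: measurable_fun_esups.
apply: (eq_measurable_fun H); last exact: measurable_funTS.
move=> [x t]; rewrite inE => -[_ /= Kt]; rewrite /H /einfs /esups /=.
have U_d n j : U n j t -> ball t n.+1%:R^-1 (d j).
  by move=> Ut; apply: ball_sym; exact: interior_subset.
apply/eqP; rewrite eq_le; apply/andP; split.
  apply/lee_addgt0Pr => e e0.
  have [c c0 hc] := within_continuousP (cf x) Kt e0.
  have [n nc] : exists n : nat, n.+1%:R^-1 <= c.
    exact: exists_invS_le.
  apply: (@le_trans _ _ (ereal_sup (sdrop (h n ^~ (x, t)) 0))).
    by apply: ereal_inf_lbound; exists n.
  apply: ge_ereal_sup => _ [j _ <-]; rewrite /h /= indicE.
  case: (boolP (t \in U n j)) => [|_].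
    rewrite inE mulr1 => /U_d Ut; rewrite lee_fin.
    by have := hc _ (dK j) (le_ball nc Ut); rewrite ltr_norml => /andP[_]; lra.
  by rewrite mulr0 lee_fin addr_ge0 ?f0// ltW.
apply: le_ereal_inf_tmp => _ [n _ <-].
apply/lee_subgt0Pr => e e0.
have [c c0 hc] := within_continuousP (cf x) Kt e0.
have n0 : 0 < (n.+1%:R : R)^-1 by rewrite invr_gt0.
have n20 : 0 < (n.+1%:R : R)^-1 / 2 by rewrite divr_gt0.
have [||j dj] := @ddense t (Num.min c ((n.+1%:R)^-1 / 2)) => //.
  by rewrite lt_min c0.
have l1 : Num.min c ((n.+1%:R)^-1 / 2) <= c by rewrite ge_min lexx.
have l2 : Num.min c ((n.+1%:R)^-1 / 2) <= (n.+1%:R)^-1 / 2 by rewrite ge_min lexx orbT.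
have Ut : U n j t.
  apply/nbhs_ballP; exists (n.+1%:R^-1 / 2) => // s ts.
  by apply: ball_split ts; apply: ball_sym; exact: le_ball dj.
apply: (@le_trans _ _ (h n j (x, t))); last by apply: ereal_sup_ubound; exists j.
rewrite /h /= indicE mem_set// mulr1 -EFinB lee_fin.
have := hc _ (dK j) (le_ball l1 dj).
by rewrite ltr_norml => /andP[]; lra.
Qed.

End compact_parameters.

(** * Bounded likelihood ratios *)

Section likelihood_ratio.
Context {R : realType} d (T : measurableType d) (nu : {measure set T -> \bar R}).

Import HBNNSimple.

Lemma le_integral_nnsfun (h : {nnsfun T >-> R}) (f : T -> \bar R) :
  (forall x, (h x)%:E <= f x)%E -> (\int[nu]_x (h x)%:E <= \int[nu]_x f x)%E.
Proof.
move=> hf; have f0 x : (0 <= f x)%E by apply: le_trans (hf x); rewrite lee_fin.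
rewrite integralT_nnsfun ge0_integralTE//.
by apply: ereal_sup_ubound; exists h.
Qed.

Let ratio_ge (p1 p2 c : R) j : 0 <= p2 -> 0 < p1 -> 0 <= c -> c * p2 <= p1 ->
  ((c ^+ j)%:E <= (p1%:E / p2%:E) ^+ j)%E.
Proof.
move=> p20 p10 c0 cp; have h : (c%:E <= p1%:E / p2%:E)%E.
  rewrite inver; case: ifPn => [_|p2n]; first by rewrite gt0_muley ?leey// lte_fin.
  by rewrite lee_fin ler_pdivlMr// lt_def p2n.
elim: j => [|j IH]; first by rewrite expr0.
by rewrite exprS expeS EFinM; apply: lee_pmul; rewrite ?lee_fin ?exprn_ge0.
Qed.

(** The moment bound of every order forces an essential bound: on a set where
    the ratio exceeds [c > b] the moments grow at least like [c ^ j]. *)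
Lemma moment_ratio_bound (p1 p2 : T -> R) b :
  measurable_fun setT p1 -> measurable_fun setT p2 ->
  (forall x, 0 <= p1 x) -> (forall x, 0 <= p2 x) -> 0 < b ->
  (forall j, (0 < j)%N ->
    (\int[nu]_x (((p1 x)%:E / (p2 x)%:E) ^+ j * (p1 x)%:E) <= (b ^+ j)%:E)%E) ->
  nu [set x | b * p2 x < p1 x] = 0%E.
Proof.
move=> mp1 mp2 p10 p20 b0 mom.
pose c n : R := b + n.+1%:R^-1.
pose E n := [set x | n.+1%:R^-1 <= p1 x] `&` [set x | c n * p2 x <= p1 x].
have n0 n : 0 < n.+1%:R^-1 :> R by rewrite invr_gt0.
have cb n : b < c n by rewrite ltrDl.
have c0 n : 0 < c n by apply: lt_trans (cb n).
have mE n : measurable (E n).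
  apply: measurableI.
    rewrite -[X in measurable X]setTI; apply: measurable_fun_ler => //.
  rewrite -[X in measurable X]setTI; apply: measurable_fun_ler => //.
  exact: measurable_funM.
have E0 n : nu (E n) = 0%E.
  have key j : (0 < j)%N -> ((c n ^+ j * n.+1%:R^-1)%:E * nu (E n) <= (b ^+ j)%:E)%E.
    move=> j0; apply: le_trans (mom j j0).
    have k0 : 0 <= c n ^+ j * n.+1%:R^-1 by rewrite mulr_ge0 ?exprn_ge0 ?invr_ge0// ltW.
    pose h : {nnsfun T >-> R} := mul_nnsfun (cst_nnsfun T (NngNum k0)) (indic_nnsfun R (mE n)).
    have <- : (\int[nu]_x (h x)%:E = (c n ^+ j * n.+1%:R^-1)%:E * nu (E n))%E.
      rewrite -[nu (E n)](congr1 nu (setIT (E n))) -integral_indic// -ge0_integralZl//.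
      exact/measurable_EFinP/measurable_indic.
    apply: le_integral_nnsfun => x; rewrite /h /= /mindic indicE.
    have l0 : (0 <= (p1 x)%:E / (p2 x)%:E)%E.
      rewrite inver; case: ifPn => _; last by rewrite lee_fin divr_ge0.
      by apply: mule_ge0; rewrite ?lee_fin// leey.
    case: (boolP (x \in E n)) => [|_]; last first.
      by rewrite mulr0; apply: mule_ge0; rewrite ?expe_ge0 ?lee_fin.
    rewrite inE mulr1 EFinM => -[/= xn xc].
    apply: lee_pmul; rewrite ?lee_fin ?exprn_ge0 ?invr_ge0//; first exact: ltW.
    by apply: ratio_ge => //; [exact: lt_le_trans xn|exact: ltW].
  apply/eqP; rewrite eq_le measure_ge0 andbT; apply/lee_addgt0Pr => e e0.
  rewrite add0e.
  have q01 : 0 < b / c n < 1 by rewrite divr_gt0//= ltr_pdivrMr// mul1r.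
  have [j hj] := exists_expr_le q01 (mulr_gt0 e0 (n0 n)).
  have ej : (b / c n) ^+ j.+1 <= e * n.+1%:R^-1.
    apply: le_trans hj; rewrite exprS ler_piMl//; last by have /andP[_ /ltW] := q01.
    by rewrite exprn_ge0// divr_ge0// ltW.
  have := key j.+1 isT.
  have kp : 0 < c n ^+ j.+1 * n.+1%:R^-1 by rewrite mulr_gt0// exprn_gt0.
  rewrite -lee_pdivlMl// => h; apply: (le_trans h); rewrite -EFinM lee_fin.
  rewrite ler_pdivrMl//; move: ej; rewrite expr_div_n ler_pdivrMr ?exprn_gt0//.
  by move=> ej2; apply: (le_trans ej2); rewrite le_eqVlt; apply/orP; left; apply/eqP; ring.
apply/eqP; rewrite eq_le measure_ge0 andbT.
have sub : [set x | b * p2 x < p1 x] `<=` \bigcup_n E n.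
  move=> x /= bp.
  have p1x : 0 < p1 x by apply: le_lt_trans bp; rewrite mulr_ge0// ltW.
  have dd : 0 < p1 x - b * p2 x by rewrite subr_gt0.
  have m0 : 0 < Num.min (p1 x) ((p1 x - b * p2 x) / (p2 x + 1)).
    by rewrite lt_min p1x divr_gt0// ltr_wpDl.
  have [n ne] : exists n : nat, n.+1%:R^-1 <= Num.min (p1 x) ((p1 x - b * p2 x) / (p2 x + 1)).
    exact: exists_invS_le.
  exists n => //; move: ne; rewrite le_min => /andP[n1 n2]; split => //=.
  move: n2; rewrite ler_pdivlMr ?ltr_wpDl// /c.
  have := n0 n; move: (n.+1%:R^-1) (p1 x) (p2 x) => v y1 y2; lra.
apply: (@le_trans _ _ (nu (\bigcup_n E n))).
  apply: le_measure => //; rewrite ?inE.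
    rewrite -[X in measurable X]setTI; apply: measurable_fun_ltr => //.
    exact: measurable_funM.
  by apply: bigcup_measurable => n _; exact: mE.
have neg : nu.-negligible (\bigcup_n E n).
  by apply: negligible_bigcup => n; apply/negligibleP; [exact: mE|exact: E0].
by rewrite (measure_negligible _ neg)//; apply: bigcup_measurable => n _; exact: mE.
Qed.

End likelihood_ratio.

(** * Mixtures absolutely continuous with respect to the initial one *)

Section local_averages.
Context {R : realType} dT (T : measurableType dT) (M : probability T R).
Context (Par : normedModType R) (F G : probability (Borel Par) R).
Variables (Th : set (Borel Par)) (r : T -> Borel Par -> R) (b : R).
Hypothesis mr : measurable_fun setT (fun z : T * Borel Par => r z.1 z.2).
Hypothesis b1 : 1 <= b.
Hypothesis rb : forall x t, b^-1 <= r x t <= b.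
Hypothesis Th_compact : compact (Th : set Par).
Hypothesis mTh : measurable Th.
Hypothesis rc : forall x, {within (Th : set Par), continuous (r x : Par -> R)}.
Hypothesis F_Th : F (~` Th) = 0%E.
Hypothesis G_Th : G (~` Th) = 0%E.
Hypothesis F_supp : forall (U : set Par) t, open U -> U t -> Th t ->
  (0 < F (U : set (Borel Par)))%E.

Let b0 : 0 < b. Proof. exact: lt_le_trans ltr01 b1. Qed.

Lemma mean_indic_null (Q : probability (Borel Par) R) : Q (~` Th) = 0%E ->
  bmf (\1_(~` Th) : Borel Par -> R) /\ \int[Q]_t \1_(~` Th) t = 0.
Proof.
move=> Q0; split.
  split; first by apply: measurable_indic; exact: measurableC.
  by exists 1 => t; rewrite indicE; case: (_ \in _); rewrite ?normr1 ?normr0.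
rewrite /Rintegral integral_indic; [|by []|exact: measurableC].
by rewrite setIT/= Q0.
Qed.

Let dist1 (t s : Borel Par) : R := \int[M]_x `|r x t - r x s|.

Let bmf_diff t s : bmf (fun x => `|r x t - r x s|).
Proof. by apply: bmf_norm; apply: bmfB; exact: (bmf_rr mr b1 rb). Qed.

Let diff_le x t s : `|r x t - r x s| <= 2 * b.
Proof.
apply: (le_trans (ler_normB _ _)); rewrite mulrDl mul1r.
by apply: lerD; exact: (norm_r b1 rb).
Qed.

Let dist1_le t s : dist1 t s <= 2 * b.
Proof. by apply: mean_le_cst. Qed.

(** Dominated convergence, along sequences of parameters tending to [c]. *)
Lemma dist1_continuous c e : Th c -> 0 < e ->
  exists2 d, 0 < d & forall t, Th t -> ball (c : Par) d t -> dist1 t c <= e.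
Proof.
move=> Tc e0; apply: contrapT => H.
have /choice[t ht] : forall n : nat, exists t : Par,
    [/\ Th t, ball (c : Par) n.+1%:R^-1 t & e < dist1 t c].
  move=> n; apply: contrapT => hn; apply: H; exists n.+1%:R^-1; first by rewrite invr_gt0.
  by move=> t Tt ct; rewrite leNgt; apply/negP => et; apply: hn; exists t.
pose f n x := `|r x (t n) - r x c|.
have fcvg x : f n x @[n --> \oo] --> (0 : R).
  apply/cvgrPdist_le => a a0; have [d d0 hd] := within_continuousP (@rc x) Tc a0.
  have [N hN] : exists N : nat, N.+1%:R^-1 <= d.
    exact: exists_invS_le.
  exists N => // n /= Nn; rewrite sub0r normrN normr_id ltW//.
  have [Tn cn _] := ht n; apply: hd => //; apply: le_ball cn.
  by apply: le_trans hN; rewrite lef_pV2 ?posrE// ler_nat.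
have cv : (\int[M]_x (f n x)%:E)%E @[n --> \oo] --> (\int[M]_x (0%:E))%E.
  apply: (@dominated_cvg _ _ _ M setT measurableT (fun n x => (f n x)%:E)
    (fun=> 0%:E)%E (fun=> (2 * b)%:E)%E) => //.
  - by move=> n; apply/measurable_EFinP; have [] := bmf_diff (t n) c.
  - by move=> x _; apply/fine_cvgP; split; [exact: nearW|exact: fcvg].
  - apply/integrableP; split => //.
    rewrite (_ : (fun _ => _) = fun=> (`|2 * b|)%:E)//.
    by rewrite integral_cst//= probability_setT mule1 ltry.
  - by move=> n x _; rewrite lee_fin normr_id.
move: cv; rewrite integral0 => /fine_cvgP[_ /cvgrPdist_lt /(_ _ e0)[N _ /(_ N (leqnn N))]].
have [_ _] := ht N; rewrite /= sub0r normrN.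
rewrite -/(Rintegral M setT (f N)) ger0_norm; last exact: Rintegral_ge0.
by move=> h1 h2; have := lt_trans h1 h2; rewrite ltxx.
Qed.

Section kernel.
Variable U : Borel Par -> set (Borel Par).

(** A Markov kernel: in [t], the density of [F] conditioned on the first set
    [U c] of the list that contains [s]. *)
Fixpoint first_cell (cs : seq (Borel Par)) (s t : Borel Par) : R :=
  if cs is c :: cs' then
    \1_(U c) s * (\1_(U c) t / fine (F (U c))) + (1 - \1_(U c) s) * first_cell cs' s t
  else 1.

Hypothesis mU : forall c, measurable (U c).

Let bmf_U c : bmf (\1_(U c) : Borel Par -> R).
Proof.
split; first exact: measurable_indic.
by exists 1 => t; rewrite indicE; case: (_ \in _); rewrite ?normr1 ?normr0.
Qed.

Lemma bmf_first_cell cs : bmf (fun z : Borel Par * Borel Par => first_cell cs z.1 z.2).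
Proof.
elim: cs => [|c cs IH] /=; first exact: bmf_cst.
have b1' : bmf (fun z : Borel Par * Borel Par => \1_(U c) z.1 : R).
  exact: (bmf_comp (bmf_U c)).
apply: bmfD; apply: bmfM => //.
  by apply: bmfM; [exact: (bmf_comp (bmf_U c))|exact: bmf_cst].
by apply: bmfB => //; exact: bmf_cst.
Qed.

Lemma first_cell_density cs s : (forall c, c \in cs -> 0 < fine (F (U c))) ->
  mix_density F (first_cell cs s).
Proof.
move=> cs0; have bk := bmf_sliceL s (bmf_first_cell cs); split=> //.
  elim: cs {bk} cs0 => [|c cs IH] cs0 t //=.
  have {}IH := IH (fun x xc => cs0 x (mem_behead (s := c :: cs) xc)) t.
  have c0 := cs0 c (mem_head _ _).
  rewrite !indicE; case: (s \in _); case: (t \in _) => /=.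
  - by rewrite mul1r mul1r subrr mul0r addr0 invr_ge0 ltW.
  - by rewrite mul1r mul0r subrr mul0r addr0.
  - by rewrite mul0r add0r subr0 mul1r.
  - by rewrite mul0r add0r subr0 mul1r.
elim: cs {bk} cs0 => [|c cs IH] cs0 /=; first by rewrite mean_cst.
have {}IH := IH (fun x xc => cs0 x (mem_behead (s := c :: cs) xc)).
have c0 := cs0 c (mem_head _ _).
have bc := bmf_sliceL s (bmf_first_cell cs).
have bu : bmf (fun t => \1_(U c) t / fine (F (U c))).
  by apply: bmfM => //; exact: bmf_cst.
rewrite meanD; [|exact: bmfZ|exact: bmfZ].
rewrite !meanZ// IH mulr1.
have -> : \int[F]_t (\1_(U c) t / fine (F (U c))) = 1.
  transitivity (\int[F]_t ((fine (F (U c)))^-1 * \1_(U c) t)).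
    by apply: eq_Rintegral => t _; rewrite mulrC.
  by rewrite meanZ// /Rintegral integral_indic// setIT/= mulVf// gt_eqF.
by rewrite mulr1 addrC subrK.
Qed.

Lemma first_cell_near cs s t : (exists2 c, c \in cs & U c s) ->
  first_cell cs s t != 0 -> exists c, [/\ c \in cs, U c s & U c t].
Proof.
elim: cs => [|c cs IH] /=; first by case.
rewrite !indicE; case: (boolP (s \in U c)) => [|sc].
  rewrite inE => sc _; rewrite subrr mul0r addr0 mul1r.
  case: (boolP (t \in U c)) => [|_]; last by rewrite mul0r eqxx.
  by rewrite inE => tc _; exists c; rewrite mem_head.
rewrite mul0r add0r subr0 mul1r => -[c' cc' sc'] /IH [|x [xc xs xt]].
  exists c' => //; move: cc'; rewrite inE => /predU1P[e|//].
  by move: sc; rewrite -e mem_set.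
by exists x; rewrite inE xc orbT.
Qed.

End kernel.

(** Replacing a point [s] by the average over a neighbourhood of [s] moves the
    kernel little, uniformly in [s], in the [L1] norm of the observations. *)
Lemma averaging_kernel e : 0 < e -> exists k : Borel Par -> Borel Par -> R,
  [/\ bmf (fun z : Borel Par * Borel Par => k z.1 z.2),
      forall s, mix_density F (k s)
    & forall s, Th s -> \int[M]_x `|predictive F r (k s) x - r x s| <= 2 * e].
Proof.
move=> e0.
have /choice[d hd] : forall c : Par, exists d : R, Th c -> 0 < d /\
    forall t, Th t -> ball c d t -> dist1 t c <= e.
  move=> c; have [Tc|nTc] := pselect (Th c); last by exists 0.
  by have [d d0 h] := dist1_continuous Tc e0; exists d.
pose U (c : Borel Par) : set (Borel Par) := (ball (c : Par) (d c))°.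
have [D DTh DU] : finite_subset_cover (Th : set Par) (U : Par -> set Par) Th.
  move: Th_compact; rewrite compact_cover; apply.
  - by move=> c _; exact: open_interior.
  - move=> t Tt; exists t => //; apply: nbhsx_ballx; exact: (hd t Tt).1.
have mU c : measurable (U c) by apply: open_borel; exact: open_interior.
pose cs : seq (Borel Par) := finmap.enum_fset D.
have csTh c : c \in cs -> Th c by move=> /DTh; rewrite inE.
have cs0 c : c \in cs -> 0 < fine (F (U c)).
  move=> /csTh Tc; apply: fine_gt0; apply/andP; split.
    apply: (F_supp (t := c)) => //; first exact: open_interior.
    apply: nbhsx_ballx; exact: (hd c Tc).1.
  by apply: (le_lt_trans (probability_le1 _ _)) => //; rewrite ltry.
exists (first_cell U cs); split.
- exact: bmf_first_cell.
- by move=> s; exact: first_cell_density.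
move=> s Ts; set k := first_cell U cs.
have dk : mix_density F (k s) by exact: first_cell_density.
have [bk k0 k1] := dk; have [_ [C kC]] := bk.
have bks : bmf (fun x => predictive F r (k s) x) by exact: (bmf_predictive mr b1 rb).
have bsr : bmf (r^~ s) by exact: (bmf_rr mr b1 rb).
have bD : bmf (fun z : T * Borel Par => `|r z.1 z.2 - r z.1 s| * k s z.2).
  apply: bmfM; last exact: (bmf_comp bk).
  apply: bmf_norm; apply: bmfB; first exact: (bmf_r mr b1 rb).
  exact: (bmf_comp bsr).
apply: (@le_trans _ _ (\int[M]_x \int[F]_t (`|r x t - r x s| * k s t))).
  apply: le_mean; [by apply: bmf_norm; exact: bmfB|exact: (bmf_mean F bD)|].
  move=> x; have brk := bmf_ru mr b1 rb x bk.
  have -> : predictive F r (k s) x - r x s = \int[F]_t ((r x t - r x s) * k s t).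
    transitivity (\int[F]_t (r x t * k s t - r x s * k s t)).
      by rewrite meanB//; [rewrite meanZ// k1 mulr1|exact: bmfZ].
    by apply: eq_Rintegral => t _; rewrite mulrBl.
  have bx : bmf (fun t => (r x t - r x s) * k s t).
    apply: bmfM => //; apply: bmfB; last exact: bmf_cst.
    exact: (bmf_rl mr b1 rb).
  apply: (le_trans (norm_mean _ bx)); apply: le_mean.
  - exact: bmf_norm.
  - exact: (bmf_sliceL x bD).
  - by move=> t; rewrite normrM (ger0_norm (k0 t)).
rewrite (mean_swap M F bD) /=.
have [bn n0] := mean_indic_null F_Th.
have C0 : 0 <= C by apply: le_trans (kC s); exact: normr_ge0.
apply: (@le_trans _ _ (\int[F]_t (2 * e * k s t + 2 * b * C * \1_(~` Th) t))); last first.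
  by rewrite meanD; [rewrite !meanZ// n0 k1 mulr1 mulr0 addr0|exact: bmfZ|exact: bmfZ].
apply: le_mean.
- apply: (bmf_mean M (g := fun z : Borel Par * T => `|r z.2 z.1 - r z.2 s| * k s z.1)).
  apply: (bmf_comp bD (h := fun z : Borel Par * T => (z.2, z.1))).
  exact: measurable_fun_pair.
- by apply: bmfD; exact: bmfZ.
move=> t.
have -> : \int[M]_x (`|r x t - r x s| * k s t) = k s t * dist1 t s.
  by rewrite -meanZ//; apply: eq_Rintegral => x _; rewrite mulrC.
rewrite indicE; case: (boolP (t \in ~` Th)) => [_|].
  rewrite mulr1; apply: ler_wpDl; first by rewrite !mulr_ge0// ltW.
  rewrite mulrC; apply: ler_pM => //; first exact: Rintegral_ge0.
  by apply: le_trans (kC t); exact: ler_norm.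
rewrite notin_setE /= => /contrapT Tt; rewrite mulr0 addr0 mulrC.
have [->|kn] := eqVneq (k s t) 0; first by rewrite !mulr0.
apply: ler_wpM2r => //.
have [|c [cc sc tc]] := first_cell_near (U := U) (cs := cs) (s := s) (t := t) _ kn.
  by have [c cD sc] := DU s Ts; exists c.
have Tc := csTh c cc; have [_ hc] := hd c Tc.
have h1 := hc t Tt (interior_subset tc); have h2 := hc s Ts (interior_subset sc).
apply: (@le_trans _ _ (dist1 t c + dist1 s c)); last by lra.
rewrite /dist1 -meanD//; apply: le_mean => //; first exact: bmfD.
move=> x; rewrite (_ : r x t - r x s = (r x t - r x c) - (r x s - r x c)); last by ring.
exact: ler_normB.
Qed.

(** Every mixing distribution carried by the support of [F] is nearly as good
    as one with a bounded density with respect to [F]. *)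
Lemma bounded_density_approx e : 0 < e -> exists2 u, mix_density F u &
  log_loss M F r u <= - (\int[M]_x ln (\int[G]_t r x t)) + e.
Proof.
move=> e0; pose a := e / (2 * b).
have a0 : 0 < a by rewrite divr_gt0// mulr_gt0.
have [k [bk dk hk]] := averaging_kernel a0.
have bk' : bmf (fun z : Borel Par * Borel Par => k z.2 z.1).
  apply: (bmf_comp bk (h := fun z : Borel Par * Borel Par => (z.2, z.1))).
  exact: measurable_fun_pair.
pose u t := \int[G]_s k s t.
have bu : bmf u by exact: (bmf_mean G bk').
have du : mix_density F u.
  split=> //; first by move=> t; apply: Rintegral_ge0 => s _; have [_ k0 _] := dk s.
  rewrite (mean_swap F G bk') /= -[RHS](mean_cst G).
  by apply: eq_Rintegral => s _; have [_ _] := dk s.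
exists u => //.
have bP : bmf (fun z : T * Borel Par => predictive F r (k z.2) z.1).
  apply: (bmf_comp (bmf_param_predictive F mr b1 rb (U := k) bk)
    (h := fun z : T * Borel Par => (z.2, z.1))).
  exact: measurable_fun_pair.
have bPs x : bmf (fun s => predictive F r (k s) x) by exact: (bmf_sliceL x bP).
have predE x : predictive F r u x = \int[G]_s predictive F r (k s) x.
  have bx : bmf (fun z : Borel Par * Borel Par => r x z.1 * k z.2 z.1).
    by apply: bmfM => //; exact: (bmf_comp (bmf_rl mr b1 rb x)).
  rewrite -(mean_swap F G bx) /=; apply: eq_Rintegral => t _.
  by rewrite meanZ//; exact: (bmf_sliceL t bk').
have brG : bmf (fun x => \int[G]_t r x t) by exact: (bmf_mean G (bmf_r mr b1 rb)).
have brx x : bmf (r x) by exact: (bmf_rl mr b1 rb).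
have bi0 : 0 < b^-1 by rewrite invr_gt0.
have Gb x : b^-1 <= \int[G]_t r x t.
  by apply: mean_ge_cst => // t; have /andP[] := rb x t.
have blG : bmf (fun x => ln (\int[G]_t r x t)) by exact: (bmf_ln bi0).
have blu := bmf_ln_predictive mr b1 rb du.
rewrite /log_loss -lerBlDl opprK addrC -meanB//.
have bdiff : bmf (fun x => `|predictive F r u x - \int[G]_t r x t|).
  by apply: bmf_norm; apply: bmfB => //; exact: (bmf_predictive mr b1 rb).
apply: (@le_trans _ _ (\int[M]_x (b * `|predictive F r u x - \int[G]_t r x t|))).
  apply: le_mean; [exact: bmfB|exact: bmfZ|].
  move=> x; have /andP[h _] := predictive_bounds mr b1 rb x du.
  apply: (le_trans (ler_norm _)); rewrite distrC -[X in _ <= X * _]invrK.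
  exact: ln_lipschitz.
rewrite meanZ// (_ : e = b * (2 * a)); last by rewrite /a; field; rewrite gt_eqF.
apply: ler_wpM2l; first exact: ltW.
have bs : bmf (fun z : T * Borel Par => `|predictive F r (k z.2) z.1 - r z.1 z.2|).
  by apply: bmf_norm; apply: bmfB => //; exact: (bmf_r mr b1 rb).
apply: (@le_trans _ _ (\int[M]_x \int[G]_s `|predictive F r (k s) x - r x s|)).
  apply: le_mean => //; first exact: (bmf_mean G bs).
  move=> x; rewrite predE -meanB//; apply: norm_mean; exact: bmfB.
rewrite (mean_swap M G bs) /=.
have [bn n0] := mean_indic_null G_Th.
apply: (@le_trans _ _ (\int[G]_s (2 * a + 2 * b * \1_(~` Th) s))); last first.
  by rewrite meanD; [rewrite mean_cst meanZ// n0 mulr0 addr0|exact: bmf_cst|exact: bmfZ].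
apply: le_mean.
- apply: (bmf_mean M (g := fun z : Borel Par * T => `|predictive F r (k z.1) z.2 - r z.2 z.1|)).
  apply: (bmf_comp bs (h := fun z : Borel Par * T => (z.2, z.1))).
  exact: measurable_fun_pair.
- by apply: bmfD; [exact: bmf_cst|exact: bmfZ].
move=> s; rewrite indicE; case: (boolP (s \in ~` Th)) => [_|].
  rewrite mulr1; apply: ler_wpDl; first by rewrite mulr_ge0// ltW.
  apply: mean_le_cst => [|x].
    by apply: bmf_norm; apply: bmfB; [exact: (bmf_predictive mr b1 rb)|exact: (bmf_rr mr b1 rb)].
  apply: (le_trans (ler_normB _ _)); rewrite mulrDl mul1r; apply: lerD.
    have /andP[h1 h2] := predictive_bounds mr b1 rb x (dk s).
    by rewrite ger0_norm//; apply: le_trans h1; exact: ltW.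
  exact: (norm_r b1 rb).
by rewrite notin_setE /= => /contrapT Ts; rewrite mulr0 addr0; exact: hk.
Qed.

End local_averages.

(** * Kullback-Leibler divergence under a bounded change of the second density *)

(** A difference of extended nonnegative numbers is finite only if both are. *)
Lemma fin_num_integrable {R : realType} d (T : measurableType d)
    (nu : {measure set T -> \bar R}) (g : T -> \bar R) :
  measurable_fun setT g -> (\int[nu]_x g x)%E \is a fin_num ->
  nu.-integrable setT g.
Proof.
move=> mg; rewrite integralE fin_numB => /andP[fp fn].
apply/integrableP; split=> //.
have -> : (fun x => `|g x|%E) = (g^\+ \+ g^\-)%E by exact: fune_abse.
rewrite ge0_integralD//; [|exact: measurable_funepos|exact: measurable_funeneg].
by rewrite lte_add_pinfty// -ge0_fin_numE ?fp ?fn//; exact: integral_ge0.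
Qed.

Section mean_density.
Context {R : realType} d (T : measurableType d) (nu : {measure set T -> \bar R}).
Variables (M : probability T R) (m : T -> R).
Hypothesis mm : measurable_fun setT m.
Hypothesis m0 : forall x, 0 <= m x.
Hypothesis ME : forall B, measurable B -> M B = (\int[nu]_(x in B) (m x)%:E)%E.

Lemma bmf_density_integral (g : T -> R) : bmf g ->
  nu.-integrable setT (fun x => (m x * g x)%:E) /\
  (\int[nu]_x (m x * g x)%:E)%E = (\int[M]_x g x)%:E.
Proof.
move=> bg; have [mg [C gC]] := bg.
have C0 : 0 <= C by apply: le_trans (gC point).
have pos (h : T -> R) : bmf h -> (forall x, 0 <= h x) ->
    nu.-integrable setT (fun x => (m x * h x)%:E) /\
    (\int[nu]_x (m x * h x)%:E)%E = (\int[M]_x h x)%:E.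
  move=> bh h0; have [mh _] := bh.
  have E : (\int[nu]_x (m x * h x)%:E)%E = (\int[M]_x h x)%:E.
    rewrite -bmf_EFin// (ge0_integral_density mm m0 ME).
    - by apply: eq_integral => x _; rewrite -EFinM mulrC.
    - exact/measurable_EFinP.
    - by move=> x; rewrite lee_fin.
  split=> //; apply: fin_num_integrable; last by rewrite E.
  by apply/measurable_EFinP; exact: measurable_funM.
have bgC : bmf (fun x => g x + C) by apply: bmfD => //; exact: bmf_cst.
have [|i1 e1] := pos _ bgC.
  by move=> x; rewrite -lerBlDr sub0r; have /ler_normlP[h _] := gC x; rewrite lerNl.
have [//|i2 e2] := pos _ (bmf_cst T C).
have E : (fun x => (m x * g x)%:E) =
    ((fun x => (m x * (g x + C))%:E) \- (fun x => (m x * C)%:E))%E.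
  by apply/funext => x; rewrite /= -EFinB; congr (_%:E); ring.
rewrite E; split; first exact: integrableB.
rewrite integralB// e1 e2 -EFinB -meanB//; last exact: bmf_cst.
by congr (_%:E); apply: eq_Rintegral => x _; rewrite addrK.
Qed.

(** The quotient and the logarithm of extended reals are resolved by cases into
    real functions. *)
Lemma measurable_KL_integrand (h : T -> R) : measurable_fun setT h ->
  (forall x, 0 <= h x) ->
  measurable_fun setT (fun x => ((m x)%:E * lne ((m x)%:E / (h x)%:E))%E).
Proof.
move=> mh h0.
rewrite (_ : (fun _ => _) = fun x => if m x == 0 then 0%E else
    if h x == 0 then +oo%E else (m x * ln (m x / h x))%:E); last first.
  apply/funext => x; case: ifPn => [/eqP ->|mx]; first by rewrite mul0e.
  have mx0 : 0 < m x by rewrite lt_neqAle eq_sym mx m0.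
  case: ifPn => [/eqP ->|hx]; first by rewrite inve0 gt0_muley ?lte_fin// gt0_muley ?lte_fin.
  have hx0 : 0 < h x by rewrite lt_neqAle eq_sym hx h0.
  by rewrite inver (negbTE hx) -EFinM lne_EFin ?divr_gt0// EFinM.
apply: measurable_fun_ifT => //; first exact: measurable_fun_eqr.
apply: measurable_fun_ifT => //; first exact: measurable_fun_eqr.
apply/measurable_EFinP; apply: measurable_funM => //.
apply: measurableT_comp => //; apply: measurable_funM => //.
exact: measurable_inv.
Qed.

(** The two integrands differ by [m * ln rho], and [ln rho] is bounded. *)
Lemma KL_bounded_factor (h h' rho : T -> R) (N : set T) :
  measurable_fun setT h -> (forall x, 0 <= h x) ->
  measurable_fun setT h' -> (forall x, 0 <= h' x) ->
  bmf (fun x => ln (rho x)) -> nu.-negligible N ->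
  (forall x, ~ N x -> m x != 0 ->
     [/\ 0 < h x, 0 < rho x & h' x = h x * rho x]) ->
  KL nu m h \is a fin_num ->
  KL nu m h' = (KL nu m h - (\int[M]_x ln (rho x))%:E)%E.
Proof.
move=> mh h0 mh' h'0 bl nN hN fin.
have [il el] := bmf_density_integral bl.
have iA := fin_num_integrable (measurable_KL_integrand mh h0) fin.
rewrite -el /KL -integralB//.
apply: ae_eq_integral => //; first exact: measurable_KL_integrand.
  by have /integrableP[] := integrableB measurableT iA il.
apply: (negligibleS _ nN) => x /= /not_implyP[_ ne].
apply: contrapT => nx; apply: ne.
have [->|mx] := eqVneq (m x) 0; first by rewrite !mul0e mul0r sube0.
have [hx rx ->] := hN x nx mx.
have mx0 : 0 < m x by rewrite lt_neqAle eq_sym mx m0.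
rewrite !inver !gt_eqF ?mulr_gt0// -!EFinM !lne_EFin ?divr_gt0 ?mulr_gt0// -!EFinM -EFinB.
by congr (_%:E); rewrite !ln_div ?posrE ?mulr_gt0// lnM ?posrE//; ring.
Qed.

End mean_density.

(** * The normalised kernel *)

Section normalised_kernel.
Context {R : realType} (chi : ptopologicalType) (Par : normedModType R).
Variables (nu : {sigma_finite_measure set (Borel chi) -> \bar R}).
Variables (mu : {sigma_finite_measure set (Borel Par) -> \bar R}).
Variables (p : chi -> Par -> R) (K Theta0 : set Par) (d : nat -> Par) (c : R).
Hypothesis dK : forall n, K (d n).
Hypothesis ddense : forall t e, K t -> 0 < e -> exists n, (ball t e) (d n).
Hypothesis mK : measurable (K : set (Borel Par)).
Hypothesis mTheta0 : measurable (Theta0 : set (Borel Par)).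
Hypothesis Theta0K : Theta0 `<=` K.
Hypothesis pm : forall t, K t -> measurable_fun setT (p^~ t : Borel chi -> R).
Hypothesis p0 : forall x t, K t -> 0 <= p x t.
Hypothesis pc : forall x, {within K, continuous (p x)}.
Hypothesis c0 : 0 < c.
Hypothesis ratio_null : forall s t, K s -> K t ->
  nu ([set x | c * p x t < p x s] : set (Borel chi)) = 0%E.

Definition unbounded_ratio : set (Borel chi) :=
  \bigcup_i \bigcup_j [set x | c * p x (d j) < p x (d i)].

Lemma measurable_unbounded_ratio : measurable unbounded_ratio.
Proof.
apply: bigcup_measurable => i _; apply: bigcup_measurable => j _.
rewrite -[X in measurable X]setTI; apply: measurable_fun_ltr => //; last exact: pm.
by apply: measurable_funM => //; exact: pm.
Qed.

Lemma unbounded_ratio_null : nu unbounded_ratio = 0%E.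
Proof.
apply: measure_negligible; first exact: measurable_unbounded_ratio.
apply: negligible_bigcup => i; apply: negligible_bigcup => j.
apply/negligibleP; last exact: ratio_null.
rewrite -[X in measurable X]setTI; apply: measurable_fun_ltr => //; last exact: pm.
by apply: measurable_funM => //; exact: pm.
Qed.

(** The inequality holds along the dense sequence in both parameters, and both
    sides are continuous. *)
Lemma ratio_le x s t : ~ unbounded_ratio x -> K s -> K t -> p x s <= c * p x t.
Proof.
move=> nx Ks Kt.
have cc (a : R) : {within K, continuous (fun=> a : R)} by move=> z; exact: cvg_cst.
apply: (within_dense_le dK ddense (f := fun=> p x s) (g := fun t => c * p x t)) => //.
  by move=> z; apply: cvgM; [exact: cvg_cst|exact: pc].
move=> j; apply: (within_dense_le dK ddense (f := p x) (g := fun=> c * p x (d j))) => // i.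
by rewrite leNgt; apply/negP => h; apply: nx; exists i => //; exists j.
Qed.

(** The observations at which the values of the kernel on [K] are all positive
    and comparable; almost every observation is one ([bad_null]). *)
Definition good : set (Borel chi) := [set x | ~ unbounded_ratio x /\ 0 < p x (d 0)].

Lemma measurable_good : measurable good.
Proof.
rewrite (_ : good = ~` unbounded_ratio `&` [set x | 0 < p x (d 0)]); last by [].
apply: measurableI; first by apply: measurableC; exact: measurable_unbounded_ratio.
rewrite -[X in measurable X]setTI; apply: measurable_fun_ltr => //; exact: pm.
Qed.

(** The kernel divided by its value at one parameter, extended by [1] off the
    observations and the parameters that matter. Predictive recursion and
    differences of Kullback-Leibler divergences only see the ratios. *)
Definition kratio (x : Borel chi) (t : Borel Par) : R :=
  if (x \in good) && (t \in (Theta0 : set (Borel Par))) then p x t / p x (d 0) else 1.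

Lemma kratio_bounds x t : (c + 1)^-1 <= kratio x t <= c + 1.
Proof.
have c1 : 1 <= c + 1 by move: c0; move: (c) => y; lra.
have c10 : 0 < c + 1 by exact: lt_le_trans ltr01 c1.
rewrite /kratio; case: ifPn => [/andP[]|_]; last by rewrite invf_le1// c1.
rewrite !inE => -[nx pd] Tt; have Kt := Theta0K Tt.
have h1 := ratio_le nx Kt (dK 0); have h2 := ratio_le nx (dK 0) Kt.
have pt : 0 < p x t.
  by move: pd; apply: contraTT; rewrite -!leNgt => pt; apply: le_trans h2 _; rewrite mulr_ge0_le0// ltW.
apply/andP; split.
  rewrite ler_pdivlMr// ler_pdivrMl// mulrDl; apply: le_trans h2 _.
  by rewrite mul1r lerDl ltW.
rewrite ler_pdivrMr// mulrDl; apply: le_trans h1 _.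
by rewrite mul1r lerDl ltW.
Qed.

Lemma measurable_pK : measurable_fun setT
  (fun z : Borel chi * Borel Par => p z.1 z.2 * \1_(K : set (Borel Par)) z.2).
Proof.
have mp : measurable_fun (setT `*` (K : set (Borel Par)))
    (fun z : Borel chi * Borel Par => p z.1 z.2).
  exact: (measurable_kernel dK ddense (T := Borel chi)).
have mX : measurable (setT `*` (K : set (Borel Par)) : set (Borel chi * Borel Par)).
  exact: measurableX.
have := (measurable_restrictT _ mX).1 mp.
congr measurable_fun; apply/funext => z; rewrite patchE indicE.
have -> : (z \in setT `*` (K : set (Borel Par))) = (z.2 \in (K : set (Borel Par))).
  by apply/idP/idP; rewrite !inE; [case|].
by case: ifPn => _; rewrite ?mulr1 ?mulr0.
Qed.

Let measurable_fun_mem d0 (T : measurableType d0) (A : set T) :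
  measurable A -> measurable_fun setT (fun x => x \in A).
Proof.
move=> mA; apply: (measurable_fun_bool true); rewrite setTI.
by rewrite (_ : _ @^-1` _ = A)//; apply/seteqP; split => z /= h; [exact: set_mem|exact: mem_set].
Qed.

Lemma measurable_kratio :
  measurable_fun setT (fun z : Borel chi * Borel Par => kratio z.1 z.2).
Proof.
rewrite (_ : (fun z : Borel chi * Borel Par => _) = fun z : Borel chi * Borel Par =>
    if (z.1 \in good) && (z.2 \in (Theta0 : set (Borel Par)))
    then p z.1 z.2 * \1_(K : set (Borel Par)) z.2 * (p z.1 (d 0))^-1 else 1); last first.
  apply/funext => z; rewrite /kratio; case: ifPn => // /andP[_].
  by rewrite inE => /Theta0K Kz; rewrite indicE mem_set// mulr1.
apply: measurable_fun_ifT.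
- apply: measurable_and.
    apply: (measurableT_comp (f := fun x : Borel chi => x \in good)) => //.
    by apply: measurable_fun_mem; exact: measurable_good.
  apply: (measurableT_comp (f := fun t : Borel Par => t \in (Theta0 : set (Borel Par)))) => //.
  exact: measurable_fun_mem.
- have mi : measurable_fun setT (fun z : Borel chi * Borel Par => (p z.1 (d 0))^-1).
    apply: (@measurableT_comp _ _ _ _ _ _ (fun x : Borel chi => (p x (d 0))^-1)).
      by apply: measurable_inv; exact: pm.
    exact: measurable_fst.
  exact: (measurable_funM measurable_pK mi).
- exact: measurable_cst.
Qed.

Lemma kratio_continuous x : {within Theta0, continuous (kratio x)}.
Proof.
have [gx|bx] := pselect (good x); last first.
  rewrite (_ : kratio x = fun=> 1); first by move=> z; exact: cvg_cst.
  by apply/funext => t; rewrite /kratio memNset.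
apply: (subspace_eq_continuous (f := fun t => p x t / p x (d 0))).
  by move=> t /set_mem Tt; rewrite /kratio (mem_set gx) /= /from_subspace
    (mem_set (A := (Theta0 : set (Borel Par))) Tt).
apply: (continuous_subspaceW Theta0K) => z.
by apply: cvgM; [exact: pc|exact: cvg_cst].
Qed.

(** ** Mixtures seen through the normalised kernel *)

Lemma mixture_setT A g : (forall t, ~ A t -> g t = 0) ->
  mixture mu p A g = mixture mu p setT g.
Proof.
move=> gA; apply/funext => x; rewrite /mixture /Rintegral integral_mkcond.
congr fine; apply: eq_integral => t _; rewrite patchE; case: ifPn => // nt.
by rewrite gA ?mulr0//; move: nt; rewrite notin_setE.
Qed.

Lemma mixture_ge0 g x : is_density mu g -> (forall t, ~ K t -> g t = 0) ->
  0 <= mixture mu p setT g x.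
Proof.
move=> [_ g0 _] gK; apply: Rintegral_ge0 => t _.
by have [/(p0 x)|/gK ->] := pselect (K t); [move=> h; exact: mulr_ge0|rewrite mulr0].
Qed.

Lemma measurable_mixture g : is_density mu g -> (forall t, ~ K t -> g t = 0) ->
  measurable_fun setT (mixture mu p setT g : Borel chi -> R).
Proof.
move=> [mg g0 _] gK.
pose h := fun z : Borel chi * Borel Par =>
  (p z.1 z.2 * \1_(K : set (Borel Par)) z.2 * g z.2)%:E.
have E x t : (p x t * g t)%:E = h (x, t).
  rewrite /h /= indicE; have [Kt|nK] := pselect (K t).
    by rewrite (mem_set (A := (K : set (Borel Par))) Kt) mulr1.
  by rewrite gK ?mulr0.
rewrite (_ : mixture mu p setT g = fun x : Borel chi => fine (\int[mu]_t h (x, t))%E); last first.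
  by apply/funext => x; congr fine; apply: eq_integral => t _; exact: E.
apply: (measurableT_comp (@fine_measurable R setT measurableT)).
apply: measurable_fun_fubini_tonelli_F => //.
  apply/measurable_EFinP; apply: measurable_funM; first exact: measurable_pK.
  by apply: (measurableT_comp mg).
move=> [x t]; rewrite -E lee_fin.
by have [/(p0 x)|/gK ->] := pselect (K t); [move=> ?; exact: mulr_ge0|rewrite mulr0].
Qed.

Let c1 : 1 <= c + 1. Proof. by rewrite lerDr ltW. Qed.

Lemma mixture_good g (dg : is_density mu g) (u : Borel Par -> R) x :
  (forall t, ~ Theta0 t -> g t = 0) -> bmf u -> (forall t, 0 <= u t) -> good x ->
  mixture mu p setT (fun t : Par => g t * u t) x =
  p x (d 0) * predictive (density_probability dg) kratio u x.
Proof.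
move=> gT bu u0 gx; have [_ g0 _] := dg.
have bk : bmf (kratio x) by exact: (bmf_rl measurable_kratio c1 kratio_bounds).
have k0 t : 0 <= kratio x t.
  have /andP[h _] := kratio_bounds x t; apply: le_trans h.
  by rewrite invr_ge0; exact: le_trans c1.
have bku := bmfM bk bu.
have mku : measurable_fun setT (fun t => (kratio x t * u t)%:E).
  by apply/measurable_EFinP; case: bku.
have [_ pd] := gx.
rewrite /predictive /Rintegral ge0_integral_density_probability//; last first.
  by move=> t; rewrite lee_fin mulr_ge0.
have mgE : measurable_fun setT (fun t => (g t)%:E) by apply/measurable_EFinP; case: dg.
have fin : (\int[mu]_t ((kratio x t * u t)%:E * (g t)%:E))%E \is a fin_num.
  rewrite -(ge0_integral_density_probability dg)//; last by move=> t; rewrite lee_fin mulr_ge0.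
  by rewrite bmf_EFin.
rewrite -[p x (d 0) * _]/(fine (p x (d 0))%:E * _) -fineM// /mixture /Rintegral.
congr fine; rewrite -ge0_integralZl//.
- apply: eq_integral => t _; rewrite -!EFinM; congr (_%:E).
  have [Tt|nT] := pselect (Theta0 t); last by rewrite gT// !(mul0r, mulr0).
  rewrite /kratio (mem_set gx) (mem_set (A := (Theta0 : set (Borel Par))) Tt) /=.
  by field; rewrite gt_eqF.
- exact: emeasurable_funM.
- by move=> t _; rewrite -EFinM lee_fin !mulr_ge0.
- by rewrite lee_fin ltW.
Qed.

Lemma mix_density_density g (dg : is_density mu g) (u : Borel Par -> R) :
  mix_density (density_probability dg) u -> is_density mu (fun t : Par => g t * u t).
Proof.
move=> [bu u0 u1]; have [mg g0 _] := dg; have [mu_ _] := bu; split.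
- exact: measurable_funM.
- by move=> t; rewrite mulr_ge0.
- under eq_integral do rewrite mulrC EFinM.
  rewrite -(ge0_integral_density_probability dg) ?bmf_EFin ?u1//.
  exact/measurable_EFinP.
Qed.

(** ** The true marginal density *)

Section marginal.
Variables (Theta : set Par) (f : Par -> R).
Hypothesis ThetaK : Theta `<=` K.
Hypothesis f_density : density_on mu Theta f.
Let m := mixture mu p Theta f.

(** Off [unbounded_ratio], the kernel vanishes on all of [K] as soon as it
    vanishes at one point. *)
Lemma marginal_bad x : ~ unbounded_ratio x -> ~ good x -> m x = 0.
Proof.
move=> nx ng; have pd : p x (d 0) <= 0 by rewrite leNgt; apply/negP => h; exact: ng.
rewrite /m (mixture_setT f_density.2) /mixture.
have E t : p x t * f t = 0.
  have [Kt|nK] := pselect (K t); last by rewrite f_density.2 ?mulr0// => /ThetaK.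
  suff -> : p x t = 0 by rewrite mul0r.
  apply/eqP; rewrite eq_le p0// andbT; apply: le_trans (ratio_le nx Kt (dK 0)) _.
  by rewrite mulr_ge0_le0// ltW.
by under eq_Rintegral do rewrite E; rewrite /Rintegral integral0.
Qed.

Lemma marginal_ge0 x : 0 <= m x.
Proof.
rewrite /m (mixture_setT f_density.2); apply: mixture_ge0; first by case: f_density.
by move=> t nK; rewrite f_density.2// => /ThetaK.
Qed.

Lemma measurable_marginal : measurable_fun setT (m : Borel chi -> R).
Proof.
rewrite /m (mixture_setT f_density.2); apply: measurable_mixture; first by case: f_density.
by move=> t nK; rewrite f_density.2// => /ThetaK.
Qed.

Lemma bad_null (M : probability (Borel chi) R) :
  (forall B, measurable B -> M B = (\int[nu]_(x in B) (m x)%:E)%E) ->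
  M (~` good) = 0%E.
Proof.
move=> ME; have mbad : measurable (~` good) by apply: measurableC; exact: measurable_good.
rewrite ME//.
rewrite (ge0_ae_eq_integral (g := cst 0%E))//; last 1 first.
- exists unbounded_ratio; split.
  + exact: measurable_unbounded_ratio.
  + exact: unbounded_ratio_null.
  + move=> x /= /not_implyP[ng ne]; apply: contrapT => nx; apply: ne.
    by rewrite marginal_bad.
- by rewrite integral0.
- by apply/measurable_EFinP; apply: measurable_funTS; exact: measurable_marginal.
- by move=> x _; rewrite lee_fin marginal_ge0.
Qed.

(** ** The information projection and the iterates *)

Section projection.
Variables (M : probability (Borel chi) R) (g0 : Par -> R).
Hypothesis ME : forall B, measurable B -> M B = (\int[nu]_(x in B) (m x)%:E)%E.
Hypothesis dg0 : is_density mu g0.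
Hypothesis g0T : forall t, ~ Theta0 t -> g0 t = 0.
Hypothesis Theta0_compact : compact Theta0.
Hypothesis g0_supp : Theta0 = density_support mu g0.
Hypothesis KL0_fin : KL nu m (mixture mu p setT g0) \is a fin_num.

Let F := density_probability dg0.
Let mk := measurable_kratio.
Let kb := kratio_bounds.
Let off_K (g : Par -> R) : (forall t, ~ Theta0 t -> g t = 0) -> forall t, ~ K t -> g t = 0.
Proof. by move=> gT t nK; apply: gT => /Theta0K. Qed.

Lemma mix_density1 (Q : probability (Borel Par) R) : mix_density Q (fun=> 1).
Proof. by split; [exact: bmf_cst|move=> t; exact: ler01|exact: mean_cst]. Qed.

(** Both densities are [p x (d 0)] times a quantity bounded above and below, so
    the divergences differ by the mean of a bounded function, the logarithm of
    the ratio of these quantities. *)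
Lemma KL_log_loss g (dg : is_density mu g) (u : Borel Par -> R) :
  (forall t, ~ Theta0 t -> g t = 0) -> mix_density (density_probability dg) u ->
  KL nu m (mixture mu p setT (fun t : Par => g t * u t)) =
  (KL nu m (mixture mu p setT g0) +
   (log_loss M (density_probability dg) kratio u -
    log_loss M F kratio (fun=> 1))%:E)%E.
Proof.
move=> gT du; have [bu u0 _] := du; have d1 := mix_density1 F.
have gu := mix_density_density du.
have guK t : ~ K t -> g t * u t = 0 by move=> nK; rewrite (off_K gT) ?mul0r.
have bl : bmf (fun x => ln (predictive (density_probability dg) kratio u x /
    predictive F kratio (fun=> 1) x)).
  rewrite (_ : (fun _ => _) = fun x => ln (predictive (density_probability dg) kratio u x) -
      ln (predictive F kratio (fun=> 1) x)); last first.
    by apply/funext => x; rewrite ln_div ?posrE// (predictive_gt0 mk c1 kb).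
  by apply: bmfB; exact: (bmf_ln_predictive mk c1 kb).
rewrite (KL_bounded_factor measurable_marginal marginal_ge0 ME
  (h := mixture mu p setT g0) (N := unbounded_ratio) _ _ _ _ bl)//.
- rewrite -EFinN; congr (_ + _%:E)%E; rewrite /log_loss opprK addrC -opprB; congr (- _).
  rewrite -meanB; [|exact: (bmf_ln_predictive mk c1 kb)|exact: (bmf_ln_predictive mk c1 kb)].
  by apply: eq_Rintegral => x _; rewrite ln_div ?posrE// (predictive_gt0 mk c1 kb).
- exact: measurable_mixture (off_K g0T).
- by move=> x; exact: mixture_ge0 (off_K g0T).
- exact: measurable_mixture.
- by move=> x; exact: mixture_ge0.
- by apply/negligibleP; [exact: measurable_unbounded_ratio|exact: unbounded_ratio_null].
- move=> x nx mx; have gx : good x by apply: contrapT => ng; rewrite marginal_bad ?eqxx in mx.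
  have [_ pd] := gx.
  have := mixture_good dg0 g0T (bmf_cst _ 1) (fun=> ler01) gx.
  under [in X in X -> _]eq_fun do rewrite mulr1.
  move=> ->; rewrite (mixture_good dg gT)//.
  have h1 := predictive_gt0 mk c1 kb x d1; have h2 := predictive_gt0 mk c1 kb x du.
  split; [exact: mulr_gt0|exact: divr_gt0|].
  have alg (a e k : R) : 0 < e -> a * k = a * e * (k / e) by move=> e0; field; rewrite gt_eqF.
  exact: alg.
Qed.

Definition optimal_loss : R :=
  inf [set log_loss M F kratio u | u in [set u | mix_density F u]].

Lemma has_inf_log_loss :
  has_inf [set log_loss M F kratio u | u in [set u | mix_density F u]].
Proof.
split; first by exists (log_loss M F kratio (fun=> 1)); exists (fun=> 1) => //; exact: mix_density1.
exists (- ln (c + 1)) => _ [u du <-]; rewrite lerN2.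
apply: mean_le_cst; first exact: (bmf_ln_predictive mk c1 kb).
move=> x; have /andP[_ h] := predictive_bounds mk c1 kb x du.
rewrite ler_ln ?posrE//; first exact: (predictive_gt0 mk c1 kb).
exact: lt_le_trans ltr01 c1.
Qed.

Lemma optimal_loss_le u : mix_density F u -> optimal_loss <= log_loss M F kratio u.
Proof.
by move=> du; apply: ge_inf; [exact: has_inf_log_loss.2|exists u].
Qed.

Lemma optimal_loss_adherent e : 0 < e ->
  exists2 u, mix_density F u & log_loss M F kratio u < optimal_loss + e.
Proof. by move=> e0; have [_ [u du <-] h] := inf_adherent e0 has_inf_log_loss; exists u. Qed.

(** The infimum over all densities on [Theta0] is approached by bounded
    multiples of the initial density, because the latter charges every
    neighbourhood of every point of [Theta0]. *)
Lemma optimal_loss_le_density g (dg : is_density mu g) :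
  (forall t, ~ Theta0 t -> g t = 0) ->
  optimal_loss <= log_loss M (density_probability dg) kratio (fun=> 1).
Proof.
move=> gT.
have null h (dh : is_density mu h) : (forall t, ~ Theta0 t -> h t = 0) ->
    density_probability dh (~` (Theta0 : set (Borel Par))) = 0%E.
  move=> hT; rewrite density_probabilityE -[RHS](integral0 mu (~` (Theta0 : set (Borel Par)))).
  by apply: eq_integral => t; rewrite inE => nt; rewrite hT.
have supp (U : set Par) t : open U -> U t -> Theta0 t -> (0 < F (U : set (Borel Par)))%E.
  by move=> oU Ut; rewrite [in X in X -> _]g0_supp density_probabilityE; exact.
apply/ler_addgt0Pr => e e0.
have [u du] := bounded_density_approx M mk c1 kb Theta0_compact mTheta0 kratio_continuous
  (null _ dg0 g0T) (null _ dg gT) supp e0.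
move=> h; apply: (le_trans (optimal_loss_le du)); apply: (le_trans h).
rewrite /log_loss lerD2r lerN2 le_eqVlt; apply/orP; left; apply/eqP; apply: eq_Rintegral => x _.
by congr ln; apply: eq_Rintegral => t _; rewrite mulr1.
Qed.

Lemma KL_inf_optimal_loss : KL_inf nu mu p m Theta0 =
  (KL nu m (mixture mu p setT g0) +
   (optimal_loss - log_loss M F kratio (fun=> 1))%:E)%E.
Proof.
set K0 := KL nu m (mixture mu p setT g0).
have [k kE] : exists k, K0 = k%:E by exists (fine K0); rewrite fineK.
apply/eqP; rewrite eq_le; apply/andP; split.
  apply/lee_addgt0Pr => e e0; have [u du h] := optimal_loss_adherent e0.
  have gu0 t : ~ Theta0 t -> g0 t * u t = 0 by move=> /g0T ->; rewrite mul0r.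
  apply: (@le_trans _ _ (KL nu m (mixture mu p setT (fun t : Par => g0 t * u t)))).
    apply: ereal_inf_lbound; exists (mixture mu p setT (fun t : Par => g0 t * u t)) => //.
    exists (fun t : Par => g0 t * u t); last exact: mixture_setT.
    by split=> //; exact: mix_density_density.
  rewrite (KL_log_loss g0T du) -/F -/K0 kE -!EFinD lee_fin.
  by move: (optimal_loss) h => o; lra_atoms.
apply: le_ereal_inf_tmp => _ [_ [g [dg gT] <-] <-].
rewrite (mixture_setT gT).
have d1 := mix_density1 (density_probability dg).
have := KL_log_loss gT d1; under [in X in X -> _]eq_fun do rewrite mulr1.
move=> ->; rewrite -/K0 kE -!EFinD lee_fin lerD2l lerD2r.
exact: optimal_loss_le_density.
Qed.

(** The factor [p x (d 0)] cancels from the Bayes update. *)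
Lemma PR_tilt (w : nat -> R) (y : nat -> chi) n :
  (forall i, (0 < i)%N -> 0 < w i <= 1) -> (forall i, (0 < i)%N -> good (y i)) ->
  PR mu p w y g0 n = (fun t => g0 t * tilt F kratio w y n t).
Proof.
move=> w01 gy; elim: n => [|n IH]; first by apply/funext => t /=; rewrite mulr1.
have dt := tilt_density F mk c1 kb w01 y n; have [bt t0 _] := dt.
apply/funext => t /=; rewrite IH (mixture_good dg0 g0T bt t0 (gy _ _))// /update.
have [Tt|nT] := pselect (Theta0 t); last by rewrite g0T// !(mul0r, mulr0) addr0.
have P0 := predictive_gt0 mk c1 kb (y n.+1) dt.
have [_ pd] := gy n.+1 isT.
rewrite /kratio (mem_set (gy n.+1 isT)) (mem_set (A := (Theta0 : set (Borel Par))) Tt) /= -/kratio.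
rewrite -/F; move: P0 pd.
move: (predictive _ _ _ _) (tilt _ _ _ _ _ _) (p _ (d 0)) (p _ t) (w _) (g0 t).
by move=> a e h k l o a0 h0; field; rewrite !gt_eqF.
Qed.

Lemma KL_excess (w : nat -> R) (y : nat -> chi) n :
  (forall i, (0 < i)%N -> 0 < w i <= 1) -> (forall i, (0 < i)%N -> good (y i)) ->
  (KL nu m (mixture mu p setT (PR mu p w y g0 n)) - KL_inf nu mu p m Theta0)%E =
  (log_loss M F kratio (tilt F kratio w y n) - optimal_loss)%:E.
Proof.
move=> w01 gy; have dt := tilt_density F mk c1 kb w01 y n.
rewrite KL_inf_optimal_loss PR_tilt// (KL_log_loss g0T dt).
rewrite -(fineK KL0_fin) -/F.
move: (fine _) (log_loss _ _ _ _) (log_loss _ _ _ _) optimal_loss => k l l' o.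
rewrite (_ : l' - o = (k + (l' - l)) - (k + (o - l))); last by ring.
by rewrite (EFinB (k + (l' - l))) (EFinD k (l' - l)) (EFinD k (o - l)).
Qed.

End projection.

End marginal.

End normalised_kernel.

(** * Decay of dependence as decorrelation *)

Section process_decorrelation.
Context {R : realType} dO (Omega : measurableType dO) (P : probability Omega R).
Variables (chi : ptopologicalType).
Variables (nu : {sigma_finite_measure set (Borel chi) -> \bar R}).
Variables (X : nat -> {RV P >-> Borel chi}) (m : Borel chi -> R) (c0 rho : R).
Variable mcond : forall i : nat, nat -> i.-tuple (Borel chi) -> chi -> R.
Hypothesis mm : measurable_fun setT m.
Hypothesis m0 : forall x, 0 <= m x.
Hypothesis X_marginal : forall i, (0 < i)%N -> has_density nu (X i) m.
Hypothesis mcond_density : forall i n, (0 < i)%N -> (0 < n)%N ->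
  is_cond_density nu X (i + n) (@mcond i n).
Hypothesis c0_gt0 : 0 < c0.
Hypothesis rho_itv : 0 < rho < 1.
Hypothesis dependence : forall n, (0 < n)%N ->
  (ereal_sup [set chi2_dependence nu X m (@mcond i n) | i in [set i | (0 < i)%N]]
     <= (c0 ^+ 2 * rho ^+ (2 * n))%:E)%E.

Let M : probability (Borel chi) R := distribution P (X 1).

Let ME B : measurable B -> M B = (\int[nu]_(x in B) (m x)%:E)%E.
Proof. exact: X_marginal. Qed.

Let law i B : (0 < i)%N -> measurable B -> distribution P (X i) B = M B.
Proof. by move=> i0 mB; rewrite ME// X_marginal. Qed.

Lemma mean_law i (h : Borel chi -> R) : (0 < i)%N -> measurable_fun setT h ->
  (forall x, 0 <= h x) -> \int[P]_om h (X i om) = \int[M]_x h x.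
Proof.
move=> i0 mh h0; rewrite /Rintegral.
have mhE : measurable_fun setT (EFin \o h) by exact/measurable_EFinP.
have h0E x : (0 <= (EFin \o h) x)%E by rewrite lee_fin.
rewrite -(ge0_integral_distribution (X i) mhE h0E); congr fine.
by apply: eq_measure_integral => B mB _; exact: law.
Qed.

Lemma measurable_past k : measurable_fun setT (past X k).
Proof.
apply/measurable_fun_tnthP => j.
rewrite (_ : _ \o _ = X j.+1)//; apply/funext => om.
by rewrite /past /= tnth_mktuple.
Qed.

Let past_mfun k := isMeasurableFun.Build _ _ _ _ _ (@measurable_past k).
Let past_rv k : {RV P >-> k.-tuple (Borel chi)} := HB.pack (past X k) (past_mfun k).

(** For [k = 0] the history is empty and the two means are equal, since [X i] has
    law [M]. *)
Lemma process_decorrelation k i (Phi : k.-tuple (Borel chi) -> Borel chi -> R) c :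
  (k < i)%N -> 0 <= c ->
  measurable_fun setT (fun z : k.-tuple (Borel chi) * Borel chi => Phi z.1 z.2) ->
  (forall v x, 0 <= Phi v x <= c) ->
  `|\int[P]_om Phi (past X k om) (X i om) -
    \int[P]_om \int[M]_x Phi (past X k om) x| <= c * (c0 * rho ^+ (i - k)).
Proof.
move=> ki cge0 mPhi Phic; have /andP[rho0 _] := rho_itv.
have s0 : 0 < c0 * rho ^+ (i - k) by rewrite mulr_gt0// exprn_gt0.
have i0 : (0 < i)%N by exact: leq_ltn_trans ki.
have [k0|k0] := posnP k.
  subst k; have v0 om : past X 0 om = [tuple] by exact: tuple0.
  have mPhi0 : measurable_fun setT (Phi [tuple]).
    exact: (measurableT_comp mPhi (pair1_measurable [tuple])).
  under eq_Rintegral do rewrite v0; under [X in _ - X]eq_Rintegral do rewrite v0.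
  rewrite mean_cst mean_law// ?subrr ?normr0; last by move=> x; have /andP[] := Phic [tuple] x.
  by rewrite mulr_ge0// ltW.
have ik : (0 < i - k)%N by rewrite subn_gt0.
have kik : (k + (i - k))%N = i by rewrite subnKC// ltnW.
have := mcond_density k0 ik; rewrite kik => -[mg g0 gE].
have chi2 : (\int[P]_om \int[nu]_x
   ((mcond (i - k) (past X k om) x / m x - 1) ^+ 2 * m x)%:E
     <= ((c0 * rho ^+ (i - k)) ^+ 2)%:E)%E.
  rewrite exprMn -exprM mulnC; apply: le_trans (dependence ik).
  by apply: ereal_sup_ubound; exists k.
have XE B : measurable B -> distribution P (X i) B = M B by exact: law.
exact: (decorrelation_chi2 (Y := past_rv k) mg g0 gE mm m0 ME XE s0 chi2 cge0 mPhi Phic).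
Qed.

End process_decorrelation.

Theorem theorem3p3
  (R : realType) (dO : measure_display) (Omega : measurableType dO)
  (P : probability Omega R) (chi : ptopologicalType) (q : nat)
  (nu : {sigma_finite_measure set (Borel chi) -> \bar R})
  (mu : {sigma_finite_measure set (Borel 'rV[R]_q) -> \bar R})
  (Theta Theta0 That ThetaH : set 'rV[R]_q) (chic : set chi)
  (p : chi -> 'rV[R]_q -> R)
  (f f0 : 'rV[R]_q -> R) (m : chi -> R)
  (X : nat -> {RV P >-> Borel chi})
  (mcond : forall i : nat, nat -> i.-tuple (Borel chi) -> chi -> R)
  (c0 rho : R) (w : nat -> R) (ftilde : 'rV[R]_q -> R)
  (* parameter sets and kernel *)
  (That_closed : closed That)
  (That_convex : convex_set (That : set (convex_lmodType 'rV[R]_q)))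
  (Theta_That : Theta `<=` That) (Theta0_That : Theta0 `<=` That)
  (p_density : forall t, That t -> is_density nu (p^~ t))
  (* true mixing density and common marginal of the observations *)
  (Theta_compact : compact Theta)
  (f_density : density_on mu Theta f)
  (f_support : Theta = density_support mu f)
  (m_def : m = mixture mu p Theta f)
  (X_marginal : forall i, (0 < i)%N -> has_density nu (X i) m)
  (* decay of dependence *)
  (mcond_density : forall i n, (0 < i)%N -> (0 < n)%N ->
     is_cond_density nu X (i + n) (mcond i n))
  (c0_gt0 : 0 < c0) (rho_itv : 0 < rho < 1)
  (dependence : forall n, (0 < n)%N ->
     (ereal_sup [set chi2_dependence nu X m (mcond i n)
                | i in [set i | (0 < i)%N]]
        <= (c0 ^+ 2 * rho ^+ (2 * n))%:E)%E)
  (* initial density and Kullback-Leibler minimizer *)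
  (Theta0_compact : compact Theta0)
  (f0_density : density_on mu Theta0 f0)
  (f0_support : Theta0 = density_support mu f0)
  (K0_finite : KL nu m (mixture mu p setT f0) \is a fin_num)
  (ftilde_density : density_on mu Theta0 ftilde)
  (ftilde_min :
     KL nu m (mixture mu p Theta0 ftilde) = KL_inf nu mu p m Theta0)
  (ftilde_unique : forall g, density_on mu Theta0 g ->
     KL nu m (mixture mu p Theta0 g) = KL_inf nu mu p m Theta0 ->
     {ae mu, forall t, g t = ftilde t})
  (* conditions *)
  (B1 : condB1 w) (B2' : condB2' nu p That) (B3 : condB3 nu p That)
  (B4 : condB4 p That)
  (ThetaH_finite : finite_set ThetaH) (ThetaH_That : ThetaH `<=` That)
  (chic_compact : compact chic)
  (C1 : condC1 p Theta ThetaH chic) (C2 : condC2 p Theta chic)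
  (C3 : condC3 p Theta chic) :
  {ae P, forall om : Omega,
    (fun n : nat =>
       KL nu m (mixture mu p setT (PR mu p w (fun i => X i om) f0 n))
       - KL_inf nu mu p m Theta0)%E @ \oo --> (0 : \bar R)%E}.
Proof.
have compact_borel (A : set 'rV[R]_q) : compact A -> measurable (A : set (Borel 'rV[R]_q)).
  move=> cA; rewrite -[A]setCK; apply: measurableC; apply: open_borel.
  by apply: closed_openC; apply: compact_closed => //; exact: norm_hausdorff.
have [df0 f0T] := f0_density.
pose K := Theta `|` Theta0.
have KThat : K `<=` That by move=> t [/Theta_That|/Theta0_That].
have [d dK ddense] : exists2 d : nat -> 'rV[R]_q, (forall n, K (d n)) &
    forall t e, K t -> 0 < e -> exists n, (ball t e) (d n).
  apply: compact_dense_seq; first exact: compactU.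
  apply: contrapT => K0; case: df0 => _ _; rewrite (eq_integral (cst 0%E)).
    by rewrite integral0 => /esym/eqP; rewrite onee_eq0.
  by move=> t _; rewrite f0T// => Tt; apply: K0; exists t; right.
have mK : measurable (K : set (Borel 'rV[R]_q)) by apply: compact_borel; exact: compactU.
have mTheta0 := compact_borel _ Theta0_compact.
have ThetaK : Theta `<=` K by move=> t; left.
have Theta0K : Theta0 `<=` K by move=> t; right.
have pm t : K t -> measurable_fun setT (p^~ t : Borel chi -> R).
  by move=> /KThat /p_density[].
have p0 x t : K t -> 0 <= p x t by move=> /KThat /p_density[].
have pc x : {within K, continuous (p x)}.
  by apply: (continuous_subspaceW KThat); have [] := B4 x.
have [c c_gt0 hc] := B2'.
(* The moments are taken under the parameter [s] itself, whose density is
   positive on the whole set to be shown null. *)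
have ratio_null s t : K s -> K t ->
    nu ([set x | c * p x t < p x s] : set (Borel chi)) = 0%E.
  move=> Ks Kt; apply: moment_ratio_bound => // [|||x|j j0];
    [exact: pm|exact: pm|by move=> x; exact: p0|exact: p0|].
  apply: le_trans (ltW (hc j j0)); apply: ereal_sup_ubound.
  by exists ((s, t), s) => //; split; [split|]; exact: KThat.
subst m; set m := mixture mu p Theta f in X_marginal K0_finite dependence ftilde_min *.
have mm : measurable_fun setT (m : Borel chi -> R).
  exact: (measurable_marginal dK ddense mK pm p0 pc ThetaK f_density).
have m0 (x : Borel chi) : 0 <= m x by exact: (marginal_ge0 p0 ThetaK f_density).
pose M : probability (Borel chi) R := distribution P (X 1).
have ME B : measurable B -> M B = (\int[nu]_(x in B) (m x)%:E)%E by exact: X_marginal.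
pose r := kratio p Theta0 d c.
have mr := measurable_kratio c dK ddense mK mTheta0 Theta0K pm p0 pc.
(* The bound [c + 1], instead of [c], is at least [1]. *)
have b1 : 1 <= c + 1 by rewrite lerDr ltW.
have rb := kratio_bounds dK ddense Theta0K pc c_gt0.
pose kappa := optimal_loss p Theta0 d c M df0.
have kle u (du : mix_density (density_probability df0) u) :=
  optimal_loss_le dK ddense mK mTheta0 Theta0K pm p0 pc c_gt0 M du.
have kad e (e0 : 0 < e) :=
  optimal_loss_adherent dK ddense mK mTheta0 Theta0K pm p0 pc c_gt0 M df0 e0.
have deco := process_decorrelation mm m0 X_marginal mcond_density c0_gt0 rho_itv dependence.
have mX i : measurable_fun setT (X i : Omega -> Borel chi) by exact: measurable_funP.
have loss_cvg := ae_excess_cvg0 (point : Borel chi) mr b1 rb B1 mX (ltW c0_gt0) rho_itv kle kad deco.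
have [w01 _ _ _] := B1.
have good_ae : {ae P, forall om, forall i, (0 < i)%N -> good p d c (X i om)}.
  apply: ae_foralln => i; case: i => [|i]; first by apply: aeW.
  have mbad : measurable (~` good p d c).
    by apply: measurableC; exact: (measurable_good c dK pm).
  exists (X i.+1 @^-1` (~` good p d c)); split.
  - by rewrite -[X in measurable X]setTI; exact: (mX i.+1).
  - have := bad_null dK ddense mK pm p0 pc c_gt0 ratio_null ThetaK f_density (M := M) ME.
    by rewrite ME// -(X_marginal i.+1 isT _ mbad).
  - by move=> om /= ng h; apply: ng.
apply: filterS2 loss_cvg good_ae => om loss_cvg gX.
have E n := KL_excess dK ddense mK mTheta0 Theta0K pm p0 pc c_gt0 ratio_null ThetaK
  f_density ME df0 f0T Theta0_compact f0_support K0_finite n w01 gX.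
apply: cvg_EFin; first by apply: nearW => n; rewrite E.
rewrite (_ : _ \o _ = fun n => log_loss M (density_probability df0) r
  (tilt (density_probability df0) r w (X^~ om) n) - kappa)//.
by apply/funext => n /=; rewrite E.
Qed.
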